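(* Fix $(\alpha,\beta,\theta)\in(0,1)^3$ such that $\alpha<\tilde\eta^{hyp}_\theta(\beta)$. Consider testing $H_0^{(p)}$: $X_i\stackrel{iid}{\sim}N(0,I_p)$, $1\le i\le n$, against $H_1^{(p)}$: the $X_i$'s are generated from the ARW model with parameters $(\alpha,\beta,\theta)$. As $p\to\infty$: (i) $\mathrm{Err}(\hat T^{(sa)}_*,\alpha,\beta,\theta)\to0$ if $0<\beta<1/2$; (ii) $\mathrm{Err}(\hat T^{(hc)},\alpha,\beta,\theta)\to0$ if $1/2<\beta<1$.
   Context: ARW model. For each $p$ let $n=n_p=p^\theta$ (treated as an integer), $\epsilon_p=p^{-\beta}$, $\tau_p=p^{-\alpha}$. The labels $\ell_1,\dots,\ell_n$ are i.i.d. uniform on $\{-1,1\}$; the coordinates of $\mu\in\mathbb R^p$ are i.i.d., equal to $\tau_p$ with probability $\epsilon_p$ and to $0$ with probability $1-\epsilon_p$; $Z_1,\dots,Z_n$ are i.i.d. $N(0,I_p)$; all are independent; $X_i=\ell_i\mu+Z_i$, $1\le i\le n$, are the rows of $X=[x_1,\dots,x_p]\in\mathbb R^{n\times p}$ (columns $x_j$). Testing error. $\mathrm{Err}(\hat T,\alpha,\beta,\theta)=P_{H_0^{(p)}}(\hat T\text{ rejects }H_0^{(p)})+P_{H_1^{(p)}}(\hat T\text{ accepts }H_0^{(p)})$, with probabilities over $(\ell,\mu,Z)$. Tests. $\hat T^{(sa)}_*$ rejects $H_0^{(p)}$ iff $(2n)^{-1/2}[p\|\bar x\|^2-n]\ge2\sqrt{2\log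 p}$, where $\bar x=p^{-1}\sum_{j=1}^px_j$. The Higher Criticism test $\hat T^{(hc)}$: let $Q(j)=(2n)^{-1/2}(\|x_j\|^2-n)$; for $1\le j\le p$ let $\pi_j=P\{(2n)^{-1/2}[\chi^2_n(0)-n]\ge Q(j)\}$ be the P-value ($\chi^2_n(0)$ a central chi-square variable with $n$ degrees of freedom, independent of the data); sort $\pi_{(1)}<\pi_{(2)}<\dots<\pi_{(p)}$; let $HC_{p,i}=\sqrt p\,[(i/p)-\pi_{(i)}]/[\pi_{(i)}(1-\pi_{(i)})]^{1/2}$ and $HC_p^*=\max_{1\le i\le p/2}HC_{p,i}$; $\hat T^{(hc)}$ rejects $H_0^{(p)}$ iff $HC_p^*\ge2\sqrt{2\log\log p}$. The curve: $\tilde\eta^{hyp}_\theta(\beta)=\max\{(2+\theta-4\beta)/4,\ \theta/4\}$. *)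

(* Defs.v *)
From HB Require Import structures.
From mathcomp Require Import all_boot all_order all_algebra.
From mathcomp Require Import all_classical all_reals all_analysis.
From mathcomp Require Import measurable_realfun.

Set Implicit Arguments.
Unset Strict Implicit.
Unset Printing Implicit Defensive.

Import Order.TTheory GRing.Theory Num.Theory.
Import numFieldNormedType.Exports.

Local Open Scope classical_set_scope.
Local Open Scope ring_scope.

Section Probability.
Context {R : realType} {d : measure_display} {Omega : measurableType d}.
Variable P : probability Omega R.

Definition mutually_independent (I : finType) (V : I -> {RV P >-> R}) : Prop :=
  forall (J : {set I}) (A : I -> set R),
    (forall i, i \in J -> measurable (A i)) ->
    (P (\bigcap_(i in [set` J]) (V i @^-1` A i)) =
     \prod_(i in J) P (V i @^-1` A i))%E.

(* Compared on measurable sets only: elsewhere the values of a measure are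
   not specified. *)
Definition standard_normal (V : {RV P >-> R}) : Prop :=
  forall A : set R, measurable A -> distribution P V A = normal_prob 0 1 A.

Variables n p : nat.

(* The n rows are i.i.d. N(0, I_p), i.e. the n * p entries are i.i.d. N(0, 1). *)
Definition gaussian_sample (Z : 'I_n -> 'I_p -> {RV P >-> R}) : Prop :=
  mutually_independent (fun ij : 'I_n * 'I_p => Z ij.1 ij.2) /\
  forall i j, standard_normal (Z i j).

Definition null_model (X : Omega -> 'M[R]_(n, p)) : Prop :=
  exists2 Z : 'I_n -> 'I_p -> {RV P >-> R},
    gaussian_sample Z & forall w, X w = \matrix_(i, j) Z i j w.

Definition arw_variables (l : 'I_n -> {RV P >-> R}) (mu : 'I_p -> {RV P >-> R})
    (Z : 'I_n -> 'I_p -> {RV P >-> R}) (k : 'I_n + 'I_p + 'I_n * 'I_p) :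
    {RV P >-> R} :=
  match k with
  | inl (inl i) => l i
  | inl (inr j) => mu j
  | inr (i, j) => Z i j
  end.

Definition signal_strength (alpha : R) : R := p%:R `^ (- alpha).
Definition signal_fraction (beta : R) : R := p%:R `^ (- beta).

Definition arw_model (alpha beta : R) (X : Omega -> 'M[R]_(n, p)) : Prop :=
  exists (l : 'I_n -> {RV P >-> R}) (mu : 'I_p -> {RV P >-> R})
         (Z : 'I_n -> 'I_p -> {RV P >-> R}),
    [/\ mutually_independent (arw_variables l mu Z),
        forall i, P [set w | l i w = 1] = (2^-1)%:E /\
                  P [set w | l i w = -1] = (2^-1)%:E,
        forall j,
          P [set w | mu j w = signal_strength alpha] = (signal_fraction beta)%:E
          /\ P [set w | mu j w = 0] = (1 - signal_fraction beta)%:E,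
        forall i j, standard_normal (Z i j)
      & forall w, X w = \matrix_(i, j) (l i w * mu j w + Z i j w)].

End Probability.

Section ChiSquare.
Context {R : realType}.

Let RM := measurableTypeR R.

Definition add_sqr (x : RM * RM) : RM := (x.1 : R) + (x.2 : R) ^+ 2.

Lemma measurable_add_sqr : measurable_fun [set: RM * RM] add_sqr.
Proof.
apply: (@measurable_funD _ _ R); first exact: measurable_fst.
apply: (@measurable_funX _ _ R); exact: measurable_snd.
Qed.

HB.instance Definition _ :=
  isMeasurableFun.Build _ _ _ _ add_sqr measurable_add_sqr.

(* The law of the sum of the squares of n independent N(0, 1) variables. *)
Fixpoint chi2_prob (n : nat) : probability RM R :=
  match n with
  | 0 => dirac (0 : RM)
  | m.+1 => distribution (chi2_prob m \x normal_prob 0 1)%E add_sqr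
  end.

End ChiSquare.

Section Tests.
Context {R : realType}.
Variables n p : nat.
Implicit Types X : 'M[R]_(n, p).

(* The library's norm on matrices is the sup norm, not the Euclidean one. *)
Definition sqnorm (v : 'cV[R]_n) : R := \sum_(i < n) v i 0 ^+ 2.

Definition standardize (x : R) : R := (Num.sqrt (2 * n%:R))^-1 * (x - n%:R).

Definition xbar X : 'cV[R]_n := p%:R^-1 *: \sum_(j < p) col j X.

Definition sa_test X : bool :=
  2 * Num.sqrt (2 * ln p%:R) <= standardize (p%:R * sqnorm (xbar X)).

Definition Qstat X (j : 'I_p) : R := standardize (sqnorm (col j X)).

Definition pvalue X (j : 'I_p) : R :=
  fine (chi2_prob n [set x : R | Qstat X j <= standardize x]).

(* pi_(i), for 1 <= i <= p. *)
Definition sorted_pvalue X (i : nat) : R :=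
  nth 0 (sort <=%R [seq pvalue X j | j <- enum 'I_p]) i.-1.

Definition HC X (i : nat) : R :=
  Num.sqrt p%:R * (i%:R / p%:R - sorted_pvalue X i)
    / Num.sqrt (sorted_pvalue X i * (1 - sorted_pvalue X i)).

(* The maximum over the integers 1 <= i <= p / 2; it is -oo if there are none,
   i.e. if p < 2. *)
Definition HC_max X : \bar R := \big[maxe/-oo%E]_(1 <= i < p./2.+1) (HC X i)%:E.

Definition hc_test X : bool :=
  ((2 * Num.sqrt (2 * ln (ln p%:R)))%:E <= HC_max X)%E.

(* A test maps the data to true when it rejects the null hypothesis. *)
Definition Err d0 (Omega0 : measurableType d0) (P0 : probability Omega0 R)
    (X0 : Omega0 -> 'M[R]_(n, p))
    d1 (Omega1 : measurableType d1) (P1 : probability Omega1 R)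
    (X1 : Omega1 -> 'M[R]_(n, p))
    (T : 'M[R]_(n, p) -> bool) : \bar R :=
  (P0 [set w | T (X0 w)] + P1 [set w | ~~ T (X1 w)])%E.

End Tests.

Definition eta_hyp {R : realType} (theta beta : R) : R :=
  Num.max ((2 + theta - 4 * beta) / 4) (theta / 4).

(* Main.v *)
Require Import Defs.
From HB Require Import structures.
From mathcomp Require Import all_boot all_order all_algebra.
From mathcomp Require Import all_classical all_reals all_analysis.
From mathcomp Require Import measurable_realfun ring lra.
Import Order.TTheory GRing.Theory Num.Theory.
Import numFieldNormedType.Exports.
Local Open Scope ring_scope.

(** Under the alternative each test is driven by one statistic.  The squared
    norm of the average column has mean shift [n p m^2], where [m] is the
    average of [mu], and the signal columns have mean shift [n tau^2]; both
    beat the noise by a power of [p], so second moments suffice, except that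
    Chernoff's bound for the chi-square law is needed to make the smallest
    p-value at most [p^-2].  Under the null hypothesis the first statistic is
    handled by Chebyshev's inequality.

    The delicate point is that Higher Criticism stays below
    [2 * sqrt (2 log log p)] under the null hypothesis.  There the p-values
    are independent and stochastically larger than uniform variables.  With
    [N x] the number of p-values at most [x], the process [(1 + c / x) ^ N x]
    is a reverse martingale of mean at most [(1 + c) ^ p], which controls all
    levels [x] of a block at once.  As the threshold is twice the sharp one,
    blocks of ratio 4 lose little enough: a block fails with probability
    [(log p) ^ (-4/3)], and there are about [log p] of them. *)

Set Implicit Arguments.
Unset Strict Implicit.
Unset Printing Implicit Defensive.

(** * A maximal inequality for counts *)

Section Ville.
Variables (R : realFieldType) (p m : nat).

(** Only finitely many levels matter, so p-values are replaced by the cells between them and the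
    maximal inequality becomes one about finite sums of products. A crossing at rank [i] means that
    at least [i] p-values lie below [lam / p], where [lam + s * sqrt lam = i] and
    [s = 2 * sqrt (log log p)]; the factor [sqrt 2] between [s] and the threshold pays for [1 - pi],
    of which only [1 - pi >= 1 / 2] is used. With [c = s * sqrt L / p] on the block
    [L <= lam <= 4 * L] the exponent gained is at least [s ^ 2 / 3], against about [s ^ 2 / 2] when
    [c] is tuned to a single level; this is where the exponent 4/3 comes from. The estimate is of
    Gaussian type and needs [lam >= 16 * s ^ 2]. Below that the counts behave like Poisson variables
    and the tails are heavy: for uniform p-values, the smallest one alone produces a crossing with
    probability of order [s ^ (-2)]. No more than a negative power of [s] can be hoped for there,
    and two cruder ranges, with [c = 1 / p] and [c = sqrt s / p], are enough. *)

Definition count_below (b : {ffun 'I_p -> 'I_m.+1}) (k : 'I_m) : nat :=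
  #|[set j | (b j <= k)%N]|.

Definition weight (q : 'I_p -> 'I_m.+1 -> R) (b : {ffun 'I_p -> 'I_m.+1}) : R :=
  \prod_j q j (b j).

(** With levels explored downwards this is the first crossing met, the analogue of a stopping time:
    for distinct [k] in [S] the events are disjoint, and each is decided by the points above level
    [k] and the count at [k]. *)
Definition last_crossing (S : {set 'I_m}) (r : 'I_m -> nat) (k : 'I_m)
    (b : {ffun 'I_p -> 'I_m.+1}) : bool :=
  (r k <= count_below b k)%N &&
  [forall k' in S, (k < k')%N ==> (count_below b k' < r k')%N].

(** Forgets where a point lies below level [k] by merging the cells up to [k]: the finite substitute
    for conditioning on what happens above that level. *)
Definition clip (k : 'I_m) (e : 'I_m.+1) : 'I_m.+1 :=
  if (e <= k)%N then inord k else e.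

Lemma clip_le (k k' : 'I_m) e : (k <= k')%N -> (clip k e <= k')%N = (e <= k')%N.
Proof.
move=> kk'; rewrite /clip; case: ifP => // ek.
rewrite inordK ?kk' ?(leq_trans ek kk')//.
by rewrite ltnS ltnW.
Qed.

Lemma count_below_clip (k k' : 'I_m) (b : {ffun 'I_p -> 'I_m.+1}) :
  (k <= k')%N -> count_below [ffun j => clip k (b j)] k' = count_below b k'.
Proof.
move=> kk'; apply: eq_card => j; rewrite !inE ffunE; exact: clip_le.
Qed.

Lemma last_crossing_clip S r (k : 'I_m) (b : {ffun 'I_p -> 'I_m.+1}) :
  last_crossing S r k [ffun j => clip k (b j)] = last_crossing S r k b.
Proof.
rewrite /last_crossing count_below_clip//; congr (_ && _).
apply: eq_forallb => k'; case: (k' \in S) => //=.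
by case: ltnP => //= kk'; rewrite count_below_clip// ltnW.
Qed.

(** An event blind to clipping is a union of fibres of the clipping map, and the weight of a fibre
    factors into masses of merged cells. *)
Lemma weight_clip (q : 'I_p -> 'I_m.+1 -> R) (k : 'I_m)
    (A : pred {ffun 'I_p -> 'I_m.+1}) :
    (forall b : {ffun 'I_p -> 'I_m.+1}, A [ffun j => clip k (b j)] = A b) ->
  \sum_(b | A b) weight q b =
  \sum_(e | A e) \prod_j \sum_(d | clip k d == e j) q j d.
Proof.
move=> Ak.
rewrite (partition_big (fun b : {ffun 'I_p -> 'I_m.+1} =>
  [ffun j => clip k (b j)]) A) /=; last by move=> b; rewrite Ak.
apply: eq_bigr => e Ae.
rewrite bigA_distr_big_dep /=.
apply: eq_bigl => b; apply/andP/familyP => [[_ /eqP <-] j|be].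
  by rewrite unfold_in /= ffunE.
have E : [ffun j => clip k (b j)] = e.
  by apply/ffunP => j; rewrite ffunE; have := be j; rewrite unfold_in => /eqP.
by rewrite -Ak E.
Qed.

(* Ville's inequality for the reverse martingale [(1 + c / x) ^ N x], where
   [N x] counts the points below level [x].  Conditioning is avoided: adding
   mass [c] to the lowest cell multiplies the weight of any event read off
   above level [x_k], with count [N], by at least [(1 + c / x_k) ^ N]. *)
Lemma ville_inequality (q : 'I_p -> 'I_m.+1 -> R) (x : 'I_m -> R)
    (S : {set 'I_m}) (r : 'I_m -> nat) (c K : R) :
    (forall j e, 0 <= q j e) -> (forall j, \sum_e q j e = 1) ->
    (forall j (k : 'I_m), \sum_(e : 'I_m.+1 | (e <= k)%N) q j e <= x k) ->
    (forall k, 0 < x k) -> 0 <= c -> 0 < K ->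
    (forall k, k \in S -> K <= (1 + c / x k) ^+ r k) ->
  \sum_(b | [exists k in S, (r k <= count_below b k)%N]) weight q b
    <= (1 + c) ^+ p / K.
Proof.
move=> q0 q1 qx x0 c0 K0 KS.
pose q' j e : R := q j e + (if e == ord0 then c else 0).
have q'0 j e : 0 <= q' j e by rewrite addr_ge0//; case: ifP.
have w0 b : 0 <= weight q b by apply: prodr_ge0.
have w'0 b : 0 <= weight q' b by apply: prodr_ge0.
have step k : k \in S ->
    K * (\sum_(b | last_crossing S r k b) weight q b)
    <= \sum_(b | last_crossing S r k b) weight q' b.
  move=> kS; rewrite !(@weight_clip _ k)//; try exact: last_crossing_clip.
  rewrite mulr_sumr; apply: ler_sum => e /andP[rk _].
  have sq0 j : 0 <= \sum_(d | clip k d == e j) q j d by apply: sumr_ge0.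
  have cx1 : 1 <= 1 + c / x k by rewrite lerDl divr_ge0// ltW.
  (* Only the points in the merged cell change: its mass goes from some [F <= x k] to [F + c], a
     factor of at least [1 + c / x k], and the event supplies at least [r k] such points. *)
  apply: (@le_trans _ _
    (\prod_(j | (e j <= k)%N) (1 + c / x k) *
     \prod_j \sum_(d | clip k d == e j) q j d)).
    apply: ler_wpM2r; first exact: prodr_ge0.
    rewrite prodr_const (le_trans (KS _ kS))// ler_weXn2l//.
    by rewrite (leq_trans rk)// /count_below cardsE.
  rewrite big_mkcond -big_split /=; apply: ler_prod => j _.
  apply/andP; split.
    by rewrite mulr_ge0//; case: ifP => // _; rewrite (le_trans ler01).
  case: ifPn => [ejk|_]; last first.
    by rewrite mul1r; apply: ler_sum => d _; rewrite lerDl; case: ifP.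
  (* A clipped value at most [k] can only be [k] itself; for any other the fibre is empty and its
     mass is 0. *)
  have [ek|nek] := eqVneq (e j) (inord k); last first.
    rewrite big_pred0 ?mulr0 ?sumr_ge0// => d; apply/negbTE.
    apply: contraNneq nek => ed; move: ejk; rewrite -ed clip_le//.
    by rewrite /clip => ->.
  have clipE d : (clip k d == e j) = (d <= k)%N.
    have kE : (inord k : 'I_m.+1) = k :> nat by rewrite inordK// ltnS ltnW.
    rewrite ek /clip; case: ifPn => [|dk]; first by rewrite eqxx.
    by apply/negbTE; apply: contraNneq dk => ->; rewrite kE.
  rewrite !(eq_bigl _ _ clipE) mulrDl mul1r big_split /= lerD2l.
  rewrite -big_mkcondr /= [leRHS](big_pred1 ord0); last first.
    by move=> d; rewrite andbC; apply: andb_idr => /eqP ->.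
  rewrite mulrAC -mulrA -[leRHS]mulr1 ler_wpM2l//.
  by rewrite ler_pdivrMr ?mul1r// qx.
rewrite ler_pdivlMr// mulrC.
apply: (@le_trans _ _ (\sum_(k in S) \sum_(b | last_crossing S r k b) weight q' b)).
  apply: (@le_trans _ _
     (K * \sum_(k in S) \sum_(b | last_crossing S r k b) weight q b)).
    rewrite ler_pM2l// (exchange_big_dep predT)//= big_mkcond.
    apply: ler_sum => b _; case: ifPn => [/exists_inP[k0 k0S k0r]|_]; last first.
      by rewrite sumr_ge0.
    pose k := [arg max_(k > k0 | (k \in S) && (r k <= count_below b k)%N) (k : nat)].
    have [kS kr kmax] : [/\ k \in S, (r k <= count_below b k)%N &
        forall k', k' \in S -> (r k' <= count_below b k')%N -> (k' <= k)%N].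
      rewrite /k; case: arg_maxnP => [|i /andP[iS ir] imax]; first by rewrite k0S.
      by split => // k' k'S k'r; apply: imax; rewrite k'S.
    rewrite (bigD1 k)/= ?lerDl ?sumr_ge0//.
    rewrite kS /last_crossing kr /=; apply/forall_inP => k' k'S.
    by apply/implyP; rewrite !ltnNge; apply: contra => /(kmax _ k'S).
  by rewrite mulr_sumr; apply: ler_sum => k; exact: step.
have -> : (1 + c) ^+ p = \sum_b weight q' b.
  rewrite /weight -(bigA_distr_bigA q') /= (eq_bigr (fun=> 1 + c)).
    by rewrite prodr_const card_ord.
  by move=> j _; rewrite big_split /= q1 -big_mkcond /= big_pred1_eq.
rewrite (exchange_big_dep predT)//=; apply: ler_sum => b _.
(* The events are disjoint, so each [b] is counted at most once. *)
have [k kP|noP] := pickP (fun k => (k \in S) && last_crossing S r k b); last first.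
  by rewrite big_pred0.
rewrite (big_pred1 k)// => k'; apply/idP/eqP => [/andP[k'S /andP[rk' /forall_inP mk']]|->//].
have /andP[kS /andP[rk /forall_inP mk]] := kP.
apply/val_inj/eqP; rewrite eqn_leq; apply/andP; split; rewrite leqNgt.
  by apply/negP => kk'; have := mk _ k'S; rewrite kk' /= ltnNge rk'.
by apply/negP => kk'; have := mk' _ kS; rewrite kk' /= ltnNge rk.
Qed.

End Ville.

(** * Growth of the martingale along the crossing boundary *)

Section Growth.
Variable R : realType.
Implicit Types h s lam : R.

(** This is [ln (1 + h) >= h - h ^ 2 / 2]. The auxiliary [g] does not increase on positive
    arguments, because [1 - c <= 1 - (c - c ^ 2 / 2) <= exp (- (c - c ^ 2 / 2))]. *)
Lemma expR_sub_half_sqr h : 0 <= h -> expR (h - h ^+ 2 / 2) <= 1 + h.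
Proof.
rewrite le_eqVlt => /predU1P[<-|h0]; first by rewrite expr0n/= mul0r subr0 expR0 addr0.
pose g : R -> R := fun x => expR (x - x ^+ 2 / 2) - x.
have dg (x : R) : is_derive x 1 g (expR (x - x ^+ 2 / 2) * (1 - x) - 1).
  rewrite /g; apply: is_deriveB; apply: is_derive1_comp.
  apply: is_deriveB; apply: is_derive_eq.
  by rewrite /GRing.scale /=; field.
have [|c] := @MVT _ g _ 0 h h0 (fun x _ => dg x).
  apply: derivable_within_continuous => x _; apply: ex_derive.
rewrite in_itv /= => /andP[c0 ch].
rewrite /g expr0n /= mul0r !subr0 expR0 => E.
have : expR (c - c ^+ 2 / 2) * (1 - c) <= 1.
  rewrite mulrC -ler_pdivlMr ?expR_gt0// -expRN mul1r.
  apply: le_trans (expR_ge1Dx _); have := sqr_ge0 c; nra.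
have := h0; nra.
Qed.

Lemma exp_growth s lam a r : 0 < lam -> 0 <= s -> 0 <= a ->
  r%:R = lam + s * Num.sqrt lam ->
  expR ((lam + s * Num.sqrt lam) * (a / lam - (a / lam) ^+ 2 / 2))
    <= (1 + a / lam) ^+ r.
Proof.
move=> lam0 s0 a0 <-; rewrite mulrC expRM_natr lerXn2r ?nnegrE ?expR_ge0//.
  by rewrite addr_ge0// divr_ge0// ltW.
by apply: expR_sub_half_sqr; rewrite divr_ge0// ltW.
Qed.

(* In the next three lemmas [lam / p] is the level below which [r] p-values
   fall when Higher Criticism crosses its threshold at [r], and the right-hand
   side is the value there of the martingale with [c = a / p]. *)
Lemma growth_small s lam r : 0 < lam -> lam <= s ->
  r%:R = lam + s * Num.sqrt lam ->
  Num.sqrt s <= (1 + 1 / lam) ^+ r.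
Proof.
move=> lam0 ls rE.
have s0 := lt_le_trans lam0 ls.
have sl0 : 0 < Num.sqrt lam by rewrite sqrtr_gt0.
have E := sqr_sqrtr (ltW lam0); have Es := sqr_sqrtr (ltW s0).
have sls : Num.sqrt lam <= Num.sqrt s by rewrite ler_sqrt// ltW.
(* The increment [1 / lam] may be large here, so Bernoulli's inequality replaces the exponential
   bound: [r / lam >= s / sqrt lam >= sqrt s]. *)
apply: (@le_trans _ _ (1 + r%:R * (1 / lam))).
  rewrite rE; move: (Num.sqrt s) (Num.sqrt lam) sl0 sls E Es => t y y0 yt <- <-.
  have -> : 1 + (y ^+ 2 + t ^+ 2 * y) * (1 / y ^+ 2) = 2 + t ^+ 2 / y.
    by field; rewrite gt_eqF.
  have : t <= t ^+ 2 / y by rewrite ler_pdivlMr// expr2 ler_wpM2l// (le_trans (ltW y0)).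
  lra.
rewrite mulr_natl.
elim: r {rE} => [|r IH]; first by rewrite mulr0n addr0 expr0.
rewrite exprS mulrSr.
have d0 : 0 <= 1 / lam by rewrite divr_ge0// ltW.
have := ler_wpM2l (addr_ge0 ler01 d0) IH.
have : 0 <= (1 / lam) *+ r by rewrite mulrn_wge0.
nra.
Qed.

Lemma growth_medium s lam r : 1 <= s -> s <= lam -> lam <= 16 * s ^+ 2 ->
  r%:R = lam + s * Num.sqrt lam ->
  expR (Num.sqrt s / 8 - 2^-1) * expR (Num.sqrt s)
    <= (1 + Num.sqrt s / lam) ^+ r.
Proof.
move=> s1 sl l16 rE; have s0 : 0 < s by lra.
have lam0 : 0 < lam by lra.
apply: le_trans (exp_growth lam0 (ltW s0) (sqrtr_ge0 _) rE).
rewrite -expRD ler_expR.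
have E := sqr_sqrtr (ltW lam0); have Es := sqr_sqrtr (ltW s0).
have y0 : 0 < Num.sqrt lam by rewrite sqrtr_gt0.
have t0 : 0 < Num.sqrt s by rewrite sqrtr_gt0.
have y4s : Num.sqrt lam <= 4 * s.
  have -> : 4 * s = Num.sqrt (16 * s ^+ 2).
    have -> : 16 * s ^+ 2 = (4 * s) ^+ 2 by ring.
    by rewrite sqrtr_sqr ger0_norm// mulr_ge0// ltW.
  by rewrite ler_sqrt// mulr_ge0// sqr_ge0.
have ty : Num.sqrt s <= Num.sqrt lam by rewrite ler_sqrt// ltW.
have t1 : 1 <= Num.sqrt s by rewrite -[X in X <= _]sqrtr1 ler_sqrt// ltW.
have ye : Num.sqrt lam != 0 by rewrite gt_eqF.
move: (Num.sqrt s) (Num.sqrt lam) y0 t0 y4s ty t1 E Es ye => t y y0 t0 y4s ty t1 <- Es ye.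
(* The leading [t] only balances the mean of the martingale. The gain is [s * (t / y)], at least
   [t / 4] because [y <= 4 * s], and the last factor at most halves it. *)
have -> : (y ^+ 2 + s * y) * (t / y ^+ 2 - (t / y ^+ 2) ^+ 2 / 2) =
    t - (t / y) ^+ 2 / 2 + s * (t / y) * (1 - t / y ^+ 2 / 2) by field.
have h1 : t / y <= 1 by rewrite ler_pdivrMr// mul1r.
have h0 : 0 <= t / y by rewrite divr_ge0// ltW.
have h2 : t / y ^+ 2 <= 1 by rewrite ler_pdivrMr ?exprn_gt0// mul1r; nra.
have h3 : t / 4 <= s * (t / y).
  by rewrite mulrA ler_pdivlMr// -Es; rewrite -Es in y4s; nra.
move: h0 h1 h2 h3; set u := t / y; set v := t / y ^+ 2; set w := s * u => *.
nra.
Qed.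

Lemma growth_large s lam L r : 1 <= s -> 16 * s ^+ 2 <= L -> L <= lam ->
  lam <= 4 * L -> r%:R = lam + s * Num.sqrt lam ->
  expR (s ^+ 2 / 3) * expR (s * Num.sqrt L)
    <= (1 + s * Num.sqrt L / lam) ^+ r.
Proof.
move=> s1 sL Ll l4 rE; have s0 : 0 < s by lra.
have L0 : 0 < L by apply: lt_le_trans sL; rewrite mulr_gt0// exprn_gt0.
have lam0 : 0 < lam by lra.
have a0 : 0 <= s * Num.sqrt L by rewrite mulr_ge0 ?sqrtr_ge0// ltW.
apply: le_trans (exp_growth lam0 (ltW s0) a0 rE).
rewrite -expRD ler_expR.
have E := sqr_sqrtr (ltW lam0); have EL := sqr_sqrtr (ltW L0).
have y0 : 0 < Num.sqrt lam by rewrite sqrtr_gt0.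
have z0 : 0 < Num.sqrt L by rewrite sqrtr_gt0.
have zy : Num.sqrt L <= Num.sqrt lam by rewrite ler_sqrt// ltW.
have y2z : Num.sqrt lam <= 2 * Num.sqrt L.
  by rewrite -(ler_pXn2r (_ : 0 < 2)%N) ?nnegrE ?mulr_ge0 ?sqrtr_ge0// exprMn E EL; lra.
have sz : 4 * s <= Num.sqrt L.
  by rewrite -(ler_pXn2r (_ : 0 < 2)%N) ?nnegrE ?sqrtr_ge0 ?mulr_ge0 ?(ltW s0)// exprMn EL; lra.
have ye : Num.sqrt lam != 0 by rewrite gt_eqF.
move: (Num.sqrt L) (Num.sqrt lam) y0 z0 zy y2z sz E ye {EL a0} => z y y0 z0 zy y2z sz <- ye.
pose u := z / y.
(* To leading order the choice [a = s * z] is optimal at the bottom of the block, where [u = 1].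
   Ratio 4 keeps [u] in [[1/2, 1]], and there [u - u ^ 2 / 2 - u ^ 3 / 8 >= 1 / 3]; the last term
   uses [s / z <= 1 / 4]. *)
have -> : (y ^+ 2 + s * y) * (s * z / y ^+ 2 - (s * z / y ^+ 2) ^+ 2 / 2) =
    s * z + s ^+ 2 * (u - u ^+ 2 / 2 - (s / z) * u ^+ 3 / 2).
  by rewrite /u; field; rewrite ye gt_eqF.
have u1 : u <= 1 by rewrite ler_pdivrMr// mul1r.
have u2 : 2^-1 <= u by rewrite ler_pdivlMr//; lra.
have s4 : s / z <= 4^-1 by rewrite ler_pdivrMr//; lra.
have s2 : 0 < s ^+ 2 by rewrite exprn_gt0.
rewrite addrC lerD2l; apply: ler_wpM2l; first exact: ltW.
have u3 : 0 <= u ^+ 3 by rewrite exprn_ge0//; lra.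
have : (s / z) * u ^+ 3 / 2 <= u ^+ 3 / 8 by nra.
have : 3^-1 <= u - u ^+ 2 / 2 - u ^+ 3 / 8.
  have -> : u ^+ 3 = u * u ^+ 2 by ring.
  nra.
lra.
Qed.

End Growth.

Section Boundary.
Variable R : realType.

(* The solution of [lam + s * Num.sqrt lam = i]. *)
Definition boundary (s : R) (i : nat) : R :=
  ((Num.sqrt (s ^+ 2 + 4 * i%:R) - s) / 2) ^+ 2.

Lemma sqrt_boundary (s : R) (i : nat) : 0 <= s ->
  Num.sqrt (boundary s i) = (Num.sqrt (s ^+ 2 + 4 * i%:R) - s) / 2.
Proof.
move=> s0; rewrite /boundary sqrtr_sqr ger0_norm// divr_ge0// subr_ge0.
by rewrite -[leLHS]ger0_norm// -sqrtr_sqr ler_sqrt ?lerDl ?addr_ge0 ?sqr_ge0 ?mulr_ge0.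
Qed.

Lemma boundaryE (s : R) (i : nat) : 0 <= s ->
  i%:R = boundary s i + s * Num.sqrt (boundary s i).
Proof.
move=> s0; rewrite sqrt_boundary// /boundary.
have E : Num.sqrt (s ^+ 2 + 4 * i%:R) ^+ 2 = s ^+ 2 + 4 * i%:R.
  by rewrite sqr_sqrtr// addr_ge0 ?sqr_ge0 ?mulr_ge0.
move: (Num.sqrt _) E => y E.
have -> : ((y - s) / 2) ^+ 2 + s * ((y - s) / 2) = (y ^+ 2 - s ^+ 2) / 4 by field.
by rewrite E; field.
Qed.

Lemma boundary_gt0 (s : R) (i : nat) : 0 <= s -> (0 < i)%N -> 0 < boundary s i.
Proof.
move=> s0 i0; rewrite lt_neqAle sqr_ge0 andbT eq_sym; apply/eqP => b0.
have := boundaryE i s0; rewrite b0 sqrtr0 mulr0 addr0 => /eqP.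
by rewrite pnatr_eq0 -leqn0 leqNgt i0.
Qed.

Lemma boundary_le (s : R) (i : nat) : 0 <= s -> boundary s i <= i%:R.
Proof.
by move=> s0; rewrite [leRHS](boundaryE i s0) lerDl mulr_ge0 ?sqrtr_ge0.
Qed.

Lemma le_boundary (s : R) (i : nat) (x : R) : 0 <= s -> 0 <= x ->
  x + s * Num.sqrt x <= i%:R -> x <= boundary s i.
Proof.
move=> s0 x0; rewrite (boundaryE i s0) leNgt => H; rewrite leNgt.
apply: contra H => H.
by apply: ltr_leD => //; apply: ler_wpM2l => //; rewrite ler_sqrt ?(ltW H).
Qed.

Lemma boundary_mono (s : R) (i j : nat) : 0 <= s -> (i <= j)%N ->
  boundary s i <= boundary s j.
Proof.
move=> s0 ij; apply: le_boundary => //; first exact: sqr_ge0.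
by rewrite -boundaryE// ler_nat.
Qed.

End Boundary.

(** * Union bound over the blocks of levels *)

Section Crossing.
Variables (R : realType) (p m : nat) (q : 'I_p -> 'I_m.+1 -> R) (s : R).
Hypotheses (p0 : (0 < p)%N) (mp : (m <= p)%N) (s1 : 1 <= s).
Hypotheses (q0 : forall j e, 0 <= q j e) (q1 : forall j, \sum_e q j e = 1).
Hypothesis qb : forall j (k : 'I_m),
  \sum_(e : 'I_m.+1 | (e <= k)%N) q j e <= boundary s k.+1 / p%:R.

Let s0 : 0 <= s. Proof. exact: le_trans ler01 s1. Qed.
Let pR0 : (0 : R) < p%:R. Proof. by rewrite ltr0n. Qed.

(** Ville's inequality with [c = a / p]: since [(1 + a / p) ^ p <= exp a], the factor [exp a] in the
    growth hypothesis cancels the mean of the martingale. *)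
Lemma crossing_block (S : {set 'I_m}) (a K : R) : 0 <= a -> 0 < K ->
    (forall k, k \in S -> K * expR a <= (1 + a / boundary s k.+1) ^+ k.+1) ->
  \sum_(b | [exists k in S, (k.+1 <= count_below b k)%N]) weight q b <= K^-1.
Proof.
move=> a0 K0 H.
apply: (@le_trans _ _ ((1 + a / p%:R) ^+ p / (K * expR a))).
  apply: (ville_inequality (r := fun k => k.+1) q0 q1 qb).
  - by move=> k; rewrite divr_gt0// boundary_gt0.
  - by rewrite divr_ge0// ltW.
  - by rewrite mulr_gt0// expR_gt0.
  - move=> k /H; congr (_ <= (_ + _) ^+ _).
    by field; rewrite gt_eqF// gt_eqF// boundary_gt0.
rewrite invfM mulrCA -[leRHS]mulr1 ler_wpM2l ?invr_ge0 ?(ltW K0)//.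
rewrite ler_pdivrMr ?expR_gt0// mul1r.
rewrite [in leRHS](_ : a = p%:R * (a / p%:R)); last by field; rewrite gt_eqF.
by rewrite expRM_natl lerXn2r ?expR_ge1Dx ?nnegrE ?expR_ge0// addr_ge0// divr_ge0// ltW.
Qed.

(** The three terms come from [lam <= s], from [s <= lam <= 16 * s ^ 2], and from [N] blocks of
    ratio 4 above. These reach every level because [lam k <= k + 1 <= p]. *)
Lemma crossing_bound (N : nat) : p%:R <= 16 * s ^+ 2 * 4 ^+ N ->
  \sum_(b | [exists k : 'I_m, (k.+1 <= count_below b k)%N]) weight q b <=
    expR 1 / Num.sqrt s + expR (2^-1 - Num.sqrt s / 8)
      + N%:R * expR (- (s ^+ 2 / 3)).
Proof.
move=> pN; pose lam (k : 'I_m) := boundary s k.+1.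
have lam0 k : 0 < lam k by exact: boundary_gt0.
pose SA := [set k | lam k <= s].
pose SB := [set k | (s <= lam k) && (lam k <= 16 * s ^+ 2)].
pose L (i : nat) : R := 16 * s ^+ 2 * 4 ^+ i.
pose SC (i : nat) := [set k | (L i <= lam k) && (lam k <= 4 * L i)].
pose cr (S : {set 'I_m}) b := [exists k in S, (k.+1 <= @count_below p m b k)%N].
have w0 b : 0 <= weight q b by apply: prodr_ge0.
have cover (k : 'I_m) : [|| k \in SA, k \in SB | [exists i : 'I_N, k \in SC i]].
  rewrite !inE; case: (leP (lam k) s) => //= sk; rewrite (ltW sk) /=.
  case: leP => //= k16.
  have kN : lam k <= L N.
    by rewrite (le_trans _ pN)// (le_trans (boundary_le _ s0))// ler_nat (leq_trans (ltn_ord k)).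
  have [i [iN Li Li1]] : exists i, [/\ (i < N)%N, L i <= lam k & lam k <= L i.+1].
    elim: N kN {pN} => [|N' IH] kN; first by move: kN; rewrite /L expr0 mulr1 leNgt k16.
    have [/IH[i [iN ? ?]]|/ltW kN'] := leP (lam k) (L N'); last by exists N'.
    by exists i; split => //; exact: ltnW.
  apply/existsP; exists (Ordinal iN); rewrite inE Li /=.
  by have -> : 4 * L i = L i.+1 by rewrite /L [4 ^+ i.+1]exprS mulrCA.
apply: (@le_trans _ _ (\sum_b weight q b * ((cr SA b)%:R + (cr SB b)%:R +
    \sum_(i < N) (cr (SC i) b)%:R))).
  rewrite big_mkcond; apply: ler_sum => b _; case: ifPn => [/existsP[k kb]|_]; last first.
    by rewrite mulr_ge0 ?addr_ge0 ?ler0n ?sumr_ge0.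
  rewrite -[leLHS]mulr1 ler_wpM2l//.
  have crk (S : {set 'I_m}) : k \in S -> cr S b by move=> kS; apply/exists_inP; exists k.
  have /or3P[/crk ->|/crk ->|/existsP[i /crk ki]] := cover k.
  - by rewrite -addrA lerDl addr_ge0 ?ler0n ?sumr_ge0.
  - by rewrite addrAC lerDr addr_ge0 ?ler0n ?sumr_ge0.
  - by rewrite (bigD1 i)//= ki addrCA lerDl ?addr_ge0 ?ler0n ?sumr_ge0.
have crE S : \sum_b weight q b * (cr S b)%:R = \sum_(b | cr S b) weight q b.
  rewrite [RHS]big_mkcond; apply: eq_bigr => b _.
  by case: (cr S b); rewrite ?mulr1 ?mulr0.
under eq_bigr do rewrite !mulrDr mulr_sumr.
rewrite !big_split /= exchange_big /= !crE.
have ss0 : 0 < Num.sqrt s by rewrite sqrtr_gt0 (lt_le_trans ltr01).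
apply: lerD; first apply: lerD.
- rewrite -[leRHS]invrK invf_div.
  apply: (@crossing_block _ 1) => //; first by rewrite divr_gt0// expR_gt0.
  move=> k; rewrite inE => kA; rewrite divfK ?expR_eq0//.
  exact: growth_small (lam0 k) kA (boundaryE _ s0).
- rewrite -opprB expRN.
  apply: (@crossing_block _ (Num.sqrt s)); rewrite ?expR_gt0 ?sqrtr_ge0//.
  move=> k; rewrite inE => /andP[sk k16].
  exact: growth_medium s1 sk k16 (boundaryE _ s0).
- rewrite mulr_natl -[X in _ *+ X](card_ord N) -sumr_const.
  apply: ler_sum => i _; rewrite crE expRN.
  have s20 : 0 < s ^+ 2 by rewrite exprn_gt0// (lt_le_trans ltr01).
  apply: (@crossing_block _ (s * Num.sqrt (L i))); rewrite ?expR_gt0 ?mulr_ge0 ?sqrtr_ge0//.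
  move=> k; rewrite inE => /andP[Lk kL]; apply: (growth_large s1 _ Lk kL (boundaryE _ s0)).
  apply: ler_peMr; first by rewrite mulr_ge0// ltW.
  by rewrite exprn_ege1// ler1n.
Qed.

End Crossing.

Local Open Scope classical_set_scope.

(** * Independent blocks of variables *)

Section Independence.
Context {R : realType} {d : measure_display} {Omega : measurableType d}.
Variable P : probability Omega R.

(** As functions of [A], both sides are finite measures of the same total mass that agree on the
    pi-system [G], hence on the sigma-algebra it generates. *)
Lemma independent_generated (G : set (set Omega)) (B : set Omega) :
    setI_closed G -> G `<=` measurable -> measurable B ->
    (forall A, G A -> P (A `&` B) = P A * P B)%E ->
  forall A, <<s G >> A -> (P (A `&` B) = P A * P B)%E.
Proof.
move=> GI Gm mB GB A GA.
have PB : (0 <= fine (P B))%R by apply: fine_ge0.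
pose m1 := mrestr P mB.
pose m2 := mscale (NngNum PB) P.
have m2E X : m2 X = (P X * P B)%E.
  by rewrite /m2 /mscale /= fineK ?fin_num_measure// muleC.
have HE : [set X | G X /\ X `<=` setT] = G by apply/seteqP; split => [X []|X].
rewrite -m2E -[LHS]/(m1 A); apply: (@g_sigma_algebra_measure_unique_trace _ _ _ G setT measurableT
  _ _ m1 m2); rewrite ?HE//.
- by rewrite -[RHS]/(m2 _) m2E /m1 /= /mrestr setTI probability_setT mul1e.
- by move=> X GX; rewrite -[RHS]/(m2 _) m2E; exact: GB.
- by rewrite /m1 /= /mrestr -ge0_fin_numE// fin_num_measure//; exact: measurableI.
Qed.

Variables (I : finType) (V : I -> {RV P >-> R}).

Definition rectangles (J : {set I}) : set (set Omega) :=
  [set E | exists2 A : I -> set R, (forall i, measurable (A i)) &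
     E = \bigcap_(i in [set` J]) (V i @^-1` A i)].

Lemma measurable_rectangles J : rectangles J `<=` measurable.
Proof.
move=> E [A mA ->]; apply: fin_bigcap_measurable => // i _.
by rewrite -[_ @^-1` _]setTI; exact: measurable_funP.
Qed.

Lemma rectangles_setI J : setI_closed (rectangles J).
Proof.
move=> _ _ [A mA ->] [B mB ->]; exists (fun i => A i `&` B i).
  by move=> i; exact: measurableI.
by rewrite -bigcapI; apply: eq_bigcapr => i _; rewrite preimage_setI.
Qed.

Definition block (J : {set I}) : set (set Omega) := <<s rectangles J >>.

Lemma measurable_block J : block J `<=` measurable.
Proof.
by move=> E; apply: smallest_sub => //; [exact: sigma_algebra_measurable|exact: measurable_rectangles].
Qed.

Lemma sub_block (J1 J2 : {set I}) E : (forall i, i \in J1 -> i \in J2) ->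
  block J1 E -> block J2 E.
Proof.
move=> J12; apply: sub_sigma_algebra2 => _ [B mB ->].
exists (fun i => if i \in J1 then B i else setT); first by move=> i; case: ifP.
apply/seteqP; split => w H i /=; last first.
  by move=> iJ; have := H i (J12 _ iJ); rewrite /= iJ.
by case: ifPn => [iJ1|]// _; exact: H.
Qed.

Hypothesis indepV : mutually_independent V.

(** A rectangle over [J1] and one over [J2] intersect in a rectangle over the union, so they
    multiply; the pi-system argument then extends one side at a time. *)
Lemma independent_blocks (J1 J2 : {set I}) E1 E2 :
    (forall i, i \in J1 -> i \notin J2) ->
  block J1 E1 -> block J2 E2 -> (P (E1 `&` E2) = P E1 * P E2)%E.
Proof.
move=> J12 bE1 bE2; apply: (@independent_generated (rectangles J1)) => //.
- exact: rectangles_setI.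
- exact: measurable_rectangles.
- exact: measurable_block bE2.
- move=> A rA; rewrite setIC muleC.
  apply: (@independent_generated (rectangles J2)) => //.
  + exact: rectangles_setI.
  + exact: measurable_rectangles.
  + exact: measurable_rectangles rA.
  + move: rA => [A1 mA1 ->] _ [A2 mA2 ->].
    pose A' i := if i \in J1 then A1 i else A2 i.
    have mA' i : measurable (A' i) by rewrite /A'; case: ifP.
    have J21 i : i \in J2 -> (i \in J1) = false.
      by move=> iJ2; apply/negbTE/negP => /J12; rewrite iJ2.
    have -> : \bigcap_(i in [set` J2]) (V i @^-1` A2 i) `&`
        \bigcap_(i in [set` J1]) (V i @^-1` A1 i) =
        \bigcap_(i in [set` J1 :|: J2]) (V i @^-1` A' i).
      apply/seteqP; split => w.
        move=> [H2 H1] i /=; rewrite /A' inE => /orP[iJ1|iJ2].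
          by rewrite iJ1; exact: H1.
        by rewrite J21//; exact: H2.
      move=> H; split => i /= iJ; have := H i; rewrite /= inE iJ ?orbT => /(_ isT);
        by rewrite /A' ?iJ ?J21.
    rewrite (indepV (fun i _ => mA' i)) (indepV (fun i _ => mA1 i)) (indepV (fun i _ => mA2 i)).
    rewrite (eq_bigl [in [predU J1 & J2]]); last by move=> i; rewrite !inE.
    rewrite bigU/=; last by apply/pred0P => i /=; apply/negbTE/negP => /andP[/J12/negP].
    rewrite muleC; congr (_ * _)%E; apply: eq_bigr => i iJ; rewrite /A' ?iJ//.
    by rewrite J21.
Qed.

Lemma block_preimage (J : {set I}) i (A : set R) : i \in J -> measurable A ->
  block J (V i @^-1` A).
Proof.
move=> iJ mA; apply: sub_sigma_algebra.
exists (fun k => if k == i then A else setT); first by move=> k; case: ifP.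
apply/seteqP; split => w /= H; last by have := H i iJ; rewrite /= eqxx.
by move=> k kJ /=; case: eqP => // ->.
Qed.

(* [block J] as a measurable space, so that measurability with respect to it
   follows from the general lemmas. *)
Definition blockType (J : {set I}) := g_sigma_algebraType (rectangles J).

Lemma measurable_block_var (J : {set I}) i : i \in J ->
  measurable_fun [set: blockType J] (V i : blockType J -> R).
Proof.
by move=> iJ _ A mA; rewrite setTI; exact: block_preimage.
Qed.

Definition depends_on (J : {set I}) (X : Omega -> R) : Prop :=
  measurable_fun [set: blockType J] (X : blockType J -> R).

Lemma depends_on_measurable J X : depends_on J X -> measurable_fun setT X.
Proof.
move=> mX _ A mA; rewrite setTI.
by apply: (@measurable_block J); rewrite -[_ @^-1` _]setTI; exact: mX.
Qed.

End Independence.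

Section ProductLaw.
Context {R : realType} {d : measure_display} {Omega : measurableType d}.
Variable P : probability Omega R.
Variables X Y : {mfun Omega >-> R}.
Hypothesis indepXY : forall A B : set R, measurable A -> measurable B ->
  (P (X @^-1` A `&` Y @^-1` B) = P (X @^-1` A) * P (Y @^-1` B))%E.

Let XY w := (X w, Y w).

Let mXY : measurable_fun setT XY.
Proof. by apply: measurable_fun_pair; exact: measurable_funP. Qed.

HB.instance Definition _ := isMeasurableFun.Build _ _ _ _ XY mXY.

Lemma independent_joint_law (S : set (measurableTypeR R * measurableTypeR R)) :
  measurable S ->
  (distribution P X \x distribution P Y)%E S = P (XY @^-1` S).
Proof.
move=> mS; rewrite -[RHS]/(distribution P XY S).
exact: product_measure_unique.
Qed.

Hypotheses (iX : P.-integrable setT (EFin \o X)) (iY : P.-integrable setT (EFin \o Y)).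

Let mul (z : measurableTypeR R * measurableTypeR R) : \bar R := ((z.1 : R) * (z.2 : R))%:E.

Let mmul : measurable_fun setT mul.
Proof.
apply/measurable_EFinP; apply: (@measurable_funM _ _ R).
  exact: measurable_fst.
exact: measurable_snd.
Qed.

Let mid : measurable_fun setT (EFin : measurableTypeR R -> \bar R).
Proof. exact: EFin_measurable. Qed.

Let iX' : (distribution P X).-integrable setT EFin.
Proof. by apply: integrable_pushforward. Qed.

Let iY' : (distribution P Y).-integrable setT EFin.
Proof. by apply: integrable_pushforward. Qed.

Let imul : (distribution P X \x distribution P Y)%E.-integrable setT mul.
Proof.
apply/integrable12ltyP => //=.
have EY x : (\int[distribution P Y]_y `|mul (x, y)| =
    `|x%:E| * \int[distribution P Y]_y `|y%:E|)%E.
  rewrite -ge0_integralZl//=; last exact: measurableT_comp.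
  by apply: eq_integral => y _; rewrite /mul /= normrM EFinM.
under eq_integral do rewrite EY.
have /integrableP[_ fX] := iX'; have /integrableP[_ fY] := iY'.
rewrite ge0_integralZr//=; last 2 first.
- exact: measurableT_comp.
- exact: integral_ge0.
by rewrite lte_mul_pinfty// ?integral_ge0// ge0_fin_numE// integral_ge0.
Qed.

Let integral_joint (f : measurableTypeR R * measurableTypeR R -> \bar R) :
  (\int[distribution P XY]_z f z = \int[distribution P X \x distribution P Y]_z f z)%E.
Proof.
apply: eq_measure_integral => A mA _.
exact/esym/independent_joint_law.
Qed.

(** First moments are enough: by Tonelli, the absolute moment of the product under the product law
    is the product of the absolute moments. *)
Lemma independent_integrableM :
  P.-integrable setT (fun w => (X w * Y w)%:E).
Proof.
apply/integrableP; split.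
  by apply/measurable_EFinP; exact: measurable_funM.
have /integrableP[_] := imul.
rewrite -integral_joint ge0_integral_distribution//.
exact: measurableT_comp.
Qed.

Lemma independent_integralM :
  (\int[P]_w (X w * Y w)%:E = (\int[P]_w (X w)%:E) * (\int[P]_w (Y w)%:E))%E.
Proof.
transitivity (\int[distribution P XY]_z mul z)%E.
  rewrite integral_distribution//; exact: independent_integrableM.
rewrite integral_joint -integral12_prod_meas1//=.
have EY x : (\int[distribution P Y]_y mul (x, y) =
    x%:E * \int[distribution P Y]_y y%:E)%E.
  by rewrite -integralZl//.
transitivity (\int[distribution P X]_x (x%:E * \int[distribution P Y]_y y%:E))%E.
  by apply: eq_integral => x _; exact: EY.
have fY : (\int[distribution P Y]_y y%:E)%E \is a fin_num by exact: integrable_fin_num.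
rewrite -(fineK fY) integralZr// fineK// (integral_distribution (X := X))// (integral_distribution (X := Y))//.
Qed.

End ProductLaw.

(** * Normal and chi-square laws *)

Definition std_normal {R : realType} : probability (measurableTypeR R) R :=
  normal_prob 0 1.

Section NormalMoments.
Variable R : realType.
Notation N01 := (@std_normal R).
Notation mu := (@lebesgue_measure R).
Implicit Types (f : R -> R) (s t x : R).

(** The Radon-Nikodym derivative of the normal law equals the Gaussian density almost everywhere,
    both having the same integral over every measurable set. *)
Lemma ge0_integral_normal_prob f : measurable_fun setT f -> (forall x, 0 <= f x) ->
  (\int[N01]_x (f x)%:E = \int[mu]_x (f x * normal_pdf 0 1 x)%:E)%E.
Proof.
move=> mf f0; have dom := @normal_prob_dominates R 0 1.
have mf' : measurable_fun setT (EFin \o f) by exact/measurable_EFinP.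
have f0' x : (0 <= (EFin \o f) x)%E by rewrite lee_fin.
rewrite -[LHS]/(\int[N01]_x (EFin \o f) x)%E.
rewrite -(Radon_Nikodym_SigmaFinite.change_of_variables dom f0' measurableT mf').
under [RHS]eq_integral do rewrite EFinM.
apply: ae_eq_integral => //.
- apply: emeasurable_funM; first exact/measurable_EFinP.
  exact: measurable_int (Radon_Nikodym_SigmaFinite.f_integrable dom).
- apply: emeasurable_funM; first exact/measurable_EFinP.
  by apply/measurable_EFinP; exact: measurable_normal_pdf.
- apply: ae_eqe_mul2l; apply: integral_ae_eq => //.
  + exact: Radon_Nikodym_SigmaFinite.f_integrable.
  + by apply/measurable_EFinP; exact: measurable_normal_pdf.
  + move=> E _ mE; rewrite -Radon_Nikodym_SigmaFinite.f_integral//.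
Qed.

(** The integrand times the standard density is [sg] times the centred normal density of standard
    deviation [sg = (1 - 2 s) ^ (-1/2)]. *)
Lemma normal_sqr_mgf s : s < 2^-1 ->
  (\int[N01]_x (expR (s * x ^+ 2))%:E = ((Num.sqrt (1 - 2 * s))^-1)%:E)%E.
Proof.
move=> s2; have c0 : 0 < 1 - 2 * s by lra.
pose sg := (Num.sqrt (1 - 2 * s))^-1.
have sg0 : 0 < sg by rewrite invr_gt0 sqrtr_gt0.
have sgE : sg ^+ 2 = (1 - 2 * s)^-1 by rewrite exprVn sqr_sqrtr// ltW.
rewrite ge0_integral_normal_prob; first last.
- by move=> x; exact: expR_ge0.
- by apply: measurableT_comp => //; apply: measurable_funM => //; exact: measurable_funX.
transitivity (\int[mu]_x (sg%:E * (normal_pdf 0 sg x)%:E))%E; last first.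
  rewrite integralZl//; last exact: integrable_normal_pdf.
  by rewrite integral_normal_pdf mule1.
apply: eq_integral => x _; rewrite -EFinM; congr EFin.
rewrite !normal_pdfE ?oner_eq0 ?gt_eqF// /normal_peak /normal_fun.
rewrite expr1n mul1r mulrCA -expRD [in RHS]mulrA; congr (_ * expR _).
  rewrite -mulrnAr sqrtrM ?sqr_ge0// sqrtr_sqr ger0_norm ?(ltW sg0)// invfM mulrA divff ?gt_eqF//.
  by rewrite mul1r.
by rewrite sgE; field; rewrite gt_eqF.
Qed.

Lemma normal_mgf t : (\int[N01]_x (expR (t * x))%:E = (expR (t ^+ 2 / 2))%:E)%E.
Proof.
rewrite ge0_integral_normal_prob; first last.
- by move=> x; exact: expR_ge0.
- by apply: measurableT_comp => //; exact: measurable_funM.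
transitivity (\int[mu]_x ((expR (t ^+ 2 / 2))%:E * (normal_pdf t 1 x)%:E))%E; last first.
  rewrite integralZl//; last exact: integrable_normal_pdf.
  by rewrite integral_normal_pdf mule1.
apply: eq_integral => x _; rewrite -EFinM; congr EFin.
rewrite !normal_pdfE ?oner_eq0// /normal_fun mulrCA [in RHS]mulrCA -!expRD.
by congr (_ * expR _); field.
Qed.

Lemma normal_integrable_expR_sqr s : s < 2^-1 ->
  N01.-integrable setT (EFin \o (fun x => expR (s * x ^+ 2))).
Proof.
move=> s2; apply/integrableP; split.
  apply/measurable_EFinP; apply: measurableT_comp => //.
  by apply: measurable_funM => //; exact: measurable_funX.
under eq_integral do rewrite /= ger0_norm ?expR_ge0//.
by rewrite normal_sqr_mgf// ltry.
Qed.

Lemma normal_integrable_expR t :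
  N01.-integrable setT (EFin \o (fun x => expR (t * x))).
Proof.
apply/integrableP; split.
  by apply/measurable_EFinP; apply: measurableT_comp => //; exact: measurable_funM.
under eq_integral do rewrite /= ger0_norm ?expR_ge0//.
by rewrite normal_mgf// ltry.
Qed.

Lemma normal_integrable_fourth : N01.-integrable setT (EFin \o (fun x => x ^+ 4)).
Proof.
have h : 4^-1 < 2^-1 :> R by lra.
apply: (le_integrable measurableT _ _
  (integrableZl measurableT 32 (normal_integrable_expR_sqr h))).
- by apply/measurable_EFinP; exact: measurable_funX.
- move=> x _ /=; have x4 : 0 <= (x : R) ^+ 4 by rewrite exprn_even_ge0.
  have e0 : 0 <= 32 * expR (4^-1 * (x : R) ^+ 2) by rewrite mulr_ge0 ?expR_ge0.
  rewrite lee_fin !ger0_norm//.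
  (* The inequality [1 + y ^ 2 / 2 <= exp y] at [y = x ^ 2 / 4]; hence the factor 32. *)
  have := @expR_ge1Dxn R (4^-1 * x ^+ 2) 1 _.
  rewrite mulr_ge0 ?sqr_ge0// => /(_ isT).
  rewrite exprMn -exprM -[(2 * 2)%N]/4%N => H.
  have e : (2`!%:R = 2 :> R) by [].
  by move: H; rewrite e; lra.
Qed.

Lemma normal_integrable_le f : measurable_fun setT f ->
  (forall x, `|f x| <= 1 + x ^+ 4) -> N01.-integrable setT (EFin \o f).
Proof.
move=> mf fb; apply: (le_integrable measurableT _ _ (integrableD measurableT
  (finite_measure_integrable_cst N01 1 measurableT) normal_integrable_fourth)).
- exact/measurable_EFinP.
- move=> x _ /=; have x4 : 0 <= (x : R) ^+ 4 by rewrite exprn_even_ge0.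
  by rewrite lee_fin (le_trans (fb x))// ger0_norm// addr_ge0.
Qed.

Lemma normal_integrable_id : N01.-integrable setT (EFin \o (fun x => x)).
Proof.
apply: normal_integrable_le => // x; rewrite ler_norml; apply/andP.
have := sqr_ge0 (x ^+ 2 - 1); have := sqr_ge0 (x - 1); have := sqr_ge0 (x + 1).
rewrite (_ : x ^+ 4 = (x ^+ 2) ^+ 2) -?exprM//; split; nra.
Qed.

Lemma normal_integrable_sqr : N01.-integrable setT (EFin \o (fun x => x ^+ 2)).
Proof.
apply: normal_integrable_le => [|x]; first exact: measurable_funX.
rewrite ger0_norm ?sqr_ge0//.
have := sqr_ge0 (x ^+ 2 - 1); rewrite (_ : x ^+ 4 = (x ^+ 2) ^+ 2) -?exprM//; nra.
Qed.

Let Rint f := (\int[N01]_x f x)%R.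

Let Rint_affine f c k : N01.-integrable setT (EFin \o f) ->
  N01.-integrable setT (EFin \o (fun x => k * (f x - c))) /\
  Rint (fun x => k * (f x - c)) = k * (Rint f - c).
Proof.
move=> fi; have ci := finite_measure_integrable_cst N01 c measurableT.
have fci := integrableB measurableT fi ci.
split; first exact: (integrableZl measurableT k fci).
rewrite /Rint RintegralZl// RintegralB// Rintegral_cst//.
rewrite -[c in RHS]mulr1; congr (_ * (_ - _ * _)); exact: (congr1 fine (probability_setT N01)).
Qed.

Lemma le0_of_le_small x : (forall t, 0 < t -> t <= 4^-1 -> x <= 4 * t) -> x <= 0.
Proof.
move=> H; rewrite leNgt; apply/negP => x0.
have [x1|x1] := leP x 1.
  have := H (x / 8); nra.
have := H 8^-1; lra.
Qed.

Lemma expR_le_quadratic t : 0 <= t -> t <= 2^-1 -> expR t <= 1 + 2 * t.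
Proof.
move=> t0 t2; have := expR_ge1Dx (- t); rewrite expRN => H.
have e0 := expR_gt0 t; rewrite -[expR t]invrK -ler_pV2 ?invrK; last 2 first.
- by rewrite inE unitfE gt_eqF//; lra.
- by rewrite inE unitfE gt_eqF ?invr_gt0//.
apply: le_trans H; rewrite -[leLHS]mul1r ler_pdivrMr; [nra|lra].
Qed.

(* As [t * x <= expR (t * x) - 1], the mean is squeezed between difference
   quotients of the moment generating function at [0].  The second moment is
   obtained in the same way from [normal_sqr_mgf]. *)
Lemma normal_mean : (\int[N01]_x x%:E = 0)%E.
Proof.
have fi := normal_integrable_id.
have key (t : R) : 0 < `|t| -> `|t| <= 4^-1 ->
    forall c, (forall x, c * x <= `|t|^-1 * (expR (t * x) - 1)) -> c * Rint (fun x => x) <= `|t|.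
  move=> t0 t4 c H.
  have [gi gE] := Rint_affine 1 `|t|^-1 (normal_integrable_expR t).
  have [ci cE] := Rint_affine 0 c fi.
  have : Rint (fun x => c * (x - 0)) <= Rint (fun x => `|t|^-1 * (expR (t * x) - 1)).
    by apply: le_Rintegral => // x _; rewrite subr0.
  rewrite cE gE subr0 => /le_trans; apply.
  rewrite /Rint /Rintegral normal_mgf /= mulrC ler_pdivrMr//.
  rewrite -(real_normK (num_real t)).
  have := @expR_le_quadratic (`|t| ^+ 2 / 2) _ _; nra.
have e0 : Rint (fun x => x) = 0.
  apply/eqP; rewrite eq_le -[X in _ && X]oppr_le0; apply/andP; split; apply: le0_of_le_small => t t0 t4.
    rewrite -[leLHS]mul1r; have := @key t _ _ 1; rewrite gtr0_norm//.
    move=> /(_ t0 t4) H; suff : 1 * Rint id <= t by lra.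
    apply: H => x; rewrite mul1r mulrC ler_pdivlMr// mulrC.
    by have := expR_ge1Dx (t * x); lra.
  have := @key (- t) _ _ (-1); rewrite normrN gtr0_norm//.
  move=> /(_ t0 t4) H; suff : -1 * Rint id <= t by lra.
  apply: H => x; rewrite mulrC mulrN mulr1 mulrC ler_pdivlMr// mulrC.
  by have := expR_ge1Dx (- t * x); lra.
have fn : (\int[N01]_x x%:E)%E \is a fin_num by exact: integrable_fin_num.
by rewrite -(fineK fn); congr EFin.
Qed.

(** Bounds [normal_sqr_mgf] near 0. Both signs of [s] serve the difference quotients for the second
    moment; positive [s] serves Chernoff's bound. *)
Lemma invr_sqrt_le s : `|s| <= 4^-1 -> (Num.sqrt (1 - 2 * s))^-1 <= 1 + s + 4 * s ^+ 2.
Proof.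
rewrite ler_norml => /andP[s1 s2].
have y0 : 0 < Num.sqrt (1 - 2 * s) by rewrite sqrtr_gt0; lra.
have y2 : Num.sqrt (1 - 2 * s) ^+ 2 = 1 - 2 * s by rewrite sqr_sqrtr//; lra.
have b0 : 0 <= 1 + s + 4 * s ^+ 2 by have := sqr_ge0 s; lra.
rewrite -[leLHS]mul1r ler_pdivrMr// -(ler_pXn2r (_ : 0 < 2)%N) ?nnegrE ?mulr_ge0 ?ler01 ?(ltW y0)//.
rewrite exprMn y2 expr1n.
have -> : (1 + s + 4 * s ^+ 2) ^+ 2 * (1 - 2 * s) =
  1 + s ^+ 2 * (5 - 10 * s - 32 * s ^+ 3) by ring.
rewrite lerDl mulr_ge0 ?sqr_ge0//.
have : s ^+ 3 <= 4^-1 ^+ 3.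
  have [s0|s0] := leP 0 s; first by rewrite lerXn2r// nnegrE; lra.
  apply: (@le_trans _ _ 0); first by rewrite exprn_odd_le0// ltW.
  by rewrite exprn_ge0// invr_ge0.
rewrite [4^-1 ^+ 3](_ : _ = 64^-1); [lra|by field].
Qed.

Lemma normal_second_moment : (\int[N01]_x (x ^+ 2)%:E = 1)%E.
Proof.
have fi := normal_integrable_sqr.
have key (s c : R) : 0 < `|s| -> `|s| <= 4^-1 -> `|c| = 1 -> s = c * `|s| ->
    c * (Rint (fun x => x ^+ 2) - 1) <= 4 * `|s|.
  move=> s0 s4 c1 sE.
  have s2 : s < 2^-1 by have := ler_norm s; lra.
  have [gi gE] := Rint_affine 1 `|s|^-1 (normal_integrable_expR_sqr s2).
  have [ci cE] := Rint_affine 0 c fi.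
  have : Rint (fun x => c * (x ^+ 2 - 0)) <= Rint (fun x => `|s|^-1 * (expR (s * x ^+ 2) - 1)).
    apply: le_Rintegral => // x _; rewrite subr0 mulrC [leRHS]mulrC ler_pdivlMr//.
    by have := expR_ge1Dx (s * x ^+ 2); rewrite {1}sE; lra.
  rewrite cE gE subr0 => H; rewrite mulrBr mulr1 lerBlDr; apply: le_trans H _.
  rewrite /Rint /Rintegral (normal_sqr_mgf s2) /= mulrC ler_pdivrMr//.
  have := invr_sqrt_le s4; rewrite {2}sE -(real_normK (num_real s)); nra.
have e1 : Rint (fun x => x ^+ 2) = 1.
  apply/eqP; rewrite -subr_eq0 eq_le -[X in _ && X]oppr_le0; apply/andP; split;
    apply: le0_of_le_small => t t0 t4.
    by have := @key t 1; rewrite normr1 gtr0_norm// !mul1r; exact.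
  by have := @key (- t) (-1); rewrite !normrN normr1 gtr0_norm// !mulN1r; exact.
have fn : (\int[N01]_x (x ^+ 2)%:E)%E \is a fin_num by exact: integrable_fin_num.
by rewrite -(fineK fn); congr EFin.
Qed.

End NormalMoments.

(** * Chi-square tails and validity of the p-values *)

Section ChiSquareTail.
Variable R : realType.
Notation RM := (measurableTypeR R).

Lemma chi2_probS m (A : set RM) : chi2_prob m.+1 A =
  ((chi2_prob m : probability RM R) \x (std_normal : probability RM R))%E
    (add_sqr @^-1` A).
Proof. by []. Qed.

Lemma chi2_mgf (s : R) m : s < 2^-1 ->
  (\int[chi2_prob m]_x (expR (s * x))%:E = ((Num.sqrt (1 - 2 * s))^-1 ^+ m)%:E)%E.
Proof.
move=> s2; elim: m => [|m IH].
  rewrite integral_dirac//=; last first.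
    by apply/measurable_EFinP; apply: measurableT_comp => //; exact: measurable_funM.
  by rewrite mulr0 expR0 expr0 diracT mul1e.
have mf : measurable_fun [set: RM] (fun x : RM => (expR (s * (x : R)))%:E).
  by apply/measurable_EFinP; apply: measurableT_comp => //; exact: measurable_funM.
have f0 (x : R) : (0 <= (expR (s * x))%:E)%E by rewrite lee_fin expR_ge0.
rewrite [LHS](@ge0_integral_distribution _ _ _ _ _
  ((chi2_prob m : probability RM R) \x (std_normal : probability RM R))%E add_sqr _ mf)//.
rewrite fubini_tonelli1; first last.
- by move=> z; exact: f0.
- exact: (measurableT_comp mf measurable_add_sqr).
transitivity (\int[chi2_prob m]_x ((expR (s * x))%:E * ((Num.sqrt (1 - 2 * s))^-1)%:E))%E.
  apply: eq_integral => x _; rewrite -normal_sqr_mgf// -ge0_integralZl//; last first.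
    apply/measurable_EFinP; apply: measurableT_comp => //.
    by apply: measurable_funM => //; exact: measurable_funX.
  by apply: eq_integral => y _; rewrite /= /add_sqr /= mulrDr expRD EFinM.
rewrite ge0_integralZr//.
by rewrite IH -EFinM exprSr.
Qed.

(* Chernoff's bound at [s = (4 * Num.sqrt m)^-1]. *)
Lemma chi2_tail m (y : R) : (0 < m)%N ->
  (chi2_prob m [set x : RM | (m%:R + y <= x)%R] <=
   (expR (4^-1 - y / (4 * Num.sqrt m%:R)))%:E)%E.
Proof.
move=> m0; set A := [set _ | _].
have r0 : 0 < Num.sqrt m%:R :> R by rewrite sqrtr_gt0 ltr0n.
have r1 : 1 <= Num.sqrt m%:R :> R by rewrite -[leLHS]sqrtr1 ler_sqrt// ler1n.
have rm : Num.sqrt m%:R ^+ 2 = m%:R :> R by rewrite sqr_sqrtr.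
pose s : R := (4 * Num.sqrt m%:R)^-1.
have s0 : 0 < s by rewrite invr_gt0 mulr_gt0.
have s4 : s <= 4^-1 by rewrite lef_pV2 ?posrE ?mulr_gt0//; lra.
have s2 : s < 2^-1 by lra.
have mA : measurable A.
  by rewrite /A (_ : [set _ | _] = `[m%:R + y, +oo[%classic)//; apply/seteqP; split=> x /=; rewrite in_itv/= andbT.
have mf : measurable_fun [set: RM] (fun x : RM => (expR (s * (x : R)))%:E).
  by apply/measurable_EFinP; apply: measurableT_comp => //; exact: measurable_funM.
have H : ((expR (s * (m%:R + y)))%:E * chi2_prob m A <= (expR (s * m%:R + 4^-1))%:E)%E.
  rewrite -integral_cst//; apply: (@le_trans _ _ (\int[chi2_prob m]_(x in A) (expR (s * x))%:E)%E).
    apply: ge0_le_integral => //.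
    - by move=> x _; rewrite lee_fin expR_ge0.
    - exact: measurable_funTS.
    - by move=> x Ax; rewrite lee_fin ler_expR ler_pM2l.
  apply: (@le_trans _ _ (\int[chi2_prob m]_x (expR (s * x))%:E)%E).
    exact: ge0_subset_integral.
  rewrite chi2_mgf// lee_fin.
  (* The choice of [s] makes the second-order term [4 * s ^ 2 * m] the constant [1 / 4]. *)
  have -> : s * m%:R + 4^-1 = m%:R * (s + 4 * s ^+ 2).
    rewrite /s; move: (Num.sqrt _) r0 rm => r r0 <-.
    by field; rewrite gt_eqF.
  rewrite expRM_natl lerXn2r ?nnegrE ?invr_ge0 ?sqrtr_ge0 ?expR_ge0//.
  apply: le_trans (expR_ge1Dx _); rewrite addrA; apply: invr_sqrt_le.
  by rewrite ger0_norm// ltW.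
rewrite -(@lee_pmul2l _ (expR (s * (m%:R + y)))%:E)// ?lte_fin ?expR_gt0//.
apply: le_trans H _; rewrite -EFinM -expRD lee_fin ler_expR.
suff -> : s * (m%:R + y) + (4^-1 - y / (4 * Num.sqrt m%:R)) = s * m%:R + 4^-1 by [].
by rewrite /s; field; rewrite gt_eqF.
Qed.

(** Makes p-values positive in the end: a zero p-value would send the Higher Criticism ratio to 0
    instead of making it large. On [[b, b + 1]] with [b >= 1] squares are at least [a], and the
    density is at least its value at [b + 1]. *)
Lemma std_normal_tail_gt0 (a : R) : (0 < std_normal [set y : RM | (a <= y ^+ 2)%R])%E.
Proof.
pose b := Num.max 1 a.
have b1 : 1 <= b by rewrite le_max lexx.
have ab : a <= b by rewrite le_max lexx orbT.
pose c := normal_pdf 0 1 (b + 1).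
have c0 : 0 < c.
  by rewrite /c normal_pdfE ?oner_eq0// mulr_gt0 ?expR_gt0// normal_peak_gt0// oner_eq0.
apply: (@lt_le_trans _ _ (std_normal (`[b, b + 1]%classic : set RM))); last first.
  apply: le_measure; rewrite ?inE//.
    rewrite -[X in measurable X]setTI.
    apply: (@measurable_fun_le _ RM R setT (cst a) (fun y : RM => (y : R) ^+ 2)) => //.
  by move=> y /=; rewrite in_itv /= => /andP[y1 _]; nra.
rewrite /std_normal /= /normal_prob.
apply: (@lt_le_trans _ _ (\int[lebesgue_measure]_(x in `[b, (b + 1)%R]) c%:E)%E).
  rewrite integral_cst//= lebesgue_measure_itv /= lte_fin ltrDl ltr01.
  by rewrite -EFinD addrAC subrr add0r mule1 lte_fin.
apply: ge0_le_integral => //.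
- by move=> x _; rewrite lee_fin ltW.
- by apply: measurable_funTS; apply/measurable_EFinP; exact: measurable_normal_pdf.
- move=> x /=; rewrite in_itv/= => /andP[x1 x2].
  rewrite lee_fin /c !normal_pdfE ?oner_eq0// ler_wpM2l ?normal_peak_ge0//.
  rewrite ler_expR !subr0 expr1n !mulNr lerN2 ler_wpM2r// ler_sqr// nnegrE; lra.
Qed.

Lemma measurable_ge (a : R) : measurable [set x : RM | (a <= x)%R].
Proof.
rewrite -[X in measurable X]setTI.
exact: (@measurable_fun_le _ RM R setT (cst a) (fun y : RM => y)).
Qed.

Lemma chi2_ge0 m : chi2_prob m [set x : RM | (0 <= x)%R] = 1%E.
Proof.
elim: m => [|m IH]; first by rewrite /= diracE mem_set /=.
apply/eqP; rewrite eq_le; apply/andP; split.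
  by apply: probability_le1; exact: measurable_ge.
rewrite chi2_probS.
have <- : ((chi2_prob m : probability RM R) \x (std_normal : probability RM R))%E
    ([set x : RM | (0 <= x)%R] `*` setT) = 1%E.
  rewrite product_measure1E//; last exact: measurable_ge.
  by rewrite [X in (X * _)%E]IH mul1e; exact: probability_setT.
apply: le_measure; rewrite ?inE.
- by apply: measurableX => //; exact: measurable_ge.
- rewrite -[X in measurable X]setTI; apply: measurable_add_sqr => //.
  exact: measurable_ge.
- by move=> [x y] [/= x0 _]; rewrite /add_sqr /= addr_ge0// sqr_ge0.
Qed.

Lemma chi2_tail_gt0 m (a : R) : (0 < m)%N ->
  (0 < chi2_prob m [set x : RM | (a <= x)%R])%E.
Proof.
case: m => // m _; rewrite chi2_probS.
have mS : measurable [set y : RM | (a <= y ^+ 2)%R].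
  rewrite -[X in measurable X]setTI.
  by apply: (@measurable_fun_le _ RM R setT (cst a) (fun y : RM => (y : R) ^+ 2)).
apply: (lt_le_trans (std_normal_tail_gt0 a)).
have -> : std_normal [set y : RM | (a <= y ^+ 2)%R] =
    ((chi2_prob m : probability RM R) \x (std_normal : probability RM R))%E
    ([set x : RM | (0 <= x)%R] `*` [set y : RM | (a <= y ^+ 2)%R]).
  rewrite product_measure1E//; last exact: measurable_ge.
  by rewrite [X in (X * _)%E]chi2_ge0 mul1e.
apply: le_measure; rewrite ?inE.
- by apply: measurableX => //; exact: measurable_ge.
- rewrite -[X in measurable X]setTI; apply: measurable_add_sqr => //.
  exact: measurable_ge.
- by move=> [x y] [/= x0 ay]; rewrite /add_sqr /= (le_trans ay)// lerDr.
Qed.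

(** No continuity of the law is involved. The set [I] is closed upwards, hence an increasing union
    of rays starting at points of [I], each of mass at most [x]. The starting points tend to minus
    infinity, are constantly the infimum, or decrease to it, according as [I] is unbounded below,
    contains its infimum, or misses it. *)
Lemma survival_superuniform (Q : probability RM R) (x : R) : 0 <= x ->
  (Q [set y : RM | (fine (Q [set z : RM | (y <= z)%R]) <= x)%R] <= x%:E)%E.
Proof.
move=> x0; set I := [set y | _].
have S1 (y : R) : I y -> (Q [set z : RM | (y <= z)%R] <= x%:E)%E.
  by rewrite /I /= -lee_fin fineK// fin_num_measure//; exact: measurable_ge.
have up (y z : R) : y <= z -> I y -> I z.
  move=> yz; rewrite /I /=; apply: le_trans; apply: fine_le.
  - by rewrite fin_num_measure//; exact: measurable_ge.
  - by rewrite fin_num_measure//; exact: measurable_ge.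
  - apply: le_measure; rewrite ?inE; try exact: measurable_ge.
    by move=> t /=; exact: le_trans.
have seq_bound (u : nat -> R) : {homo u : i j / (i <= j)%N >-> j <= i} ->
    (forall i, I (u i)) -> (forall y, I y -> exists i, u i <= y) -> (Q I <= x%:E)%E.
  move=> ndu Iu cof.
  have IE : I = \bigcup_i [set z : RM | (u i <= z)%R].
    apply/seteqP; split => [y /cof[i uiy]|y [i _ /= uiy]]; first by exists i.
    exact: up uiy (Iu i).
  have mE i : measurable [set z : RM | (u i <= z)%R] by exact: measurable_ge.
  have cv : (Q \o (fun i => [set z : RM | (u i <= z)%R])) @ \oo --> Q I.
    rewrite IE; apply: nondecreasing_cvg_mu => //; first exact: bigcupT_measurable.
    move=> i j ij; apply/subsetPset => z /=; apply: le_trans; exact: ndu.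
  rewrite -(cvg_lim _ cv)//; apply: lime_le; first by apply/cvg_ex; exists (Q I).
  by near=> i; exact: S1.
have [I0|/set0P[y0 Iy0]] := eqVneq I set0; first by rewrite I0 measure0 lee_fin.
have [[b bI]|nbI] := pselect (exists b, forall y, I y -> b <= y); last first.
  apply: (seq_bound (fun n => - n%:R)).
  - by move=> i j ij; rewrite lerN2 ler_nat.
  - move=> i; apply: contrapT => nI; apply: nbI; exists (- i%:R) => y Iy.
    by rewrite leNgt; apply/negP => /ltW yi; apply: nI; exact: up yi Iy.
  - move=> y _; exists (Num.truncn `|y|).+1; rewrite lerNl.
    by rewrite (le_trans (ler_norm _))// normrN ltW// truncnS_gt.
have hI : @has_inf _ R I by split; [exists y0|exists b].
have [infI|ninfI] := pselect (I (@inf R I)).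
  apply: (seq_bound (fun=> @inf R I)) => // y Iy; exists 0%N.
  exact: @ge_inf R I (proj2 hI) _ Iy.
apply: (seq_bound (fun n => @inf R I + n.+1%:R^-1)).
- by move=> i j ij; rewrite lerD2l lef_pV2 ?posrE// ler_nat.
- move=> i; have e0 : 0 < i.+1%:R^-1 :> R by rewrite invr_gt0.
  have [y Iy yi] := inf_adherent e0 hI.
  exact: up (ltW yi) Iy.
- move=> y Iy; have iy : @inf R I < y.
    rewrite lt_neqAle (@ge_inf R I (proj2 hI) _ Iy) andbT; apply/eqP => E.
    by apply: ninfI; rewrite E.
  exists (Num.truncn (y - @inf R I)^-1); rewrite -lerBrDl -[leRHS]invrK lef_pV2 ?posrE ?invr_gt0 ?subr_gt0//.
  by rewrite ltW// truncnS_gt.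
Unshelve. all: by end_near.
Qed.

End ChiSquareTail.

(** * Second moments *)

Section Expectation.
Context {R : realType} {d : measure_display} {Omega : measurableType d}.
Variable P : probability Omega R.
Implicit Types X Y : Omega -> R.

Definition L1 X := P.-integrable setT (EFin \o X).
Definition mean X : R := (\int[P]_w X w)%R.

Lemma meanE X : L1 X -> (\int[P]_w (X w)%:E = (mean X)%:E)%E.
Proof. by move=> iX; rewrite /mean /Rintegral fineK//; exact: integrable_fin_num. Qed.

Lemma L1_measurable X : L1 X -> measurable_fun setT X.
Proof. by move=> /(measurable_int P) /measurable_EFinP. Qed.

Lemma L1_le X Y : measurable_fun setT X -> (forall w, `|X w| <= Y w) -> L1 Y -> L1 X.
Proof.
move=> mX XY iY; apply: (le_integrable measurableT _ _ iY).
  exact/measurable_EFinP.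
by move=> w _ /=; rewrite lee_fin (le_trans (XY w))// ler_norm.
Qed.

Lemma L1_cst c : L1 (fun=> c).
Proof. exact: finite_measure_integrable_cst. Qed.

Lemma mean_cst c : mean (fun=> c) = c.
Proof.
rewrite /mean Rintegral_cst// -[RHS]mulr1; congr (_ * _).
exact: (congr1 fine (probability_setT P)).
Qed.

Lemma L1D X Y : L1 X -> L1 Y -> L1 (fun w => X w + Y w).
Proof. exact: integrableD. Qed.

Lemma meanD X Y : L1 X -> L1 Y -> mean (fun w => X w + Y w) = mean X + mean Y.
Proof. exact: RintegralD. Qed.

Lemma L1Z c X : L1 X -> L1 (fun w => c * X w).
Proof. exact: integrableZl. Qed.

Lemma meanZ c X : L1 X -> mean (fun w => c * X w) = c * mean X.
Proof. exact: RintegralZl. Qed.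

Lemma L1_sum (T : finType) (X : T -> Omega -> R) :
  (forall t, L1 (X t)) -> L1 (fun w => \sum_t X t w).
Proof.
move=> iX; have := @integrable_sum _ _ _ P setT measurableT T (index_enum T) xpredT
  (fun t => EFin \o X t) (fun t _ => iX t).
by apply: eq_integrable => // w _; rewrite /= sumEFin.
Qed.

Lemma mean_sum (T : finType) (X : T -> Omega -> R) :
  (forall t, L1 (X t)) -> mean (fun w => \sum_t X t w) = \sum_t mean (X t).
Proof.
move=> iX; apply: EFin_inj; rewrite -sumEFin -meanE; last exact: L1_sum.
under [RHS]eq_bigr do rewrite -meanE//.
rewrite -integral_sum//.
by apply: eq_integral => w _; rewrite sumEFin.
Qed.

Lemma le_mean X Y : L1 X -> L1 Y -> (forall w, X w <= Y w) -> mean X <= mean Y.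
Proof. by move=> iX iY XY; apply: le_Rintegral. Qed.

Lemma L1_of_sqr X : measurable_fun setT X -> L1 (fun w => X w ^+ 2) -> L1 X.
Proof.
move=> mX iX2; apply: (@L1_le _ (fun w => 1 + X w ^+ 2)) => //.
  move=> w; have [_|_] := ger0P (X w); nra.
exact: L1D (L1_cst 1) iX2.
Qed.

Lemma markov_ineq X (x c : R) : 0 < x -> (forall w, 0 <= X w) -> L1 X -> mean X <= c ->
  (P [set w | x <= X w]%R <= (c / x)%:E)%E.
Proof.
move=> x0 X0 iX Xc; set A := [set w | _].
have mX := L1_measurable iX.
have mA : measurable A.
  by rewrite -[A]setTI; apply: (@measurable_fun_le _ _ R setT (cst x)).
rewrite EFinM lee_pdivlMr//.
apply: (@le_trans _ _ (\int[P]_(w in A) x%:E)%E); first by rewrite integral_cst// muleC.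
apply: (@le_trans _ _ (\int[P]_(w in A) (X w)%:E)%E).
  apply: ge0_le_integral => //.
  - by move=> w _; rewrite lee_fin ltW.
  - by apply: measurable_funTS; exact/measurable_EFinP.
apply: (@le_trans _ _ (\int[P]_w (X w)%:E)%E).
  apply: ge0_subset_integral => //; first exact/measurable_EFinP.
  by move=> w _; rewrite lee_fin.
by rewrite meanE// lee_fin.
Qed.

Lemma chebyshev_ineq X (x c : R) : 0 < x -> measurable_fun setT X ->
  L1 (fun w => X w ^+ 2) -> mean (fun w => X w ^+ 2) <= c ->
  (P [set w | x <= `|X w|]%R <= (c / x ^+ 2)%:E)%E.
Proof.
move=> x0 mX iX2 Xc.
have -> : [set w | x <= `|X w|] = [set w | x ^+ 2 <= X w ^+ 2].
  apply/seteqP; split => w /=; rewrite -[X w ^+ 2]real_normK ?num_real//.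
    by move=> xX; rewrite lerXn2r// nnegrE// ltW.
  by rewrite ler_pXn2r// nnegrE// ltW.
apply: markov_ineq => //; first by rewrite exprn_gt0.
by move=> w; rewrite sqr_ge0.
Qed.

Definition independent_pair X Y := forall A B : set R, measurable A -> measurable B ->
  (P (X @^-1` A `&` Y @^-1` B) = P (X @^-1` A) * P (Y @^-1` B))%E.

Lemma independent_mean X Y : independent_pair X Y -> L1 X -> L1 Y ->
  L1 (fun w => X w * Y w) /\ mean (fun w => X w * Y w) = mean X * mean Y.
Proof.
move=> XY iX iY.
pose X' : {mfun Omega >-> R} :=
  HB.pack X (isMeasurableFun.Build _ _ _ _ X (L1_measurable iX)).
pose Y' : {mfun Omega >-> R} :=
  HB.pack Y (isMeasurableFun.Build _ _ _ _ Y (L1_measurable iY)).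
have iXY : L1 (fun w => X w * Y w) := @independent_integrableM _ _ _ P X' Y' XY iX iY.
split => //; apply: EFin_inj; rewrite EFinM -!meanE//.
exact: (@independent_integralM _ _ _ P X' Y' XY iX iY).
Qed.

Lemma mean_sqr_sum (T : finType) (X : T -> Omega -> R) :
    (forall t, measurable_fun setT (X t)) -> (forall t, L1 (fun w => X t w ^+ 2)) ->
    (forall t, mean (X t) = 0) ->
    (forall t u, t != u -> independent_pair (X t) (X u)) ->
  L1 (fun w => (\sum_t X t w) ^+ 2) /\
  mean (fun w => (\sum_t X t w) ^+ 2) = \sum_t mean (fun w => X t w ^+ 2).
Proof.
move=> mX iX2 X0 Xind.
have iX t : L1 (X t) by exact: L1_of_sqr.
have Xtu t u : L1 (fun w => X t w * X u w) /\
    mean (fun w => X t w * X u w) = if t == u then mean (fun w => X t w ^+ 2) else 0.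
  have [<-|tu] := eqVneq t u; first by split; [exact: iX2|].
  by have [? ->] := independent_mean (Xind _ _ tu) (iX t) (iX u); rewrite X0 mul0r.
have E : (fun w => (\sum_t X t w) ^+ 2) = (fun w => \sum_t \sum_u X t w * X u w).
  by apply/funext => w; rewrite expr2 big_distrlr.
have iin t : L1 (fun w => \sum_u X t w * X u w).
  by apply: L1_sum => u; have [] := Xtu t u.
rewrite E; split; first exact: L1_sum.
rewrite mean_sum//; apply: eq_bigr => t _.
rewrite mean_sum; last by move=> u; have [] := Xtu t u.
rewrite (bigD1 t)//= (proj2 (Xtu t t)) eqxx big1 ?addr0// => u ut.
by rewrite (proj2 (Xtu t u)) eq_sym (negbTE ut).
Qed.

Lemma standard_normal_mean (V : {RV P >-> R}) (f : R -> R) : standard_normal V ->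
    measurable_fun setT f -> std_normal.-integrable setT (EFin \o f) ->
  L1 (f \o V) /\ mean (f \o V) = (\int[std_normal]_x f x)%R.
Proof.
move=> nV mf fi.
have mf' : measurable_fun [set: measurableTypeR R] (EFin \o f) by exact/measurable_EFinP.
have mV : measurable_fun setT (V : Omega -> measurableTypeR R).
  by move=> mT A mA; rewrite setTI; exact: (measurable_funPTI V mA).
pose V' : {mfun Omega >-> measurableTypeR R} :=
  HB.pack (V : Omega -> measurableTypeR R) (isMeasurableFun.Build _ _ _ _ _ mV).
have eqm (g : measurableTypeR R -> \bar R) :
    (\int[distribution P V']_x g x = \int[std_normal]_x g x)%E.
  by apply: eq_measure_integral => A mA _; exact: nV.
have iV : L1 (f \o V).
  apply/integrableP; split.
    by apply/measurable_EFinP; apply: (measurableT_comp mf).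
  have /integrableP[_] := fi; rewrite -eqm ge0_integral_distribution//.
  exact: measurableT_comp.
split => //; rewrite /mean /Rintegral -eqm; congr fine.
by rewrite (integral_distribution (X := V')).
Qed.

End Expectation.

Section Blocks.
Context {R : realType} {d : measure_display} {Omega : measurableType d}.
Variable P : probability Omega R.
Variables (I : finType) (V : I -> {RV P >-> R}).
Hypothesis indepV : mutually_independent V.

Lemma independent_pair_blocks (J1 J2 : {set I}) (X Y : Omega -> R) :
    (forall i, i \in J1 -> i \notin J2) -> depends_on V J1 X -> depends_on V J2 Y ->
  independent_pair P X Y.
Proof.
move=> J12 dX dY A B mA mB; apply: (independent_blocks indepV J12).
  by rewrite -[_ @^-1` _]setTI; exact: dX.
by rewrite -[_ @^-1` _]setTI; exact: dY.
Qed.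

End Blocks.

Section DependsOn.
Context {R : realType} {d : measure_display} {Omega : measurableType d}.
Variable P : probability Omega R.
Variables (I : finType) (V : I -> {RV P >-> R}).
Implicit Types (J : {set I}) (X Y : Omega -> R).

Lemma depends_onD J X Y : depends_on V J X -> depends_on V J Y ->
  depends_on V J (fun w => X w + Y w).
Proof. exact: measurable_funD. Qed.

Lemma depends_onM J X Y : depends_on V J X -> depends_on V J Y ->
  depends_on V J (fun w => X w * Y w).
Proof. exact: measurable_funM. Qed.

Lemma depends_on_cst J c : depends_on V J (fun=> c).
Proof. exact: measurable_cst. Qed.

Lemma depends_onX J X k : depends_on V J X -> depends_on V J (fun w => X w ^+ k).
Proof. exact: measurable_funX. Qed.

Lemma depends_on_comp J (f : R -> R) X : measurable_fun setT f -> depends_on V J X ->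
  depends_on V J (fun w => f (X w)).
Proof. by move=> mf dX; exact: (measurableT_comp mf dX). Qed.

Lemma depends_on_var J i : i \in J -> depends_on V J (V i).
Proof. exact: measurable_block_var. Qed.

Lemma depends_on_sum J T (s : seq T) (X : T -> Omega -> R) :
  (forall t, depends_on V J (X t)) -> depends_on V J (fun w => \sum_(t <- s) X t w).
Proof. by move=> dX; apply: measurable_sum. Qed.

Lemma sub_depends_on J1 J2 X : (forall i, i \in J1 -> i \in J2) ->
  depends_on V J1 X -> depends_on V J2 X.
Proof.
move=> J12 dX mT A mA; have := dX measurableT A mA; rewrite !setTI.
exact: sub_block.
Qed.

End DependsOn.

Section NormalSums.
Context {R : realType} {d : measure_display} {Omega : measurableType d}.
Variable P : probability Omega R.
Variables (I : finType) (V : I -> {RV P >-> R}).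
Hypothesis indepV : mutually_independent V.

Definition normal_kurtosis : R := (\int[@std_normal R]_x x ^+ 4)%R.
Local Notation C4 := normal_kurtosis.

Definition vsum (s : seq I) (w : Omega) : R := \sum_(k <- s) V k w.

Lemma depends_on_vsum s : depends_on V [set k in s] (vsum s).
Proof.
elim: s => [|k s IH].
  have -> : vsum [::] = fun=> 0 by apply/funext => w; rewrite /vsum big_nil.
  exact: depends_on_cst.
have -> : vsum (k :: s) = fun w => V k w + vsum s w.
  by apply/funext => w; rewrite /vsum big_cons.
apply: depends_onD; first by apply: depends_on_var; rewrite inE mem_head.
apply: sub_depends_on IH => i; rewrite !inE => ->; exact: orbT.
Qed.

Lemma normal_moments k : standard_normal (V k) ->
  [/\ mean P (V k) = 0, mean P (fun w => V k w ^+ 2) = 1,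
      L1 P (fun w => V k w ^+ 4) & mean P (fun w => V k w ^+ 4) = C4].
Proof.
move=> nV.
have [_ e1] := standard_normal_mean nV (@measurable_id _ _ _) (@normal_integrable_id R).
have m2 : measurable_fun setT (fun x : R => x ^+ 2) by exact: measurable_funX.
have m4 : measurable_fun setT (fun x : R => x ^+ 4) by exact: measurable_funX.
have [_ e2] := standard_normal_mean nV m2 (@normal_integrable_sqr R).
have [i4 e4] := standard_normal_mean nV m4 (@normal_integrable_fourth R).
split => //.
- by rewrite [LHS]e1 /Rintegral normal_mean.
- by rewrite [LHS]e2 /Rintegral normal_second_moment.
Qed.

Lemma L1_pow (X : Omega -> R) k : (k <= 4)%N -> measurable_fun setT X ->
  L1 P (fun w => X w ^+ 4) -> L1 P (fun w => X w ^+ k).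
Proof.
move=> k4 mX iX; apply: (@L1_le _ _ _ _ _ (fun w => 1 + X w ^+ 4)).
- exact: measurable_funX.
- move=> w; rewrite normrX -(ger0_norm (exprn_even_ge0 (X w) (isT : ~~ odd 4))) normrX.
  have [x1|x1] := leP `|X w| 1.
    apply: (@le_trans _ _ 1); first exact: exprn_ile1.
    by rewrite lerDl exprn_ge0.
  apply: (@le_trans _ _ (`|X w| ^+ 4)); last by rewrite lerDr.
  by rewrite ler_weXn2l// ltW.
- exact: L1D (L1_cst P 1) iX.
Qed.

(** The law of the sum is never identified. Expanding [(V k + S) ^ 4] with [N] terms in [S], the odd
    cross terms vanish and [C4 + 6 N + (C4 + 3) N ^ 2 <= (C4 + 3) (N + 1) ^ 2] closes the induction.
    [C4] stays symbolic, as only the order [N ^ 2] matters later. *)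
Lemma vsum_moments (s : seq I) : uniq s -> (forall k, k \in s -> standard_normal (V k)) ->
  [/\ L1 P (fun w => vsum s w ^+ 4), mean P (vsum s) = 0,
      mean P (fun w => vsum s w ^+ 2) = (size s)%:R &
      mean P (fun w => vsum s w ^+ 4) <= (C4 + 3) * (size s)%:R ^+ 2].
Proof.
elim: s => [_ _|k s IH /andP[ks us] nV].
  have E : vsum [::] = fun=> 0 by apply/funext => w; rewrite /vsum big_nil.
  have E' j : (fun w : Omega => vsum [::] w ^+ j.+1) = fun=> 0.
    by apply/funext => w; rewrite E expr0n.
  rewrite !E' E !mean_cst mulr0n expr0n mulr0 lexx; split => //.
  exact: (L1_cst P 0).
have nVk : standard_normal (V k) by apply: nV; rewrite mem_head.
have [i4 e1 e2 e4] : [/\ L1 P (fun w => vsum s w ^+ 4), mean P (vsum s) = 0,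
      mean P (fun w => vsum s w ^+ 2) = (size s)%:R &
      mean P (fun w => vsum s w ^+ 4) <= (C4 + 3) * (size s)%:R ^+ 2].
  by apply: IH => // i si; apply: nV; rewrite inE si orbT.
have [v1 v2 iv4 v4] := normal_moments nVk.
have mV : measurable_fun setT (V k : Omega -> R) by exact: measurable_funP.
have dS : depends_on V [set i in s] (vsum s) := @depends_on_vsum s.
have mS := depends_on_measurable dS.
have prod a b : (a <= 4)%N -> (b <= 4)%N ->
    L1 P (fun w => V k w ^+ a * vsum s w ^+ b) /\
    mean P (fun w => V k w ^+ a * vsum s w ^+ b) =
    mean P (fun w => V k w ^+ a) * mean P (fun w => vsum s w ^+ b).
  move=> a4 b4; apply: independent_mean; try exact: L1_pow.
  apply: (@independent_pair_blocks _ _ _ _ _ V indepV [set k] [set i in s]).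
  - by move=> i; rewrite !inE => /eqP ->.
  - by apply: depends_onX; apply: depends_on_var; rewrite inE.
  - exact: depends_onX.
have Sk : vsum (k :: s) = fun w => V k w + vsum s w.
  by apply/funext => w; rewrite /vsum big_cons.
pose mono a b := fun w => V k w ^+ a * vsum s w ^+ b.
have i_ a b : (a <= 4)%N -> (b <= 4)%N -> L1 P (mono a b) by move=> a4 b4; case: (prod a b a4 b4).
have m_ a b : (a <= 4)%N -> (b <= 4)%N ->
    mean P (mono a b) = mean P (fun w => V k w ^+ a) * mean P (fun w => vsum s w ^+ b).
  by move=> a4 b4; case: (prod a b a4 b4).
have m0 X : mean P (fun w : Omega => X w ^+ 0) = 1 by exact: (mean_cst P 1).
have m1 X : mean P (fun w : Omega => X w ^+ 1) = mean P X by [].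
have E1 : vsum (k :: s) = fun w => mono 1 0 w + mono 0 1 w.
  by rewrite Sk; apply/funext => w; rewrite /mono; ring.
have E2 : (fun w => vsum (k :: s) w ^+ 2) =
    fun w => mono 2 0 w + (2 * mono 1 1 w + mono 0 2 w).
  by rewrite Sk; apply/funext => w; rewrite /mono; ring.
have E4 : (fun w => vsum (k :: s) w ^+ 4) =
    fun w => mono 4 0 w + (4 * mono 3 1 w + (6 * mono 2 2 w + (4 * mono 1 3 w + mono 0 4 w))).
  by rewrite Sk; apply/funext => w; rewrite /mono; ring.
have C0 : 0 <= C4 by rewrite -v4; apply: Rintegral_ge0 => w _; rewrite exprn_even_ge0.
rewrite E4 E2 E1; split.
- by do ![apply: L1D|apply: L1Z|apply: i_].
- by rewrite meanD ?i_// !m_// !m0 !m1 v1 e1; ring.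
- have i11 := L1Z 2 (i_ 1 1 isT isT).
  rewrite (meanD (i_ 2 0 isT isT) (L1D i11 (i_ 0 2 isT isT))) (meanD i11 (i_ 0 2 isT isT)).
  rewrite (meanZ 2 (i_ 1 1 isT isT)) !m_// !m0 !m1 v2 e1 e2 /= -natr1; ring.
- have i31 := L1Z 4 (i_ 3 1 isT isT); have i22 := L1Z 6 (i_ 2 2 isT isT).
  have i13 := L1Z 4 (i_ 1 3 isT isT); have i04 := i_ 0 4 isT isT.
  rewrite (meanD (i_ 4 0 isT isT) (L1D i31 (L1D i22 (L1D i13 i04)))).
  rewrite (meanD i31 (L1D i22 (L1D i13 i04))) (meanD i22 (L1D i13 i04)) (meanD i13 i04).
  rewrite !meanZ ?m_ ?m0 ?m1 ?v1 ?v2 ?v4 ?e1 ?e2//; try exact: i_.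
  rewrite /= -natr1; move: e4; set x := (size s)%:R.
  have : 0 <= x by rewrite /x.
  nra.
Qed.

End NormalSums.

Section FiniteValued.
Context {R : realType} {d : measure_display} {Omega : measurableType d}.
Variable P : probability Omega R.
Variables (T : finType) (g : Omega -> T).
Hypothesis mg : forall e, measurable [set w | g w = e].

Lemma measurable_finite_valued (Q : pred T) : measurable [set w | Q (g w)].
Proof.
have -> : [set w | Q (g w)] = \bigcup_(e in [set e | Q e]) [set w | g w = e].
  by apply/seteqP; split => [w Qw|w [e Qe /= ge]]; [exists (g w)|rewrite ge].
by apply: fin_bigcup_measurable.
Qed.

Lemma finite_valued_law (Q : pred T) :
  (P [set w | Q (g w)] = (\sum_(e | Q e) fine (P [set w | g w = e]))%:E)%E.
Proof.
have -> : [set w | Q (g w)] = [set w | g w \in [seq e <- index_enum T | Q e]].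
  by apply/funext => w; rewrite /= mem_filter mem_index_enum andbT.
rewrite -big_filter.
have : uniq [seq e <- index_enum T | Q e] by rewrite filter_uniq// index_enum_uniq.
elim: [seq e <- _ | _] => [_|e s IH /andP[es us]].
  rewrite big_nil (_ : [set _ | _] = set0) ?measure0//.
  by apply/seteqP; split => w.
rewrite big_cons EFinD -IH// fineK ?fin_num_measure//.
rewrite -measureU//.
- congr (P _); apply/seteqP; split => w /=; rewrite inE.
    by move=> /orP[/eqP|]; [left|right].
  by move=> [->|->]; rewrite ?eqxx ?orbT.
- exact: (measurable_finite_valued (mem s)).
- by apply/seteqP; split => // w /= [-> ]; rewrite (negbTE es).
Qed.

End FiniteValued.

Section IndependentBlocks.
Context {R : realType} {d : measure_display} {Omega : measurableType d}.
Variable P : probability Omega R.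
Variables (I : finType) (V : I -> {RV P >-> R}).
Hypothesis indepV : mutually_independent V.

(** The blocks already treated merge into a single block, disjoint from the next one, so
    independence of two blocks can be iterated. *)
Lemma independent_blocks_prod (T : finType) (J : T -> {set I}) (E : T -> set Omega) :
    (forall t u i, i \in J t -> i \in J u -> t = u) -> (forall t, block V (J t) (E t)) ->
  (P (\bigcap_t E t) = \prod_t P (E t))%E.
Proof.
move=> disj bE.
suff H (s : seq T) : uniq s ->
    block V [set i | [exists t, (t \in s) && (i \in J t)]] (\bigcap_(t in [set` s]) E t) /\
    (P (\bigcap_(t in [set` s]) E t) = \prod_(t <- s) P (E t))%E.
  have [_] := H (index_enum T) (index_enum_uniq T).
  have -> : [set` index_enum T] = [set: T] by apply/seteqP; split => // t _ /=; rewrite mem_index_enum.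
  by [].
elim: s => [_|t s IH /andP[ts us]].
  rewrite (_ : [set` [::]] = set0); last by apply/seteqP; split.
  rewrite bigcap_set0 big_nil probability_setT; split => //.
  by have := @measurableT _ (blockType V [set i | [exists t, (t \in [::]) && (i \in J t)]]%SET).
have [bs Ps] := IH us.
have SE : [set` t :: s] = t |` [set` s].
  apply/seteqP; split => u /=; rewrite inE.
    by move=> /orP[/eqP|]; [left|right].
  by move=> [->|->]; rewrite ?eqxx ?orbT.
rewrite SE bigcap_setU1 big_cons; split.
  have m1 : block V [set i | [exists u, (u \in t :: s) && (i \in J u)]] (E t).
    apply: sub_block (bE t) => i it; rewrite inE; apply/existsP; exists t.
    by rewrite mem_head.
  have m2 : block V [set i | [exists u, (u \in t :: s) && (i \in J u)]]
      (\bigcap_(t in [set` s]) E t).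
    apply: sub_block bs => i; rewrite !inE => /existsP[u /andP[us' iu]].
    by apply/existsP; exists u; rewrite inE us' orbT.
  exact: (@measurableI _ (blockType V [set i | [exists u, (u \in t :: s) && (i \in J u)]]%SET) _ _ m1 m2).
rewrite -Ps; apply: (independent_blocks indepV _ (bE t) bs) => i it.
rewrite inE; apply/existsP => -[u /andP[us' iu]].
by move: ts; rewrite (disj t u i it iu) us'.
Qed.

Definition vsumsq (s : seq I) (w : Omega) : R := \sum_(k <- s) V k w ^+ 2.

Lemma depends_on_vsumsq (s : seq I) (J : {set I}) : (forall i, i \in s -> i \in J) ->
  depends_on V J (vsumsq s).
Proof.
elim: s => [_|k s IH sJ].
  have -> : vsumsq [::] = fun=> 0 by apply/funext => w; rewrite /vsumsq big_nil.
  exact: depends_on_cst.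
have -> : vsumsq (k :: s) = fun w => V k w ^+ 2 + vsumsq s w.
  by apply/funext => w; rewrite /vsumsq big_cons.
apply: depends_onD; last by apply: IH => i si; apply: sJ; rewrite inE si orbT.
by apply: depends_onX; apply: depends_on_var; rewrite sJ// mem_head.
Qed.

Lemma vsumsq_law (s : seq I) (A : set R) : uniq s ->
    (forall k, k \in s -> standard_normal (V k)) -> measurable A ->
  P (vsumsq s @^-1` A) = chi2_prob (size s) A.
Proof.
move=> + + mA; elim: s A mA => [|k s IH] A mA.
  move=> _ _.
  have -> : vsumsq [::] = fun=> 0 by apply/funext => w; rewrite /vsumsq big_nil.
  rewrite preimage_cst /= diracE; case: ifP => _; first exact: probability_setT.
  exact: measure0.
move=> /andP[ks us] nV.
have nVk : standard_normal (V k) by apply: nV; rewrite mem_head.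
have {}IH := fun A mA => IH A mA us (fun i si => nV i (mem_behead (s := k :: s) si)).
pose RM := measurableTypeR R.
have dS : depends_on V [set i in s]%SET (vsumsq s).
  by apply: depends_on_vsumsq => i; rewrite inE.
have mS : measurable_fun setT (vsumsq s : Omega -> RM).
  by move=> mT B mB; exact: (depends_on_measurable dS mT mB).
have mV : measurable_fun setT (V k : Omega -> RM).
  by move=> mT B mB; rewrite setTI; exact: (measurable_funPTI (V k) mB).
have mSV : measurable_fun setT (fun w => (vsumsq s w, V k w) : RM * RM).
  exact: measurable_fun_pair.
pose SV : {mfun Omega >-> (RM * RM)%type} :=
  HB.pack (fun w => (vsumsq s w, V k w) : RM * RM) (isMeasurableFun.Build _ _ _ _ _ mSV).
rewrite [RHS]chi2_probS.
have -> : vsumsq (k :: s) @^-1` A = SV @^-1` (add_sqr @^-1` A).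
  apply/seteqP; split => w; rewrite /preimage /= /add_sqr /= /vsumsq big_cons addrC//.
apply/esym; rewrite -[RHS]/(distribution P SV (add_sqr @^-1` A)).
apply: product_measure_unique; last first.
  by rewrite -[X in measurable X]setTI; exact: measurable_add_sqr.
move=> B C mB mC; rewrite -[LHS]/(P ((vsumsq s @^-1` B) `&` (V k @^-1` C))).
rewrite (@independent_pair_blocks _ _ _ _ _ V indepV [set i in s]%SET [set k]%SET)//.
- by rewrite IH//; congr (_ * _)%E; exact: nVk.
- by move=> i; rewrite !inE; apply: contraTN => /eqP ->.
- by apply: depends_on_var; rewrite inE.
Qed.

End IndependentBlocks.

(** * Noise of the row sums and of the columns *)

Section Rows.
Context {R : realType} {d : measure_display} {Omega : measurableType d}.
Variable P : probability Omega R.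
Variables (I : finType) (V : I -> {RV P >-> R}) (n p : nat) (z : 'I_n -> 'I_p -> I).
Hypotheses (indepV : mutually_independent V)
  (zinj : forall i j i' j', z i j = z i' j' -> i = i' /\ j = j')
  (nz : forall i j, standard_normal (V (z i j))).

Local Notation C4 := (@normal_kurtosis R).

(** Entries are reached through an injection [z] into an arbitrary index type, so that the same
    moments serve the null model, indexed by entries, and the alternative, whose family also
    contains the labels and [mu]. *)
Definition row_indices (i : 'I_n) : seq I := [seq z i j | j <- enum 'I_p].

Lemma uniq_row_indices i : uniq (row_indices i).
Proof. by rewrite map_inj_uniq ?enum_uniq// => j j' /zinj[]. Qed.

Lemma size_row_indices i : size (row_indices i) = p.
Proof. by rewrite size_map size_enum_ord. Qed.

Lemma vsum_row i w : vsum V (row_indices i) w = \sum_j V (z i j) w.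
Proof. by rewrite /vsum big_map big_enum. Qed.

Lemma row_indices_normal i k : k \in row_indices i -> standard_normal (V k).
Proof. by move=> /mapP[j _ ->]. Qed.

Lemma row_indices_disjoint i i' k : k \in row_indices i -> k \in row_indices i' -> i = i'.
Proof. by move=> /mapP[j _ ->] /mapP[j' _ /zinj[]]. Qed.

(** In the absence of signal this is [p] times [p * |xbar| ^ 2 - n]. *)
Definition quadratic_noise (w : Omega) : R :=
  \sum_i (vsum V (row_indices i) w ^+ 2 - p%:R).

Lemma quadratic_noise_moment : [/\ measurable_fun setT quadratic_noise,
  L1 P (fun w => quadratic_noise w ^+ 2) &
  mean P (fun w => quadratic_noise w ^+ 2) <= (C4 + 3) * (n%:R * p%:R ^+ 2)].
Proof.
pose X i w := vsum V (row_indices i) w ^+ 2 - p%:R.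
have dX i : depends_on V [set k in row_indices i]%SET (X i).
  apply: depends_onD; last exact: depends_on_cst.
  by apply: depends_onX; exact: (@depends_on_vsum _ _ _ _ _ V).
have mX i := depends_on_measurable (dX i).
have mom i := vsum_moments indepV (uniq_row_indices i) (@row_indices_normal i).
have mA i : measurable_fun setT (vsum V (row_indices i)).
  exact: (depends_on_measurable (@depends_on_vsum _ _ _ _ _ V (row_indices i))).
have i4 i : L1 P (fun w => vsum V (row_indices i) w ^+ 4) by case: (mom i).
have i2 i : L1 P (fun w => vsum V (row_indices i) w ^+ 2) by apply: L1_pow.
have e2 i : mean P (fun w => vsum V (row_indices i) w ^+ 2) = p%:R.
  by case: (mom i); rewrite size_row_indices.
have e4 i : mean P (fun w => vsum V (row_indices i) w ^+ 4) <= (C4 + 3) * p%:R ^+ 2.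
  by case: (mom i); rewrite size_row_indices.
have X0 i : mean P (X i) = 0.
  by rewrite /X (meanD (i2 i) (L1_cst P (- p%:R))) e2 mean_cst subrr.
have XE i : (fun w => X i w ^+ 2) = fun w => vsum V (row_indices i) w ^+ 4 +
    ((- 2 * p%:R) * vsum V (row_indices i) w ^+ 2 + p%:R ^+ 2).
  by apply/funext => w; rewrite /X; ring.
have iX2 i : L1 P (fun w => X i w ^+ 2).
  by rewrite XE; do ![apply: L1D|apply: L1Z|apply: L1_cst|done].
have eX2 i : mean P (fun w => X i w ^+ 2) <= (C4 + 3) * p%:R ^+ 2.
  have i2' := L1Z (- 2 * p%:R) (i2 i).
  rewrite XE (meanD (i4 i) (L1D i2' (L1_cst P _))) (meanD i2' (L1_cst P _)) mean_cst.
  rewrite (meanZ _ (i2 i)) e2; have := e4 i; have := sqr_ge0 (p%:R : R); lra.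
have [iS ES] := mean_sqr_sum mX iX2 X0 (fun i i' ii' =>
  independent_pair_blocks indepV (J1 := [set k in row_indices i]%SET)
   (J2 := [set k in row_indices i']%SET)
   (fun k => ltac:(rewrite !inE => ki; apply: contra_neqN ii'; exact: row_indices_disjoint))
   (dX i) (dX i')).
split.
- by apply: measurable_sum => i; exact: mX.
- exact: iS.
- rewrite /quadratic_noise [leLHS]ES (le_trans (ler_sum _ (fun i _ => eX2 i)))//.
  by rewrite sumr_const card_ord -[leLHS]mulr_natl mulrCA.
Qed.

Variable l : 'I_n -> I.
Hypotheses (linj : injective l) (lz : forall i i' j, l i <> z i' j).

(** The model makes labels equal to 1 or -1 only almost surely. Rounding to a sign makes the square
    1 everywhere and still depends on the label alone. *)
Definition label_sign (x : R) : R := if x == 1 then 1 else -1.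

Lemma label_sign_sqr x : label_sign x ^+ 2 = 1.
Proof. by rewrite /label_sign; case: ifP => _; rewrite ?sqrrN expr1n. Qed.

Lemma measurable_label_sign : measurable_fun setT label_sign.
Proof.
apply: measurable_fun_ifT => //.
apply: measurable_fun_eqr => //.
Qed.

Definition label (i : 'I_n) (w : Omega) : R := label_sign (V (l i) w).

Lemma depends_on_label i : depends_on V [set l i]%SET (label i).
Proof.
apply: depends_on_comp; first exact: measurable_label_sign.
by apply: depends_on_var; rewrite inE.
Qed.

Lemma label_norm i w : `|label i w| = 1.
Proof. by rewrite /label /label_sign; case: ifP => _; rewrite ?normrN normr1. Qed.

Lemma mean_label_mul i (J : {set I}) (X : Omega -> R) : l i \notin J -> depends_on V J X ->
  L1 P X -> mean P X = 0 ->
  L1 P (fun w => label i w * X w) /\ mean P (fun w => label i w * X w) = 0.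
Proof.
move=> lJ dX iX X0.
have iL : L1 P (label i).
  apply: (@L1_le _ _ _ _ _ (fun=> 1)); last exact: L1_cst.
    exact: (depends_on_measurable (@depends_on_label i)).
  by move=> w; rewrite label_norm.
have [|? ->] := @independent_mean _ _ _ P (label i) X _ iL iX; last by rewrite X0 mulr0.
apply: (independent_pair_blocks indepV _ (@depends_on_label i) dX) => k.
by rewrite inE => /eqP ->.
Qed.

Definition linear_noise (w : Omega) : R :=
  \sum_i label i w * vsum V (row_indices i) w.

Lemma linear_noise_moment : [/\ measurable_fun setT linear_noise,
  L1 P (fun w => linear_noise w ^+ 2) &
  mean P (fun w => linear_noise w ^+ 2) = n%:R * p%:R].
Proof.
pose X i w := label i w * vsum V (row_indices i) w.
have dA i : depends_on V [set k in row_indices i]%SET (vsum V (row_indices i)).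
  exact: (@depends_on_vsum _ _ _ _ _ V).
have dX i : depends_on V (l i |: [set k in row_indices i])%SET (X i).
  apply: depends_onM.
    by apply: sub_depends_on (@depends_on_label i) => k; rewrite !inE => ->.
  by apply: sub_depends_on (dA i) => k; rewrite !inE => ->; rewrite orbT.
have mX i := depends_on_measurable (dX i).
have mom i := vsum_moments indepV (uniq_row_indices i) (@row_indices_normal i).
have mA i := depends_on_measurable (dA i).
have i4 i : L1 P (fun w => vsum V (row_indices i) w ^+ 4) by case: (mom i).
have i2 i : L1 P (fun w => vsum V (row_indices i) w ^+ 2) by apply: L1_pow.
have i1 i : L1 P (vsum V (row_indices i)) := @L1_pow _ _ _ P _ 1 isT (mA i) (i4 i).
have e2 i : mean P (fun w => vsum V (row_indices i) w ^+ 2) = p%:R.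
  by case: (mom i); rewrite size_row_indices.
have e1 i : mean P (vsum V (row_indices i)) = 0 by case: (mom i).
have X0 i : mean P (X i) = 0.
  have [|_ ->//] := @mean_label_mul i [set k in row_indices i]%SET _ _ (dA i) (i1 i) (e1 i).
  by rewrite inE; apply/negP => /mapP[j _ /lz].
have XE i : (fun w => X i w ^+ 2) = fun w => vsum V (row_indices i) w ^+ 2.
  by apply/funext => w; rewrite /X exprMn label_sign_sqr mul1r.
have iX2 i : L1 P (fun w => X i w ^+ 2) by rewrite XE.
have [iS ES] := mean_sqr_sum mX iX2 X0 (fun i i' ii' =>
  independent_pair_blocks indepV (J1 := (l i |: [set k in row_indices i])%SET)
   (J2 := (l i' |: [set k in row_indices i'])%SET)
   (fun k => ltac:(rewrite !inE => /orP[/eqP ->|ki]; [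
      rewrite (inj_eq linj) (negbTE ii') /=; apply/negP => /mapP[j _ /lz]//
     |rewrite negb_or; apply/andP; split;
        [apply/eqP => kl; move: ki; rewrite kl => /mapP[j _ /lz]//
        |apply: contra_neqN ii'; exact: row_indices_disjoint]]))
   (dX i) (dX i')).
split.
- by apply: measurable_sum => i; exact: mX.
- exact: iS.
- rewrite /linear_noise [LHS]ES (eq_bigr (fun=> p%:R)); last by move=> i _; rewrite XE.
  by rewrite sumr_const card_ord mulr_natl.
Qed.

(** For a column of strength [tau], what is left of [|x_j| ^ 2 - n] once the shift [n * tau ^ 2] is
    removed. *)
Definition column_noise (tau : R) (j : 'I_p) (w : Omega) : R :=
  \sum_i (2 * tau * (label i w * V (z i j) w) + (V (z i j) w ^+ 2 - 1)).

(** [K] will be every index except that of [mu j], so that the noise is independent of whether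
    column [j] carries a signal. The bound is [(a + b) ^ 2 <= 2 a ^ 2 + 2 b ^ 2] in each summand. *)
Lemma column_noise_moment (tau : R) j (K : {set I}) :
  (forall i, l i \in K) -> (forall i, z i j \in K) ->
  [/\ depends_on V K (column_noise tau j),
  L1 P (fun w => column_noise tau j w ^+ 2) &
  mean P (fun w => column_noise tau j w ^+ 2) <= n%:R * (8 * tau ^+ 2 + 2 * C4)].
Proof.
move=> lK zK.
pose X i w := 2 * tau * (label i w * V (z i j) w) + (V (z i j) w ^+ 2 - 1).
have dX i : depends_on V [set l i; z i j]%SET (X i).
  apply: depends_onD.
    apply: depends_onM; first exact: depends_on_cst.
    apply: depends_onM; last by apply: depends_on_var; rewrite !inE eqxx orbT.
    by apply: sub_depends_on (@depends_on_label i) => k; rewrite !inE => ->.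
  apply: depends_onD; last exact: depends_on_cst.
  by apply: depends_onX; apply: depends_on_var; rewrite !inE eqxx orbT.
have mX i := depends_on_measurable (dX i).
have mV i : measurable_fun setT (V (z i j) : Omega -> R) by exact: measurable_funP.
have mom i := normal_moments (nz i j).
have i4 i : L1 P (fun w => V (z i j) w ^+ 4) by case: (mom i).
have i2 i : L1 P (fun w => V (z i j) w ^+ 2) by apply: L1_pow.
have i1 i : L1 P (V (z i j)) := @L1_pow _ _ _ P _ 1 isT (mV i) (i4 i).
have e1 i : mean P (V (z i j)) = 0 by case: (mom i).
have e2 i : mean P (fun w => V (z i j) w ^+ 2) = 1 by case: (mom i).
have e4 i : mean P (fun w => V (z i j) w ^+ 4) = C4 by case: (mom i).
have lab i : L1 P (fun w => label i w * V (z i j) w) /\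
    mean P (fun w => label i w * V (z i j) w) = 0.
  apply: (@mean_label_mul i [set z i j]%SET) => //.
    by rewrite inE; apply/eqP => /lz.
  by apply: depends_on_var; rewrite inE.
have X0 i : mean P (X i) = 0.
  have [il el] := lab i.
  rewrite /X (meanD (L1Z _ il) (L1D (i2 i) (L1_cst P (-1)))) (meanZ _ il).
  by rewrite (meanD (i2 i) (L1_cst P (-1))) el e2 mean_cst mulr0 add0r subrr.
pose Y i w := (8 * tau ^+ 2) * V (z i j) w ^+ 2 + (2 * V (z i j) w ^+ 4 + (- 4 * V (z i j) w ^+ 2 + 2)).
have iY i : L1 P (Y i).
  by do ![apply: L1D|apply: L1Z|apply: L1_cst|done].
have XY i w : X i w ^+ 2 <= Y i w.
  have := label_sign_sqr (V (l i) w); rewrite -/(label i w) /X /Y => l2.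
  set a := 2 * tau * _; set b := _ - 1.
  have : a ^+ 2 = 4 * tau ^+ 2 * V (z i j) w ^+ 2.
    rewrite /a; transitivity (4 * tau ^+ 2 * (label i w ^+ 2 * V (z i j) w ^+ 2)); first by ring.
    by rewrite l2 mul1r.
  have : b ^+ 2 = V (z i j) w ^+ 4 - 2 * V (z i j) w ^+ 2 + 1 by rewrite /b; ring.
  have := sqr_ge0 (a - b); nra.
have iX2 i : L1 P (fun w => X i w ^+ 2).
  apply: (L1_le _ _ (iY i)); first exact: measurable_funX.
  by move=> w; rewrite ger0_norm ?sqr_ge0.
have eX2 i : mean P (fun w => X i w ^+ 2) <= 8 * tau ^+ 2 + 2 * C4.
  apply: le_trans (le_mean (iX2 i) (iY i) (XY i)) _.
  have j2 := L1Z (8 * tau ^+ 2) (i2 i); have j4 := L1Z 2 (i4 i); have j3 := L1Z (- 4) (i2 i).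
  rewrite /Y (meanD j2 (L1D j4 (L1D j3 (L1_cst P _)))) (meanD j4 (L1D j3 (L1_cst P _))).
  rewrite (meanD j3 (L1_cst P _)) mean_cst !meanZ// e2 e4; lra.
have [iS ES] := mean_sqr_sum mX iX2 X0 (fun i i' ii' =>
  independent_pair_blocks indepV (J1 := [set l i; z i j]%SET)
   (J2 := [set l i'; z i' j]%SET)
   (fun k => ltac:(rewrite !inE => /orP[/eqP ->|/eqP ->]; [
      rewrite (inj_eq linj) (negbTE ii') /=; apply/eqP => /lz//
     |rewrite negb_or; apply/andP; split; apply/eqP;
        [move=> /esym /lz//|move=> /zinj[/eqP]; rewrite (negbTE ii')//]]))
   (dX i) (dX i')).
split.
- apply: depends_on_sum => i; apply: sub_depends_on (dX i) => k.
  by rewrite !inE => /orP[] /eqP ->.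
- exact: iS.
- rewrite /column_noise [leLHS]ES (le_trans (ler_sum _ (fun i _ => eX2 i)))//.
  by rewrite sumr_const card_ord -[leLHS]mulr_natl.
Qed.

End Rows.

(** * P-values and Higher Criticism *)

Section PValues.
Variables (R : realType) (n p : nat).
Implicit Types X : 'M[R]_(n, p).
Notation RM := (measurableTypeR R).

Definition chi2_survival (y : R) : R := fine (chi2_prob n [set x : RM | (y <= x)%R]).

Lemma chi2_survival_nonincreasing : {homo chi2_survival : x y /~ x <= y}.
Proof.
move=> x y xy; apply: fine_le; rewrite ?fin_num_measure//; try exact: measurable_ge.
apply: le_measure; rewrite ?inE; try exact: measurable_ge.
by move=> t /=; exact: le_trans.
Qed.

Lemma standardize_le (x y : R) : (0 < n)%N -> (standardize n x <= standardize n y) = (x <= y).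
Proof.
move=> n0; rewrite /standardize ler_pM2l ?lerD2r//.
by rewrite invr_gt0 sqrtr_gt0 mulr_gt0 ?ltr0n.
Qed.

Lemma pvalueE X j : (0 < n)%N -> pvalue X j = chi2_survival (sqnorm (col j X)).
Proof.
move=> n0; rewrite /pvalue /chi2_survival /Qstat; congr (fine (chi2_prob n _)).
by apply/seteqP; split => x /=; rewrite standardize_le.
Qed.

(** Order statistics enter only through this translation into counts: in measurability, in the
    boundary crossing, and for the smallest p-value. *)
Lemma sorted_pvalue_le X (i : nat) (u : R) : (0 < i <= p)%N ->
  (sorted_pvalue X i <= u) = (i <= #|[set j | (pvalue X j <= u)%R]%SET|)%N.
Proof.
case/andP=> i0 ip; set s := sort <=%R [seq pvalue X j | j <- enum 'I_p].
have ss : sorted <=%R s by apply: sort_le_sorted.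
have sz : size s = p by rewrite size_sort size_map size_enum_ord.
have -> : #|[set j | (pvalue X j <= u)%R]%SET| = count (<= u) s.
  rewrite /s count_sort count_map cardE size_filter.
  rewrite -[RHS]size_filter /enum_mem -!filter_predI size_filter -enumT.
  by apply: eq_count => j; rewrite /= inE andbT.
rewrite /sorted_pvalue -/s; apply/idP/idP => [|ic]; last first.
  by apply: nth_count_le => //; rewrite prednK.
rewrite leqNgt; apply: contraL; rewrite -ltNge => ci.
apply: nth_count_gt => //; by rewrite sz -ltnS prednK// ci.
Qed.

End PValues.

Section TestsMeasurable.
Context {R : realType} {d : measure_display} {Omega : measurableType d}.
Variables (n p : nat) (X : Omega -> 'M[R]_(n, p)).
Hypotheses (mX : forall i j, measurable_fun setT (fun w => X w i j)).

Lemma measurable_standardize m (f : Omega -> R) : measurable_fun setT f ->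
  measurable_fun setT (fun w => standardize m (f w)).
Proof.
move=> mf; apply: measurable_funM => //; exact: measurable_funB.
Qed.

Lemma measurable_sa : measurable [set w | sa_test (X w)].
Proof.
rewrite -[X in measurable X]setTI; apply: measurable_fun_le => //.
apply: measurable_standardize; apply: measurable_funM => //.
apply: measurable_sum => i; apply: measurable_funX.
have -> : (fun w => xbar (X w) i 0) = fun w => p%:R^-1 * \sum_j X w i j.
  apply/funext => w; rewrite mxE summxE; congr (_ * _).
  by apply: eq_bigr => j _; rewrite mxE.
by apply: measurable_funM => //; exact: measurable_sum.
Qed.

Lemma measurable_sqnorm_col j : measurable_fun setT (fun w => sqnorm (col j (X w))).
Proof.
apply: measurable_sum => i; apply: measurable_funX.
by under eq_fun do rewrite mxE; exact: mX.
Qed.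

Hypothesis n0 : (0 < n)%N.

Lemma measurable_pvalue j : measurable_fun setT (fun w => pvalue (X w) j).
Proof.
under eq_fun do rewrite pvalueE//.
apply: (measurableT_comp (nonincreasing_measurable _ _)); last exact: measurable_sqnorm_col.
  exact: measurableT.
by move=> x y xy; exact: chi2_survival_nonincreasing.
Qed.

Lemma measurable_sorted_pvalue (i : nat) : (0 < i <= p)%N ->
  measurable_fun setT (fun w => sorted_pvalue (X w) i).
Proof.
move=> ip; apply: (measurability (@RGenOInfty.G R)) => [|/= _ [_] [u] -> <-].
  exact: RGenOInfty.measurableE.
have -> : `]u, +oo[%classic = ~` `]-oo, u]%classic by rewrite setCitvl.
rewrite preimage_setC setTI; apply: measurableC.
pose g w := [set j | (pvalue (X w) j <= u)%R]%SET.
rewrite [X in measurable X](_ : _ = [set w | (fun S : {set 'I_p} => (i <= #|S|)%N) (g w)]); last first.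
  by apply/seteqP; split => w; rewrite /= in_itv /= sorted_pvalue_le.
apply: (measurable_finite_valued (g := g) _ (fun S : {set 'I_p} => (i <= #|S|)%N)) => S.
have -> : [set w | g w = S] =
    \bigcap_(j in [set: 'I_p]) [set w | (pvalue (X w) j <= u) = (j \in S)].
  apply/seteqP; split => [w /= <- j _|w H]; first by rewrite /g /= inE.
  by apply/setP => j; rewrite /g inE; exact: H.
apply: fin_bigcap_measurable => // j _.
have mj : measurable [set w | pvalue (X w) j <= u].
  rewrite -[X in measurable X]setTI; apply: measurable_fun_le => //.
  exact: measurable_pvalue.
case: (j \in S); first by [].
rewrite (_ : [set _ | _] = ~` [set w | pvalue (X w) j <= u]); first exact: measurableC.
by apply/seteqP; split => w /=; [move=> ->|move=> /negP/negbTE].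
Qed.

End TestsMeasurable.

Section HigherCriticism.
Variables (R : realType) (n p : nat).
Implicit Types X : 'M[R]_(n, p).

Definition hc_threshold : R := 2 * Num.sqrt (2 * ln (ln p%:R)).

Lemma hc_testP X : reflect (exists2 i, (0 < i <= p./2)%N & hc_threshold <= HC X i) (hc_test X).
Proof.
rewrite /hc_test /HC_max -/hc_threshold; set t := hc_threshold.
have H (s : seq nat) : (t%:E <= \big[maxe/-oo%E]_(i <- s) (HC X i)%:E)%E =
    has (fun i => t <= HC X i) s.
  by elim: s => [|i s IH]; rewrite ?big_nil ?big_cons //= le_max IH lee_fin.
rewrite H; apply: (iffP hasP) => -[i ip ti]; exists i => //.
  by move: ip; rewrite mem_index_iota ltnS.
by rewrite mem_index_iota ltnS.
Qed.

(* Division by zero makes [HC] vanish when the p-value is [0] or [1]. *)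
Lemma HC_ge X i (t : R) : 0 < t -> (t <= HC X i) =
  [&& 0 < sorted_pvalue X i * (1 - sorted_pvalue X i) &
   t * Num.sqrt (sorted_pvalue X i * (1 - sorted_pvalue X i)) <=
     Num.sqrt p%:R * (i%:R / p%:R - sorted_pvalue X i)].
Proof.
move=> t0; rewrite /HC; set y := sorted_pvalue X i * _.
have [y0|y0] := ltP 0 y; first by rewrite ler_pdivlMr// sqrtr_gt0.
by rewrite (ler0_sqrtr y0) invr0 mulr0 leNgt t0.
Qed.

End HigherCriticism.

Section HCMeasurable.
Context {R : realType} {d : measure_display} {Omega : measurableType d}.
Variables (n p : nat) (X : Omega -> 'M[R]_(n, p)).
Hypotheses (mX : forall i j, measurable_fun setT (fun w => X w i j)) (n0 : (0 < n)%N).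
Hypothesis t0 : 0 < @hc_threshold R p.

Lemma measurable_hc : measurable [set w | hc_test (X w)].
Proof.
have -> : [set w | hc_test (X w)] =
    \bigcup_(i in [set i | (0 < i <= p./2)%N]) [set w | hc_threshold R p <= HC (X w) i].
  by apply/seteqP; split => w => [/hc_testP[i ip ti]|[i ip ti]]; [exists i|apply/hc_testP; exists i].
apply: bigcup_measurable => i /andP[i0 ip].
have ip2 : (0 < i <= p)%N.
  by rewrite i0 (leq_trans ip)// -{2}(odd_double_half p) -addnn addnCA leq_addr.
have my := measurable_sorted_pvalue mX n0 ip2.
have mq : measurable_fun setT (fun w => sorted_pvalue (X w) i * (1 - sorted_pvalue (X w) i)).
  by apply: measurable_funM => //; exact: measurable_funB.
have -> : [set w | hc_threshold R p <= HC (X w) i] =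
  ~` (setT `&` [set w | sorted_pvalue (X w) i * (1 - sorted_pvalue (X w) i) <= cst 0 w]) `&`
  (setT `&` [set w | hc_threshold R p * Num.sqrt (sorted_pvalue (X w) i * (1 - sorted_pvalue (X w) i)) <=
     Num.sqrt p%:R * (i%:R / p%:R - sorted_pvalue (X w) i)]).
  rewrite !setTI; apply/seteqP; split => w /=; rewrite HC_ge//.
    by move=> /andP[q0 ->]; rewrite leNgt q0.
  by move=> [/negP]; rewrite -ltNge => -> ->.
apply: measurableI; first by apply: measurableC; exact: measurable_fun_le.
apply: measurable_fun_le => //.
  apply: measurable_funM => //; apply: (measurableT_comp (nondecreasing_measurable _ _)) => //.
  by move=> x y xy; exact: ler_wsqrtr.
by apply: measurable_funM => //; exact: measurable_funB.
Qed.

End HCMeasurable.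

Section HCCrossing.
Variables (R : realType) (n p : nat).

(** As [i <= p / 2], a positive numerator forces [pi_(i) < 1 / 2], so [2 * (1 - pi) >= 1] and the
    factor [sqrt 2] is absorbed. What remains is [y + s * sqrt y <= i] at [y = p * pi_(i)]. The
    ordinal [k] stands for rank [k + 1]. *)
Lemma hc_crossing (X : 'M[R]_(n, p)) (s : R) : 0 < s -> hc_threshold R p = Num.sqrt 2 * s ->
  hc_test X -> exists k : 'I_(p./2),
    (k.+1 <= #|[set j | (pvalue X j <= boundary s k.+1 / p%:R)%R]%SET|)%N.
Proof.
move=> s0 tE /hc_testP[i /andP[i0 ip]].
have t0 : 0 < hc_threshold R p by rewrite tE mulr_gt0// sqrtr_gt0.
rewrite HC_ge//; set y := sorted_pvalue X i => /andP[q0].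
have ip2 : (i <= p)%N.
  by rewrite (leq_trans ip)// -{2}(odd_double_half p) -addnn addnCA leq_addr.
have pR : (0 : R) < p%:R by rewrite ltr0n (leq_trans i0).
have ip' : i%:R / p%:R <= 2^-1 :> R.
  rewrite ler_pdivrMr// mulrC ler_pdivlMr// -natrM ler_nat.
  by rewrite muln2 -[leqRHS]odd_double_half (leq_trans _ (leq_addl _ _))// leq_double.
rewrite tE => H.
have r2 : 0 < Num.sqrt 2 :> R by rewrite sqrtr_gt0.
have rp : 0 < Num.sqrt p%:R :> R by rewrite sqrtr_gt0.
have rq : 0 < Num.sqrt (y * (1 - y)) by rewrite sqrtr_gt0.
have yi : y < i%:R / p%:R.
  rewrite -subr_gt0 -(pmulr_rgt0 _ rp); apply: lt_le_trans H.
  by rewrite !mulr_gt0.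
have y0 : 0 < y by have := q0; nra.
have y2 : 2^-1 <= 1 - y by lra.
have i0' : (i.-1 < p./2)%N by rewrite prednK.
exists (Ordinal i0'); rewrite /= prednK//.
rewrite -sorted_pvalue_le ?i0// -/y ler_pdivlMr// mulrC.
apply: le_boundary; [exact: ltW|by rewrite mulr_ge0 ?ltW|].
have E : Num.sqrt (p%:R * y) = Num.sqrt p%:R * Num.sqrt y by rewrite sqrtrM// ltW.
have h1 : s * Num.sqrt y <= Num.sqrt 2 * s * Num.sqrt (y * (1 - y)).
  rewrite mulrAC mulrC ler_wpM2r ?(ltW s0)// -sqrtrM//.
  by rewrite ler_sqrt ?mulr_ge0 ?ltW//; nra.
have h2 : s * Num.sqrt y <= Num.sqrt p%:R * (i%:R / p%:R - y) by exact: le_trans h1 H.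
rewrite E mulrCA -lerBrDl.
have -> : i%:R - p%:R * y = Num.sqrt p%:R * (Num.sqrt p%:R * (i%:R / p%:R - y)).
  rewrite mulrA -expr2 sqr_sqrtr ?(ltW pR)//; field.
  by rewrite gt_eqF.
by rewrite ler_pM2l.
Qed.

End HCCrossing.

Section Cells.
Context {R : realType} {d : measure_display} {Omega : measurableType d}.
Variables (m : nat) (x : 'I_m -> R).
Hypothesis xmono : forall k k' : 'I_m, (k <= k')%N -> x k <= x k'.

(** The strict inequality puts a p-value equal to a level in the cell of that level, in agreement
    with the non-strict counts; the value [m] means above all levels. *)
Definition cell (y : R) : 'I_m.+1 := inord #|[set k | (x k < y)%R]%SET|.

Lemma cell_le (y : R) (k : 'I_m) : (cell y <= k)%N = (y <= x k).
Proof.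
rewrite /cell inordK; last by rewrite ltnS -[leqRHS]card_ord max_card.
have card_lt (j : nat) : (j <= m)%N -> #|[set k' : 'I_m | (k' < j)%N]%SET| = j.
  by move=> jm; rewrite -sum1dep_card (big_ord_narrow jm) sum1_card card_ord.
apply/idP/idP => [|yx]; last first.
  rewrite -[leqRHS](card_lt k (ltnW (ltn_ord k))); apply: subset_leq_card.
  apply/fintype.subsetP => k'; rewrite !inE => xk'; rewrite ltnNge; apply/negP => /xmono kk'.
  by move: xk'; rewrite ltNge (le_trans yx).
apply: contraTT; rewrite -ltNge -ltnNge => xy.
rewrite -[leqLHS](card_lt k.+1 (ltn_ord k)); apply: subset_leq_card.
by apply/fintype.subsetP => k'; rewrite !inE ltnS => /xmono kk'; exact: le_lt_trans xy.
Qed.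

Lemma measurable_cell (f : Omega -> R) e : measurable_fun setT f ->
  measurable [set w | cell (f w) = e].
Proof.
move=> mf.
have -> : [set w | cell (f w) = e] =
    \bigcap_(k in [set: 'I_m]) [set w | (f w <= x k) = (e <= k)%N].
  apply/seteqP; split => [w /= <- k _|w H]; first by rewrite /= cell_le.
  have H' (k : 'I_m) : (cell (f w) <= k)%N = (e <= k)%N by rewrite cell_le; exact: H.
  apply/val_inj/eqP; rewrite eqn_leq; apply/andP; split; rewrite leqNgt; apply/negP => lt.
    have em : (e < m)%N by rewrite (leq_trans lt) // -ltnS; exact: ltn_ord.
    by have := H' (Ordinal em); rewrite /= leqnn => ce; move: lt; rewrite ltnNge ce.
  have cm : (cell (f w) < m)%N by rewrite (leq_trans lt) // -ltnS; exact: ltn_ord.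
  by have := H' (Ordinal cm); rewrite /= leqnn => /esym ce; move: lt; rewrite ltnNge ce.
apply: fin_bigcap_measurable => // k _.
have mk : measurable [set w | f w <= x k].
  by rewrite -[X in measurable X]setTI; apply: (@measurable_fun_le _ _ R setT f (cst (x k))).
case: (e <= k)%N; first by [].
rewrite (_ : [set _ | _] = ~` [set w | f w <= x k]); first exact: measurableC.
by apply/seteqP; split => w /=; [move=> ->|move=> /negP/negbTE].
Qed.

End Cells.

(** * Higher Criticism under the null hypothesis *)

Section HCNull.
Context {R : realType} {d : measure_display} {Omega : measurableType d}.
Variables (P : probability Omega R) (n p : nat).

(** Columns use disjoint blocks of entries, so the law of the vector of cells is a product and the
    crossing probability is the finite sum bounded by [crossing_bound]; superuniformity supplies its
    hypothesis on the levels. *)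
Lemma hc_null_bound (X : Omega -> 'M[R]_(n, p)) (s : R) (N : nat) :
    null_model P X -> (0 < n)%N -> (0 < p)%N -> 1 <= s ->
    hc_threshold R p = Num.sqrt 2 * s -> p%:R <= 16 * s ^+ 2 * 4 ^+ N ->
  (P [set w | hc_test (X w)] <= (expR 1 / Num.sqrt s +
     expR (2^-1 - Num.sqrt s / 8) + N%:R * expR (- (s ^+ 2 / 3)))%:E)%E.
Proof.
move=> [Z [indZ nZ] XE] n0 p0 s1 tE pN.
have s0 : 0 < s by apply: lt_le_trans s1.
have t0 : 0 < hc_threshold R p by rewrite tE mulr_gt0// sqrtr_gt0.
have mX i j : measurable_fun setT (fun w => X w i j).
  have -> : (fun w => X w i j) = Z i j by apply/funext => w; rewrite XE mxE.
  exact: measurable_funP.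
pose V (ij : 'I_n * 'I_p) : {RV P >-> R} := Z ij.1 ij.2.
pose m := p./2.
pose x (k : 'I_m) : R := boundary s k.+1 / p%:R.
have pR : (0 : R) < p%:R by rewrite ltr0n.
have x_mono (k k' : 'I_m) : (k <= k')%N -> x k <= x k'.
  by move=> kk'; rewrite ler_wpM2r ?invr_ge0 ?(ltW pR)// boundary_mono// ltW.
pose c j w := cell x (pvalue (X w) j).
have mc j e : measurable [set w | c j w = e].
  by apply: measurable_cell => //; exact: measurable_pvalue.
pose b w : {ffun 'I_p -> 'I_m.+1} := [ffun j => c j w].
pose q j e := fine (P [set w | c j w = e]).
have bE e : [set w | b w = e] = \bigcap_j [set w | c j w = e j].
  apply/seteqP; split => [w /= <- j _|w H]; first by rewrite /= ffunE.
  by apply/ffunP => j; rewrite ffunE; exact: H.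
have mb e : measurable [set w | b w = e].
  by rewrite bE; apply: fin_bigcap_measurable.
pose D (b : {ffun 'I_p -> 'I_m.+1}) := [exists k : 'I_m, (k.+1 <= count_below b k)%N].
apply: (@le_trans _ _ (P [set w | D (b w)])).
  apply: le_measure; rewrite ?inE.
  - exact: measurable_hc.
  - exact: measurable_finite_valued.
  - move=> w /= /(hc_crossing s0 tE)[k kc]; apply/existsP; exists k.
    rewrite (leq_trans kc)//; apply/eq_leq/eq_card => j.
    by rewrite !inE ffunE cell_le.
rewrite finite_valued_law// lee_fin.
pose col (j : 'I_p) := [seq (i, j) | i <- enum 'I_n].
have ucol j : uniq (col j) by rewrite map_inj_uniq ?enum_uniq// => i i' [].
have colE j w : pvalue (X w) j = chi2_survival n (vsumsq V (col j) w).
  rewrite pvalueE//; congr (chi2_survival n _).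
  rewrite /sqnorm /vsumsq big_map big_enum /=; apply: eq_bigr => i _.
  by rewrite XE !mxE.
pose J (j : 'I_p) : {set 'I_n * 'I_p} := [set ij | ij.2 == j]%SET.
have dep j : depends_on V (J j) (vsumsq V (col j)).
  by apply: depends_on_vsumsq => ij /mapP[i _ ->]; rewrite inE.
have msurv : measurable_fun setT (chi2_survival n : R -> R).
  apply: nonincreasing_measurable => //.
  by move=> y y' yy'; exact: chi2_survival_nonincreasing.
have weightE e : fine (P [set w | b w = e]) = weight q e.
  rewrite bE (independent_blocks_prod indZ (J := J)).
  - rewrite -[RHS]/(fine (weight q e)%:E) /weight -prodEFin; congr fine.
    by apply: eq_bigr => j _; rewrite /q fineK// fin_num_measure.
  - by move=> j j' ij; rewrite !inE => /eqP <- /eqP.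
  - move=> j; have mB : measurable [set y : R | cell x (chi2_survival n y) = e j].
      exact: measurable_cell.
    have := dep j measurableT _ mB; rewrite setTI.
    suff -> : vsumsq V (col j) @^-1` [set y | cell x (chi2_survival n y) = e j] =
      [set w | c j w = e j] by [].
    by apply/seteqP; split => w; rewrite /c /preimage /= colE.
rewrite (eq_bigr (weight q)); last by move=> e _; exact: weightE.
apply: crossing_bound => //.
- rewrite /m -{2}(odd_double_half p) -addnn addnCA; exact: leq_addr.
- move=> j e; exact: fine_ge0.
- move=> j; rewrite /q.
  have := finite_valued_law P (mc j) xpredT.
  rewrite [X in P X](_ : _ = setT); last by apply/seteqP; split.
  by rewrite probability_setT => -[].
- move=> j k; rewrite -lee_fin -(finite_valued_law P (mc j) (fun e => (e <= k)%N)).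
  have -> : [set w | (c j w <= k)%N] =
      vsumsq V (col j) @^-1` [set y | chi2_survival n y <= x k].
    by apply/seteqP; split => w; rewrite /c /preimage /= cell_le// colE.
  rewrite (vsumsq_law indZ (ucol j)).
  - rewrite size_map size_enum_ord; apply: survival_superuniform.
    by rewrite divr_ge0// sqr_ge0.
  - by move=> ij /mapP[i _ ->]; exact: nZ.
  - by rewrite -[X in measurable X]setTI; apply: (@measurable_fun_le _ _ R setT (chi2_survival n : R -> R) (cst (x k))).
Qed.

End HCNull.

(** * Error probabilities of the two tests *)

Lemma standardize_xbar (R : realType) (n p : nat) (X : 'M[R]_(n, p)) : (0 < p)%N ->
  standardize n (p%:R * sqnorm (xbar X)) =
  (Num.sqrt (2 * n%:R))^-1 * ((\sum_i (\sum_j X i j) ^+ 2) / p%:R - n%:R).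
Proof.
move=> p0; congr (_ * (_ - _)).
have pe : p%:R != 0 :> R by rewrite pnatr_eq0 -lt0n.
rewrite /sqnorm (eq_bigr (fun i => p%:R ^- 2 * (\sum_j X i j) ^+ 2)); last first.
  move=> i _; rewrite mxE summxE exprMn exprVn; congr (_ * _ ^+ 2).
  by apply: eq_bigr => j _; rewrite mxE.
by rewrite -mulr_sumr mulrA mulrC; congr (_ * _); field.
Qed.

Section SANull.
Context {R : realType} {d : measure_display} {Omega : measurableType d}.
Variables (P : probability Omega R) (n p : nat).
Local Notation C4 := (@normal_kurtosis R).

Lemma sa_null_bound (X : Omega -> 'M[R]_(n, p)) :
    null_model P X -> (0 < n)%N -> (1 < p)%N ->
  (P [set w | sa_test (X w)] <= ((C4 + 3) / (16 * ln p%:R))%:E)%E.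
Proof.
move=> [Z [indZ nZ] XE] n0 p1.
have mX i j : measurable_fun setT (fun w => X w i j).
  have -> : (fun w => X w i j) = Z i j by apply/funext => w; rewrite XE mxE.
  exact: measurable_funP.
pose V (ij : 'I_n * 'I_p) : {RV P >-> R} := Z ij.1 ij.2.
pose z (i : 'I_n) (j : 'I_p) := (i, j).
have zinj i j i' j' : z i j = z i' j' -> i = i' /\ j = j' by case.
have nz i j : standard_normal (V (z i j)) by exact: nZ.
have [mq iq eq] := quadratic_noise_moment indZ zinj nz.
have p0 : (0 < p)%N by exact: ltnW.
have pR : (0 : R) < p%:R by rewrite ltr0n.
have nR : (0 : R) < n%:R by rewrite ltr0n.
have lp : 0 < ln p%:R :> R by rewrite ln_gt0// ltr1n.
pose x : R := 2 * Num.sqrt (2 * ln p%:R) * Num.sqrt (2 * n%:R) * p%:R.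
have x0 : 0 < x by rewrite !mulr_gt0// sqrtr_gt0 mulr_gt0.
have x2 : x ^+ 2 = 16 * n%:R * p%:R ^+ 2 * ln p%:R.
  by rewrite /x !exprMn !sqr_sqrtr ?mulr_ge0 ?ltW//; ring.
apply: (@le_trans _ _ (P [set w | x <= `|quadratic_noise V z w|])).
  apply: le_measure; rewrite ?inE.
  - exact: measurable_sa.
  - rewrite -[X in measurable X]setTI; apply: (@measurable_fun_le _ _ R setT (cst x)) => //.
    exact: measurableT_comp.
  - move=> w /=; rewrite /sa_test standardize_xbar// [leRHS]mulrC ler_pdivlMr; last first.
      by rewrite sqrtr_gt0 mulr_gt0.
    have -> : (\sum_i (\sum_j X w i j) ^+ 2) / p%:R - n%:R = quadratic_noise V z w / p%:R.
      rewrite /quadratic_noise sumrB sumr_const card_ord.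
      rewrite (eq_bigr (fun i => vsum V (row_indices z i) w ^+ 2)); last first.
        by move=> i _; rewrite vsum_row; congr (_ ^+ 2); apply: eq_bigr => j _; rewrite XE mxE.
      by rewrite -mulr_natr; field; rewrite gt_eqF.
    by rewrite ler_pdivlMr// => H; apply: le_trans (ler_norm _).
apply: le_trans (chebyshev_ineq x0 mq iq eq) _.
rewrite lee_fin x2 le_eqVlt; apply/orP; left; apply/eqP; field.
by rewrite !gt_eqF.
Qed.

End SANull.

(** * Both tests under the alternative *)

Section Alternative.
Context {R : realType} {d : measure_display} {Omega : measurableType d}.
Variables (P : probability Omega R) (n p : nat).
Variables (l : 'I_n -> {RV P >-> R}) (mu : 'I_p -> {RV P >-> R})
  (Z : 'I_n -> 'I_p -> {RV P >-> R}) (tau eps : R).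
Let V := arw_variables l mu Z.
Hypotheses (indV : mutually_independent V)
  (lP : forall i, P [set w | l i w = 1] = (2^-1)%:E /\ P [set w | l i w = -1] = (2^-1)%:E)
  (muP : forall j, P [set w | mu j w = tau] = eps%:E /\ P [set w | mu j w = 0] = (1 - eps)%:E)
  (nZ : forall i j, standard_normal (Z i j))
  (tau0 : 0 < tau) (eps0 : 0 < eps) (n0 : (0 < n)%N) (p0 : (0 < p)%N).
Local Notation C4 := (@normal_kurtosis R).

Definition arw_entry (i : 'I_n) (j : 'I_p) : 'I_n + 'I_p + 'I_n * 'I_p := inr (i, j).
Definition arw_label (i : 'I_n) : 'I_n + 'I_p + 'I_n * 'I_p := inl (inl i).
Let z := arw_entry.
Let lab := arw_label.
Let sg i w := label V lab i w.

Let zinj i j i' j' : z i j = z i' j' -> i = i' /\ j = j'.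
Proof. by case. Qed.
Let nz i j : standard_normal (V (z i j)).
Proof. exact: nZ. Qed.
Let labinj : injective lab.
Proof. by move=> i i' []. Qed.
Let labz i i' j : lab i <> z i' j.
Proof. by []. Qed.

Definition signal (j : 'I_p) (w : Omega) : R := if mu j w == tau then 1 else 0.

Let signal_sqr j w : signal j w ^+ 2 = signal j w.
Proof. by rewrite /signal; case: ifP; rewrite ?expr1n ?expr0n. Qed.

Let signal_indic j : signal j = \1_[set w | mu j w = tau].
Proof.
apply/funext => w; rewrite indicE /signal; case: eqP => [E|H].
  by rewrite mem_set.
by rewrite memNset.
Qed.

Let measurable_level (X : {RV P >-> R}) c : measurable [set w | X w = c].
Proof. exact: (measurable_funPTI X (measurable_set1 c)). Qed.

Let L1_signal j : L1 P (signal j).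
Proof. by rewrite signal_indic; apply: integrable_indic => //; exact: measurable_level. Qed.

Let mean_signal j : mean P (signal j) = eps.
Proof.
apply: EFin_inj; rewrite -meanE// signal_indic.
rewrite (integral_indic P measurableT (measurable_level (mu j) tau)) setIT.
exact: (muP j).1.
Qed.

Let depends_on_signal j : depends_on V [set inl (inr j)]%SET (signal j).
Proof.
rewrite /signal; apply: (@depends_on_comp _ _ _ _ _ _ _ (fun x => if x == tau then 1 else 0) (mu j)).
  by apply: measurable_fun_ifT => //; exact: measurable_fun_eqr.
by apply: (@depends_on_var _ _ _ _ _ V _ (inl (inr j))); rewrite inE.
Qed.

Lemma signal_count_bound :
  (P [set w | p%:R * eps / 2 <= `|\sum_j signal j w - p%:R * eps|]%R <=
    (4 / (p%:R * eps))%:E)%E.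
Proof.
have pR : (0 : R) < p%:R by rewrite ltr0n.
pose X j w := signal j w - eps.
have dX j : depends_on V [set inl (inr j)]%SET (X j).
  by apply: depends_onD => //; exact: depends_on_cst.
have mX j := depends_on_measurable (dX j).
have XE j : (fun w => X j w ^+ 2) = fun w => (1 - 2 * eps) * signal j w + eps ^+ 2.
  by apply/funext => w; rewrite /X sqrrB signal_sqr; ring.
have iX2 j : L1 P (fun w => X j w ^+ 2).
  by rewrite XE; apply: L1D; [exact: L1Z|exact: L1_cst].
have X0 j : mean P (X j) = 0.
  by rewrite /X (meanD (L1_signal j) (L1_cst P _)) mean_signal mean_cst subrr.
have eX2 j : mean P (fun w => X j w ^+ 2) <= eps.
  rewrite XE (meanD (L1Z _ (L1_signal j)) (L1_cst P _)) meanZ// mean_signal mean_cst.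
  by have := sqr_ge0 eps; lra.
have [iS ES] := mean_sqr_sum mX iX2 X0 (fun j j' jj' =>
  independent_pair_blocks indV (J1 := [set inl (inr j)]%SET) (J2 := [set inl (inr j')]%SET)
   (fun k => ltac:(rewrite !inE => /eqP ->; exact: jj')) (dX j) (dX j')).
have x0 : 0 < p%:R * eps / 2 by rewrite divr_gt0 ?mulr_gt0.
have -> : [set w | p%:R * eps / 2 <= `|\sum_j signal j w - p%:R * eps|] =
    [set w | p%:R * eps / 2 <= `|\sum_j X j w|].
  by apply/funext => w; rewrite /= /X sumrB sumr_const card_ord !mulr_natl.
have mS : measurable_fun setT (fun w => \sum_j X j w) by exact: measurable_sum.
have bS : mean P (fun w => (\sum_j X j w) ^+ 2) <= p%:R * eps.
  rewrite ES (le_trans (ler_sum _ (fun j _ => eX2 j)))//.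
  by rewrite sumr_const card_ord mulr_natl.
apply: le_trans (chebyshev_ineq x0 mS iS bS) _.
rewrite lee_fin le_eqVlt; apply/orP; left; apply/eqP; field.
by rewrite !gt_eqF.
Qed.

(** Labels and [mu] are two-valued only almost surely. On this event of probability one they
    coincide with variables that are two-valued everywhere. *)
Definition regular (w : Omega) : Prop :=
  (forall i, l i w = sg i w) /\ (forall j, mu j w = tau * signal j w).

Let measurable_regular : measurable [set w | regular w].
Proof.
rewrite (_ : [set w | regular w] =
  (\bigcap_(i in [set: 'I_n]) [set w | (l i \- sg i) w = 0]) `&`
  (\bigcap_(j in [set: 'I_p]) [set w | (mu j \- (fun w => tau * signal j w)) w = 0])); last first.
  apply/seteqP; split => w.
    by move=> [h1 h2]; split => k _ /=; rewrite ?h1 ?h2 subrr.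
  by move=> [h1 h2]; split => k; apply/eqP; rewrite -subr_eq0; apply/eqP; [exact: h1|exact: h2].
apply: measurableI; apply: fin_bigcap_measurable => // k _.
  have mf : measurable_fun setT (l k \- sg k).
    apply: measurable_funB => //.
    exact: (depends_on_measurable (@depends_on_label _ _ _ _ _ V _ lab k)).
  by rewrite -[X in measurable X]setTI; exact: (mf measurableT _ (measurable_set1 0)).
have mf : measurable_fun setT (mu k \- (fun w => tau * signal k w)).
  apply: measurable_funB => //.
  exact: (measurable_funM (measurable_cst tau) (L1_measurable (L1_signal k))).
by rewrite -[X in measurable X]setTI; exact: (mf measurableT _ (measurable_set1 0)).
Qed.

Let off_two_values (X : {RV P >-> R}) (a b : R) :
  [set w | X w != a /\ X w != b] = ~` ([set w | X w = a] `|` [set w | X w = b]).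
Proof.
rewrite setCU; apply/seteqP; split => w /= [h1 h2]; split; exact/eqP.
Qed.

Let measurable_off_two_values (X : {RV P >-> R}) (a b : R) :
  measurable [set w | X w != a /\ X w != b].
Proof.
rewrite off_two_values; apply: measurableC; apply: measurableU; exact: measurable_level.
Qed.

Let almost_sure_two_values (X : {RV P >-> R}) (a b r s : R) : a != b ->
  P [set w | X w = a] = r%:E -> P [set w | X w = b] = s%:E -> r + s = 1 ->
  P [set w | X w != a /\ X w != b] = 0%E.
Proof.
move=> ab Pa Pb rs; rewrite off_two_values.
rewrite probability_setC; last by apply: measurableU; exact: measurable_level.
rewrite measureU; try exact: measurable_level.
  rewrite [X in (1 - X)%E](_ : _ = 1%E) ?subee//.
  transitivity (r%:E + s%:E)%E; last by rewrite -EFinD rs.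
  by congr (_ + _)%E; [exact: Pa|exact: Pb].
by apply/seteqP; split => // w /= [-> /eqP]; rewrite (negbTE ab).
Qed.

Let finite_union_null (T : finType) (E : T -> set Omega) :
  (forall t, measurable (E t)) -> (forall t, P (E t) = 0%E) -> P (\bigcup_t E t) = 0%E.
Proof.
move=> mE E0; apply/eqP; rewrite eq_le measure_ge0 andbT.
have fT : finite_set [set: T] by exact: finite_finset.
have mU : measurable (\bigcup_t E t) by apply: fin_bigcup_measurable.
apply: (le_trans (content_sub_fsum P fT (fun t _ => mE t) mU (@subset_refl _ _))).
by rewrite fsbig1// => t _; exact: E0.
Qed.

Lemma regular_ae : P (~` [set w | regular w]) = 0%E.
Proof.
pose E (k : 'I_n + 'I_p) := match k with
  | inl i => [set w | l i w != 1 /\ l i w != -1]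
  | inr j => [set w | mu j w != tau /\ mu j w != 0]
  end.
have mE k : measurable (E k) by case: k => k; exact: measurable_off_two_values.
have E0 k : P (E k) = 0%E.
  case: k => k /=.
    have [h1 h2] := lP k; apply: almost_sure_two_values h1 h2 _; last by field.
    by apply/eqP; lra.
  have [h1 h2] := muP k; apply: almost_sure_two_values h1 h2 _; last by ring.
  by rewrite gt_eqF.
apply/eqP; rewrite eq_le measure_ge0 andbT -(finite_union_null mE E0).
apply: le_measure; rewrite ?inE.
- exact: measurableC.
- by apply: fin_bigcup_measurable => //.
move=> w /= nreg; apply: contrapT => nE; apply: nreg; split => [i|j].
  rewrite /sg /label /label_sign /=; case: eqP => // l1; apply: contrapT => l2.
  by apply: nE; exists (inl i) => //=; split; exact/eqP.
rewrite /signal; case: eqP => [->|m1]; first by rewrite mulr1.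
rewrite mulr0; apply: contrapT => m2.
by apply: nE; exists (inr j) => //=; split; exact/eqP.
Qed.

Variable X : Omega -> 'M[R]_(n, p).
Hypothesis XE : forall w, X w = \matrix_(i, j) (l i w * mu j w + Z i j w).

Let mX i j : measurable_fun setT (fun w => X w i j).
Proof.
have -> : (fun w => X w i j) = fun w => l i w * mu j w + Z i j w.
  by apply/funext => w; rewrite XE mxE.
by apply: measurable_funD => //; exact: measurable_funM.
Qed.

Let pR : (0 : R) < p%:R. Proof. by rewrite ltr0n. Qed.
Let nR : (0 : R) < n%:R. Proof. by rewrite ltr0n. Qed.
Let peps0 : 0 < p%:R * eps. Proof. exact: mulr_gt0. Qed.

Let few_signals := [set w | p%:R * eps / 2 <= `|\sum_j signal j w - p%:R * eps|].

Let measurable_few_signals : measurable few_signals.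
Proof.
rewrite -[X in measurable X]setTI; apply: (@measurable_fun_le _ _ R setT (cst (p%:R * eps / 2))) => //.
apply: measurableT_comp => //; apply: measurable_funB => //.
by apply: measurable_sum => j; exact: L1_measurable.
Qed.

Let few_signalsN w : ~ few_signals w -> p%:R * eps / 2 <= \sum_j signal j w.
Proof. by move=> /negP; rewrite -ltNge ltr_norml => /andP[h _]; have := h; lra. Qed.

Let error_bound (E A : set Omega) (a : R) : measurable E -> measurable A ->
  (forall w, regular w -> ~ few_signals w -> ~ A w -> ~ E w) ->
  (P A <= a%:E -> P E <= (4 / (p%:R * eps) + a)%:E)%E.
Proof.
move=> mE mA H PA.
have mR : measurable (~` [set w | regular w]) by exact: measurableC.
apply: (@le_trans _ _ (P (~` [set w | regular w] `|` (few_signals `|` A)))).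
  apply: le_measure; rewrite ?inE//.
    by apply: measurableU => //; exact: measurableU.
  move=> w Ew; apply: contrapT => /not_orP[/contrapT rw /not_orP[fw Aw]].
  exact: H rw fw Aw Ew.
apply: le_trans (measureU2 _ _ _) _ => //; first exact: measurableU.
rewrite [X in (X + _)%E]regular_ae add0e EFinD.
apply: le_trans (measureU2 _ _ _) _ => //.
by apply: leeD => //; exact: signal_count_bound.
Qed.

(** Each row sum is a label times [M], plus noise, where [M >= M0] once at least half the expected
    number of signals is present. Squaring removes the label. Outside the two Chebyshev events the
    linear noise costs at most [n * M ^ 2 / 4] and the quadratic one [n * M0 ^ 2 / 4], which leaves
    [n * M0 ^ 2 / 2]. *)
Lemma sa_alt_bound (M0 : R) : M0 = tau * (p%:R * eps / 2) ->
    2 * Num.sqrt (2 * ln p%:R) * Num.sqrt (2 * n%:R) <= n%:R * M0 ^+ 2 / (2 * p%:R) ->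
  (P [set w | ~~ sa_test (X w)] <= (4 / (p%:R * eps) +
    ((n%:R * p%:R) / (n%:R * M0 / 8) ^+ 2 +
     (C4 + 3) * (n%:R * p%:R ^+ 2) / (n%:R * M0 ^+ 2 / 4) ^+ 2))%:E)%E.
Proof.
move=> M0E H.
have M00 : 0 < M0 by rewrite M0E mulr_gt0// divr_gt0.
have [mq iq eq] := quadratic_noise_moment indV zinj nz.
have [ml il el] := linear_noise_moment indV zinj nz labinj labz.
pose A2 := [set w | n%:R * M0 / 8 <= `|linear_noise V z lab w|].
pose A3 := [set w | n%:R * M0 ^+ 2 / 4 <= `|quadratic_noise V z w|].
have mA2 : measurable A2.
  rewrite -[X in measurable X]setTI; apply: (@measurable_fun_le _ _ R setT (cst (n%:R * M0 / 8))) => //.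
  exact: measurableT_comp.
have mA3 : measurable A3.
  rewrite -[X in measurable X]setTI; apply: (@measurable_fun_le _ _ R setT (cst (n%:R * M0 ^+ 2 / 4))) => //.
  exact: measurableT_comp.
apply: (@error_bound _ (A2 `|` A3)).
- rewrite (_ : [set w | ~~ sa_test (X w)] = ~` [set w | sa_test (X w)]).
    by apply: measurableC; exact: measurable_sa.
  by apply/seteqP; split => w /= /negP.
- exact: measurableU.
- move=> w [lE muE] /few_signalsN cnt /not_orP[/negP nA2 /negP nA3] /negP; apply.
  move: nA2 nA3; rewrite -!ltNge !ltr_norml => /andP[q1 _] /andP[q2 _].
  rewrite /sa_test standardize_xbar// [leRHS]mulrC ler_pdivlMr; last first.
    by rewrite sqrtr_gt0 mulr_gt0.
  apply: (le_trans H).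
  pose M := tau * \sum_j signal j w.
  have MM0 : M0 <= M by rewrite M0E ler_pM2l.
  have rowE i : \sum_j X w i j = sg i w * M + vsum V (row_indices z i) w.
    rewrite vsum_row /M mulr_sumr mulr_sumr -big_split /=; apply: eq_bigr => j _.
    by rewrite XE mxE lE muE.
  have -> : (\sum_i (\sum_j X w i j) ^+ 2) / p%:R - n%:R =
      (n%:R * M ^+ 2 + 2 * M * linear_noise V z lab w + quadratic_noise V z w) / p%:R.
    have -> : \sum_i (\sum_j X w i j) ^+ 2 =
        n%:R * M ^+ 2 + 2 * M * linear_noise V z lab w + (quadratic_noise V z w + n%:R * p%:R).
      rewrite /quadratic_noise sumrB sumr_const card_ord -[p%:R *+ n]mulr_natl subrK.
      rewrite /linear_noise mulr_sumr.
      have -> : n%:R * M ^+ 2 = \sum_(i < n) M ^+ 2 by rewrite sumr_const card_ord mulr_natl.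
      rewrite -!big_split /=; apply: eq_bigr => i _.
      rewrite rowE sqrrD exprMn label_sign_sqr mul1r -mulr_natl.
      by rewrite -/(sg i w); congr (_ + _); congr (_ + _); ring.
    by field; rewrite gt_eqF.
  have -> : n%:R * M0 ^+ 2 / (2 * p%:R) = (n%:R * M0 ^+ 2 / 2) / p%:R.
    by field; rewrite gt_eqF.
  rewrite ler_pM2r ?invr_gt0//.
  have h1 : M0 ^+ 2 <= M ^+ 2 by rewrite lerXn2r// nnegrE ltW// (lt_le_trans M00).
  have h2 : n%:R * M0 ^+ 2 <= n%:R * M ^+ 2 by rewrite ler_pM2l.
  have M_0 : 0 < M := lt_le_trans M00 MM0.
  have h3 : 2 * M * (- (n%:R * M0 / 8)) <= 2 * M * linear_noise V z lab w.
    by apply: ler_wpM2l; [rewrite mulr_ge0// ltW|exact: ltW].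
  have h4 : n%:R * M * M0 <= n%:R * M ^+ 2 by rewrite expr2 mulrA ler_pM2l// mulr_gt0.
  lra.
- apply: le_trans (measureU2 _ mA2 mA3) _; rewrite EFinD; apply: leeD.
    by apply: chebyshev_ineq => //; [rewrite divr_gt0 ?mulr_gt0|rewrite el].
  by apply: chebyshev_ineq => //; rewrite divr_gt0 ?mulr_gt0 ?exprn_gt0.
Qed.

(** One signal column with noise below [x = n * tau ^ 2 / 2] suffices. If there were none, the
    squared noises over signal columns would sum to at least [x ^ 2] times the number of signals; in
    Markov's inequality [p * eps] then cancels. *)
Lemma hc_alt_bound : (1 < p)%N -> 0 < hc_threshold R p ->
    hc_threshold R p <= Num.sqrt p%:R / 2 ->
    expR (4^-1 - (n%:R * tau ^+ 2 / 2) / (4 * Num.sqrt n%:R)) <= p%:R ^- 2 ->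
  (P [set w | ~~ hc_test (X w)] <= (4 / (p%:R * eps) +
     8 * (8 * tau ^+ 2 + 2 * C4) / (n%:R * tau ^+ 4))%:E)%E.
Proof.
move=> p1 t0 tp H.
pose x := n%:R * tau ^+ 2 / 2.
have x0 : 0 < x by rewrite divr_gt0// mulr_gt0// exprn_gt0.
pose Kj (j : 'I_p) : {set 'I_n + 'I_p + 'I_n * 'I_p} := [set k | k != inl (inr j)]%SET.
have cm j := column_noise_moment indV zinj nz labinj labz tau (j := j) (K := Kj j)
  (fun i => ltac:(by rewrite inE)) (fun i => ltac:(by rewrite inE)).
pose Y j w := signal j w * column_noise V z lab tau j w ^+ 2.
have YE j : L1 P (Y j) /\ mean P (Y j) <= eps * (n%:R * (8 * tau ^+ 2 + 2 * C4)).
  have [dc ic ec] := cm j.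
  have dc2 : depends_on V (Kj j) (fun w => column_noise V z lab tau j w ^+ 2).
    exact: depends_onX.
  have [|iY mY] := @independent_mean _ _ _ P (signal j) _ _ (L1_signal j) ic.
    refine (independent_pair_blocks indV _ (@depends_on_signal j) dc2) => k.
    by rewrite !inE negbK.
  by split => //; rewrite /Y mY mean_signal ler_pM2l.
have iS : L1 P (fun w => \sum_j Y j w) by apply: L1_sum => j; case: (YE j).
have eS : mean P (fun w => \sum_j Y j w) <= p%:R * (eps * (n%:R * (8 * tau ^+ 2 + 2 * C4))).
  rewrite mean_sum; last by move=> j; case: (YE j).
  apply: (le_trans (ler_sum _ (fun j _ => (YE j).2))).
  by rewrite sumr_const card_ord -[leLHS]mulr_natl.
have Y0 w : 0 <= \sum_j Y j w.
  by apply: sumr_ge0 => j _; rewrite mulr_ge0 ?sqr_ge0// /signal; case: ifP.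
pose y := p%:R * eps / 2 * x ^+ 2.
have y0 : 0 < y by apply: mulr_gt0; [exact: divr_gt0|exact: exprn_gt0].
pose A := [set w | y <= \sum_j Y j w].
have mA : measurable A.
  rewrite -[X in measurable X]setTI; apply: (@measurable_fun_le _ _ R setT (cst y)) => //.
  exact: (L1_measurable iS).
apply: (@error_bound _ A) => //.
- rewrite (_ : [set w | ~~ hc_test (X w)] = ~` [set w | hc_test (X w)]).
    by apply: measurableC; exact: measurable_hc.
  by apply/seteqP; split => w /= /negP.
- move=> w [lE muE] /few_signalsN cnt /negP; rewrite -ltNge => Sy /negP; apply.
  have [j jP] : exists j, mu j w = tau /\ `|column_noise V z lab tau j w| < x.
    apply: contrapT => nj; move: Sy; rewrite ltNge => /negP; apply.
    apply: (@le_trans _ _ (\sum_j signal j w * x ^+ 2)).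
      by rewrite -mulr_suml ler_pM2r// exprn_gt0.
    apply: ler_sum => j _; rewrite /Y /signal; case: eqP => mj; last by rewrite !mul0r.
    rewrite !mul1r -[leRHS]real_normK ?num_real// lerXn2r ?nnegrE ?(ltW x0)//.
    by rewrite leNgt; apply/negP => cx; apply: nj; exists j.
  have [mj /ltr_normlP[cx _]] := jP.
  have sq : n%:R + x <= sqnorm (col j (X w)).
    have -> : sqnorm (col j (X w)) = n%:R * tau ^+ 2 + column_noise V z lab tau j w + n%:R.
      rewrite /column_noise /sqnorm.
      have -> : n%:R * tau ^+ 2 = \sum_(i < n) tau ^+ 2 by rewrite sumr_const card_ord mulr_natl.
      have -> : n%:R = \sum_(i < n) 1 :> R by rewrite sumr_const card_ord.
      rewrite -!big_split /=; apply: eq_bigr => i _.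
      rewrite mxE XE mxE mj lE sqrrD exprMn label_sign_sqr mul1r -mulr_natl /sg.
      by ring.
    by rewrite /x in cx *; lra.
  have piE := pvalueE (X w) j n0.
  have pi_le : pvalue (X w) j <= p%:R ^- 2.
    rewrite piE; apply: le_trans H; apply: (le_trans (@chi2_survival_nonincreasing R n _ _ sq)).
    rewrite -lee_fin fineK ?fin_num_measure//; last exact: measurable_ge.
    exact: chi2_tail.
  have pi_gt k : 0 < pvalue (X w) k.
    rewrite pvalueE// -lte_fin fineK ?fin_num_measure//; last exact: measurable_ge.
    exact: chi2_tail_gt0.
  apply/hc_testP; exists 1%N; first by rewrite -divn2 divn_gt0.
  rewrite HC_ge//; set v := sorted_pvalue _ _.
  have p0' : (0 < 1 <= p)%N by [].
  have v1 : v <= p%:R ^- 2.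
    rewrite sorted_pvalue_le//; apply/card_gt0P; exists j.
    by rewrite inE.
  have v0 : 0 < v.
    rewrite ltNge sorted_pvalue_le//; apply/card_gt0P => -[k].
    by rewrite inE leNgt pi_gt.
  have p2 : 2 <= p%:R :> R by rewrite ler_nat.
  have pV : p%:R^-1 <= 2^-1 :> R by rewrite lef_pV2 ?posrE.
  have pV0 : 0 < p%:R^-1 :> R by rewrite invr_gt0.
  have v1' : v <= p%:R^-1 ^+ 2 by rewrite exprVn.
  have v12 : v <= 2^-1 by nra.
  apply/andP; split; first by rewrite mulr_gt0// subr_gt0; lra.
  have sv : Num.sqrt (v * (1 - v)) <= p%:R^-1.
    rewrite -[leRHS]ger0_norm ?(ltW pV0)// -sqrtr_sqr ler_sqrt ?sqr_ge0//.
    by apply: le_trans v1'; nra.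
  (* At rank 1 the ratio is at least [sqrt p * (1 / p - 1 / p ^ 2) * p], hence at least [sqrt p / 2]
     as [p >= 2]. *)
  apply: (@le_trans _ _ (Num.sqrt p%:R / 2 * p%:R^-1)).
    by rewrite ler_pM ?sqrtr_ge0// ltW.
  rewrite -mulrA ler_wpM2l ?sqrtr_ge0// mul1r; nra.
- apply: (le_trans (markov_ineq y0 Y0 iS eS)); rewrite lee_fin le_eqVlt; apply/orP; left; apply/eqP.
  by rewrite /y /x; field; rewrite !gt_eqF.
Qed.

End Alternative.

(** * Asymptotics *)

Section Asymptotics.
Variable R : realType.
Implicit Types (M c g : R).

Lemma near_ln_ge M : \forall p \near \oo, M <= ln p%:R :> R.
Proof.
near=> p; rewrite -[M]expRK ler_ln ?posrE ?expR_gt0//.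
  by near: p; exact: nbhs_infty_ger.
by rewrite ltr0n; near: p; exact: nbhs_infty_gt.
Unshelve. all: by end_near.
Qed.

(** [exp (g * ln p)] dominates [(g * ln p) ^ 2 / 2], which is quadratic in [ln p]. *)
Lemma near_mul_ln_le_powR M g : 0 < g -> \forall p \near \oo, M * ln p%:R <= p%:R `^ g :> R.
Proof.
move=> g0; near=> p.
have p0 : (0 : R) < p%:R by rewrite ltr0n; near: p; exact: nbhs_infty_gt.
have L0 : 0 <= ln p%:R :> R by near: p; exact: near_ln_ge.
have LM : `|M| * 2 / g ^+ 2 <= ln p%:R by near: p; exact: near_ln_ge.
rewrite /powR gt_eqF//; set L := ln p%:R in L0 LM *.
have gL0 : 0 <= g * L by rewrite mulr_ge0// ltW.
have := @expR_ge1Dxn R (g * L) 1 gL0.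
have -> : (2`!%:R = 2 :> R) by [].
apply: le_trans; rewrite exprMn.
have g2 : 0 < g ^+ 2 by rewrite exprn_gt0.
move: LM; rewrite ler_pdivrMr// => LM.
have := ler_norm M; nra.
Unshelve. all: by end_near.
Qed.

Lemma near_powR_ge M g : 0 < g -> \forall p \near \oo, M <= p%:R `^ g :> R.
Proof.
move=> g0; near=> p.
have L1 : 1 <= ln p%:R :> R by near: p; exact: near_ln_ge.
have H : `|M| * ln p%:R <= p%:R `^ g by near: p; exact: near_mul_ln_le_powR.
apply: le_trans H; have := ler_norm M; have := normr_ge0 M; nra.
Unshelve. all: by end_near.
Qed.

Lemma vanish_div c (f : nat -> R) : (forall M, \forall p \near \oo, M <= f p) ->
  c / f p @[p --> \oo] --> 0.
Proof.
move=> fy; apply/cvgr0Pnorm_le => e e0; near=> p.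
have f1 : 1 <= f p by near: p; exact: fy.
have fM : `|c| / e <= f p by near: p; exact: fy.
have f0 : 0 < f p by lra.
rewrite normrM normfV (gtr0_norm f0) ler_pdivrMr// mulrC.
by move: fM; rewrite ler_pdivrMr.
Unshelve. all: by end_near.
Qed.

Lemma vanish_powR c g : 0 < g -> c * p%:R `^ (- g) @[p --> \oo] --> 0.
Proof.
move=> g0; under eq_fun do rewrite powRN.
by apply: vanish_div => M; exact: near_powR_ge.
Qed.

Lemma vanish_expRN (f : nat -> R) c : (forall M, \forall p \near \oo, M <= f p) ->
  c * expR (- f p) @[p --> \oo] --> 0.
Proof.
move=> fy; under eq_fun do rewrite expRN.
apply: vanish_div => M; near=> p; apply: le_trans (expR_ge1Dx _).
by rewrite -lerBlDl; near: p; exact: fy.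
Unshelve. all: by end_near.
Qed.

Lemma vanishing_error (E : nat -> \bar R) (b : nat -> R) : (forall p, (0 <= E p)%E) ->
  (\forall p \near \oo, (E p <= (b p)%:E)%E) -> b p @[p --> \oo] --> 0 ->
  E p @[p --> \oo] --> 0%E.
Proof.
move=> E0 Eb b0.
apply: (squeeze_cvge (f := cst 0%E) (h := EFin \o b)).
- by near=> p; rewrite E0 /=; near: p.
- exact: cvg_cst.
- by apply/fine_cvgP; split => //; exact: nearW.
Unshelve. all: by end_near.
Qed.

End Asymptotics.

(** * From error bounds to powers of p *)

Section PowerAlgebra.
Variable R : realType.
Variables (P T a n v C : R).
Hypotheses (P0 : 0 < P) (T0 : 0 < T) (a0 : 0 < a) (v0 : 0 < v) (nT : T / 2 <= n).

Let n0 : 0 < n. Proof. by apply: lt_le_trans nT; rewrite divr_gt0. Qed.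

(** In use, [P], [T] and [a] are [p], [p ^ theta] and [p * tau * eps], so that [a / 2] is [M0], and
    [v] is the power of [p] by which signal beats noise. Rounding of the sample size is absorbed by
    [T / 2 <= n]. *)
Lemma linear_term_le : T * a ^+ 2 = v * P ->
  n * P / (n * (a / 2) / 8) ^+ 2 <= 512 * v^-1.
Proof.
move=> H.
have -> : n * P / (n * (a / 2) / 8) ^+ 2 = 256 * P / (n * a ^+ 2).
  by field; rewrite !gt_eqF.
have na : v * P / 2 <= n * a ^+ 2.
  by rewrite -H mulrAC ler_pM2r ?exprn_gt0.
have vP : 0 < v * P / 2 by rewrite divr_gt0 ?mulr_gt0.
apply: (@le_trans _ _ (256 * P / (v * P / 2))).
  apply: ler_wpM2l; first by rewrite mulr_ge0// ltW.
  by rewrite lef_pV2 ?posrE//; exact: (lt_le_trans vP na).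
by rewrite le_eqVlt; apply/orP; left; apply/eqP; field; rewrite !gt_eqF.
Qed.

Lemma quadratic_term_le : 0 <= C -> T * a ^+ 4 = v * P ^+ 2 ->
  C * (n * P ^+ 2) / (n * (a / 2) ^+ 2 / 4) ^+ 2 <= 512 * C * v^-1.
Proof.
move=> C0 H.
have -> : C * (n * P ^+ 2) / (n * (a / 2) ^+ 2 / 4) ^+ 2 = 256 * C * P ^+ 2 / (n * a ^+ 4).
  by field; rewrite !gt_eqF.
have na : v * P ^+ 2 / 2 <= n * a ^+ 4.
  by rewrite -H mulrAC ler_pM2r ?exprn_gt0.
have vP : 0 < v * P ^+ 2 / 2 by rewrite divr_gt0 ?mulr_gt0 ?exprn_gt0.
apply: (@le_trans _ _ (256 * C * P ^+ 2 / (v * P ^+ 2 / 2))).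
  apply: ler_wpM2l; first by apply: mulr_ge0; [exact: mulr_ge0|exact: sqr_ge0].
  by rewrite lef_pV2 ?posrE//; exact: (lt_le_trans vP na).
by rewrite le_eqVlt; apply/orP; left; apply/eqP; field; rewrite !gt_eqF.
Qed.

Lemma sa_threshold_le L : 0 <= L -> 2048 * L <= v -> T * a ^+ 4 = v * P ^+ 2 ->
  2 * Num.sqrt (2 * L) * Num.sqrt (2 * n) <= n * (a / 2) ^+ 2 / (2 * P).
Proof.
move=> L0 Lv H.
have -> : 2 * Num.sqrt (2 * L) * Num.sqrt (2 * n) = Num.sqrt (16 * L * n).
  rewrite -mulrA -sqrtrM ?mulr_ge0//.
  have -> : 16 * L * n = 2 ^+ 2 * (2 * L * (2 * n)) by ring.
  by rewrite [RHS]sqrtrM ?sqr_ge0// sqrtr_sqr ger0_norm.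
have r0 : 0 <= n * (a / 2) ^+ 2 / (2 * P).
  by rewrite divr_ge0 ?mulr_ge0 ?sqr_ge0 ?ltW.
rewrite -[leRHS]ger0_norm// -sqrtr_sqr ler_sqrt ?sqr_ge0//.
(* After squaring and dividing by [n] the claim is [16 * L <= n * a ^ 4 / P ^ 2 / 64]; with
   [n * a ^ 4 / P ^ 2 >= v / 2] this gives the constant 2048. *)
have -> : (n * (a / 2) ^+ 2 / (2 * P)) ^+ 2 = n * (n * a ^+ 4 / P ^+ 2) / 64.
  by field; rewrite gt_eqF.
have h : v / 2 <= n * a ^+ 4 / P ^+ 2.
  rewrite ler_pdivlMr ?exprn_gt0// mulrAC -H mulrAC ler_pM2r ?exprn_gt0//.
have := n0; nra.
Qed.

End PowerAlgebra.

(** * Consistency of each test on its side of the curve *)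

Section Consistency.
Variables (R : realType) (alpha beta theta : R) (n : nat -> nat).
Variables (d0 : nat -> measure_display) (Omega0 : forall p, measurableType (d0 p))
  (P0 : forall p, probability (Omega0 p) R)
  (X0 : forall p, Omega0 p -> 'M[R]_(n p, p))
  (d1 : nat -> measure_display) (Omega1 : forall p, measurableType (d1 p))
  (P1 : forall p, probability (Omega1 p) R)
  (X1 : forall p, Omega1 p -> 'M[R]_(n p, p)).
Hypotheses (halpha : 0 < alpha < 1) (hbeta : 0 < beta < 1) (htheta : 0 < theta < 1).
Hypothesis hn : forall p, `|(n p)%:R - p%:R `^ theta| < 1.
Hypotheses (hnull : forall p, null_model (P0 p) (@X0 p))
  (harw : forall p, arw_model (P1 p) alpha beta (@X1 p)).
Local Notation C4 := (@normal_kurtosis R).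

Let C40 : 0 <= C4.
Proof. by apply: Rintegral_ge0 => x _; rewrite exprn_even_ge0. Qed.

Let Err_ge0 (T : forall p, 'M[R]_(n p, p) -> bool) p :
  (0 <= Err (P0 p) (@X0 p) (P1 p) (@X1 p) (@T p))%E.
Proof. by rewrite /Err adde_ge0. Qed.

Let near_sample_size : \forall p \near \oo,
  [/\ (1 < p)%N, 0 < p%:R `^ theta :> R, p%:R `^ theta / 2 <= (n p)%:R & (0 < n p)%N].
Proof.
have [theta0 _] := andP htheta.
near=> p.
have p1 : (1 < p)%N by near: p; exact: nbhs_infty_gt.
have T2 : 2 <= p%:R `^ theta :> R by near: p; exact: near_powR_ge.
have := hn p; rewrite ltr_norml => /andP[h1 _].
have nT : p%:R `^ theta / 2 <= (n p)%:R by lra.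
split => //; first by lra.
by rewrite -(ltr0n R); lra.
Unshelve. all: by end_near.
Qed.

Lemma sa_consistency : alpha < (2 + theta - 4 * beta) / 4 ->
  Err (P0 p) (@X0 p) (P1 p) (@X1 p) (@sa_test R (n p) p) @[p --> \oo] --> 0%E.
Proof.
move=> hc; have [theta0 _] := andP htheta; have [beta0 beta1] := andP hbeta.
(* [e] is four times the gap in the hypothesis on [alpha], and [e2 = (e + theta) / 2] is then
   positive too. *)
pose e := theta + 2 - 4 * alpha - 4 * beta.
pose e2 := theta + 1 - 2 * alpha - 2 * beta.
have e0 : 0 < e by rewrite /e; lra.
have e20 : 0 < e2 by rewrite /e2; move: e0; rewrite /e; lra.
pose b (p : nat) : R := (C4 + 3) / 16 / ln p%:R + (4 * p%:R `^ (- (1 - beta)) +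
  (512 * p%:R `^ (- e2) + 512 * (C4 + 3) * p%:R `^ (- e))).
apply: (@vanishing_error R _ b).
- by move=> p; exact: (Err_ge0 (fun p => @sa_test R (n p) p)).
- near=> p.
  have [p1 T0 nT n0] : [/\ (1 < p)%N, 0 < p%:R `^ theta :> R,
    p%:R `^ theta / 2 <= (n p)%:R & (0 < n p)%N] by near: p.
  have He : 2048 * ln p%:R <= p%:R `^ e :> R by near: p; exact: near_mul_ln_le_powR.
  have p0 : (0 < p)%N by exact: ltnW.
  have pR : (0 : R) < p%:R by rewrite ltr0n.
  have pne : p%:R != 0 :> R by rewrite gt_eqF.
  have pw x : 0 < p%:R `^ x :> R by exact: powR_gt0.
  have pD x y : p%:R `^ (x + y) = p%:R `^ x * p%:R `^ y :> R by rewrite powRD// pne implybT.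
  have p1E : p%:R = p%:R `^ 1 :> R by rewrite powRr1// ltW.
  have L0 : 0 <= ln p%:R :> R by rewrite ln_ge0// ler1n.
  have pXn x k : (p%:R `^ x) ^+ k = p%:R `^ (x * k%:R) :> R.
    by rewrite -powR_mulrn ?(ltW (pw _))// powRrM.
  have [l [mu [Z [ind lP muP nZ XE]]]] := harw p.
  set tau := signal_strength p alpha in muP *; set eps := signal_fraction p beta in muP *.
  pose a : R := p%:R `^ (1 - alpha - beta).
  have a2 : a / 2 = tau * (p%:R * eps / 2).
    by rewrite /a /tau /eps /signal_strength /signal_fraction pD pD -p1E; field.
  have Ha2 : p%:R `^ theta * a ^+ 2 = p%:R `^ e2 * p%:R.
    by rewrite [X in _ = _ * X]p1E /a pXn -!pD; congr powR; rewrite /e2; ring.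
  have Ha4 : p%:R `^ theta * a ^+ 4 = p%:R `^ e * p%:R ^+ 2.
    by rewrite [X in _ = _ * X ^+ 2]p1E /a !pXn -!pD; congr powR; rewrite /e; ring.
  have pe : p%:R * eps = p%:R `^ (1 - beta) by rewrite /eps /signal_fraction pD -p1E.
  rewrite /Err /b EFinD; apply: leeD.
    apply: le_trans (sa_null_bound (hnull p) n0 p1) _.
    rewrite lee_fin le_eqVlt; apply/orP; left; apply/eqP; field.
    by rewrite gt_eqF// ln_gt0// ltr1n.
  apply: le_trans (sa_alt_bound ind lP muP nZ _ _ n0 p0 XE a2 _) _; try exact: pw.
    exact: (sa_threshold_le pR T0 (pw _) nT L0 He Ha4).
  rewrite lee_fin lerD//; first by rewrite pe powRN.
  rewrite !powRN; apply: lerD.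
    exact: (linear_term_le pR T0 (pw _) (pw _) nT Ha2).
  by apply: (quadratic_term_le pR T0 (pw _) (pw _) nT _ Ha4); rewrite addr_ge0.
- rewrite -[X in _ --> X]addr0; apply: cvgD.
    by apply: vanish_div => M; exact: near_ln_ge.
  rewrite -[X in _ --> X]addr0; apply: cvgD; first by apply: vanish_powR; lra.
  by rewrite -[X in _ --> X]addr0; apply: cvgD; exact: vanish_powR.
Unshelve. all: by end_near.
Qed.

Lemma hc_consistency : alpha < theta / 4 ->
  Err (P0 p) (@X0 p) (P1 p) (@X1 p) (@hc_test R (n p) p) @[p --> \oo] --> 0%E.
Proof.
move=> hc; have [theta0 _] := andP htheta; have [beta0 beta1] := andP hbeta.
have [alpha0 _] := andP halpha.
pose s (p : nat) : R := 2 * Num.sqrt (ln (ln p%:R)).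
have lnln M : \forall p \near \oo, M <= ln (ln p%:R) :> R.
  near=> p; rewrite -[M]expRK ler_ln ?posrE ?expR_gt0//; first by near: p; exact: near_ln_ge.
  by rewrite (lt_le_trans ltr01)//; near: p; exact: near_ln_ge.
have sy M : \forall p \near \oo, M <= s p.
  near=> p; apply: (@le_trans _ _ (2 * `|M|)); first by have := ler_norm M; have := normr_ge0 M; lra.
  rewrite /s ler_pM2l// -sqrtr_sqr ler_wsqrtr//.
  by near: p; exact: lnln.
have ssy M : \forall p \near \oo, M <= Num.sqrt (s p).
  near=> p; apply: (@le_trans _ _ `|M|); first exact: ler_norm.
  by rewrite -sqrtr_sqr ler_wsqrtr//; near: p; exact: sy.
pose b (p : nat) : R := (expR 1 / Num.sqrt (s p) +
   expR 2^-1 * expR (- (Num.sqrt (s p) / 8)) + 2 * expR (- (s p ^+ 2 / 12))) +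
  (4 * p%:R `^ (- (1 - beta)) + 16 * (8 + 2 * C4) * p%:R `^ (- (theta - 4 * alpha))).
apply: (@vanishing_error R _ b).
- by move=> p; exact: (Err_ge0 (fun p => @hc_test R (n p) p)).
- near=> p.
  have [p1 T0 nT n0] : [/\ (1 < p)%N, 0 < p%:R `^ theta :> R,
    p%:R `^ theta / 2 <= (n p)%:R & (0 < n p)%N] by near: p.
  have L1 : 1 <= ln p%:R :> R by near: p; exact: near_ln_ge.
  have LL1 : 1 <= ln (ln p%:R) :> R by near: p; exact: lnln.
  have s1 : 1 <= s p by near: p; exact: sy.
  (* This makes [sqrt n * tau ^ 2 / 8] at least [(36 / 16) * ln p], which covers [2 * ln p + 1 / 4]
     as [ln p >= 1]. *)
  have He : 36 * ln p%:R <= p%:R `^ (theta / 2 - 2 * alpha) :> R.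
    by near: p; apply: near_mul_ln_le_powR; lra.
  (* The threshold is at most [sqrt p / 2] exactly when [32 * ln (ln p) <= p]. *)
  have Lp : 32 * ln p%:R <= p%:R `^ 1 :> R by near: p; exact: near_mul_ln_le_powR.
  have p0 : (0 < p)%N by exact: ltnW.
  have pR : (0 : R) < p%:R by rewrite ltr0n.
  have pne : p%:R != 0 :> R by rewrite gt_eqF.
  have pw x : 0 < p%:R `^ x :> R by exact: powR_gt0.
  have pD x y : p%:R `^ (x + y) = p%:R `^ x * p%:R `^ y :> R by rewrite powRD// pne implybT.
  have p1E : p%:R = p%:R `^ 1 :> R by rewrite powRr1// ltW.
  have pXn x k : (p%:R `^ x) ^+ k = p%:R `^ (x * k%:R) :> R.
    by rewrite -powR_mulrn ?(ltW (pw _))// powRrM.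
  rewrite -p1E in Lp.
  have tE : hc_threshold R p = Num.sqrt 2 * s p.
    by rewrite /hc_threshold /s sqrtrM// mulrCA.
  have t0 : 0 < hc_threshold R p by rewrite tE mulr_gt0 ?sqrtr_gt0//; lra.
  have s2 : s p ^+ 2 = 4 * ln (ln p%:R).
    by rewrite /s exprMn sqr_sqrtr; [ring|lra].
  have [l [mu [Z [ind lP muP nZ XE]]]] := harw p.
  set tau := signal_strength p alpha in muP *; set eps := signal_fraction p beta in muP *.
  have pe : p%:R * eps = p%:R `^ (1 - beta) by rewrite /eps /signal_fraction pD -p1E.
  have tau0 : 0 < tau := pw _.
  have tau1 : tau <= 1.
    by rewrite -[leRHS](powRr0 p%:R) ler_powR ?ler1n// oppr_le0 ltW.
  have nR : 0 < (n p)%:R :> R by rewrite ltr0n.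
  rewrite /Err /b EFinD; apply: leeD.
    (* As [e <= 4], having [N >= ln p] gives [p <= 4 ^ N], so [N] blocks reach every level. With
       [N <= 2 * ln p] and [s ^ 2 / 3 = (4 / 3) * ln (ln p)] they contribute at most
       [2 * (ln p) ^ (-1/3)]. *)
    pose N := (Num.truncn (ln p%:R : R)).+1.
    have LN : ln p%:R <= N%:R :> R by rewrite ltW// truncnS_gt.
    have NL : N%:R <= 2 * ln p%:R :> R.
      have /andP[h _] := truncn_itv (le_trans ler01 L1).
      by rewrite /N -natr1; lra.
    have pN : p%:R <= 16 * s p ^+ 2 * 4 ^+ N.
      apply: (@le_trans _ _ (4 ^+ N)); last first.
        by rewrite ler_peMl ?exprn_ge0// s2; lra.
      have e4 : expR 1 <= 4 :> R.
        have h := @expR_le_quadratic R 2^-1 _ _.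
        have -> : 1 = 2^-1 + 2^-1 :> R by field.
        have h2 : expR (2^-1) <= 2 :> R by apply: le_trans (h _ _) _; lra.
        by rewrite expRD; have := expR_gt0 (2^-1 : R); nra.
      rewrite -[leLHS]lnK ?posrE//; apply: (@le_trans _ _ (expR (1 * N%:R))).
        by rewrite ler_expR mul1r.
      by rewrite expRM_natr; apply: lerXn2r; rewrite ?nnegrE ?expR_ge0.
    apply: le_trans (hc_null_bound (hnull p) n0 p0 s1 tE pN) _.
    rewrite lee_fin; apply: lerD; first by rewrite lerD2l expRD.
    have -> : s p ^+ 2 / 12 = ln (ln p%:R) / 3 by rewrite s2; field.
    have -> : - (s p ^+ 2 / 3) = - ln (ln p%:R) + - (ln (ln p%:R) / 3) by rewrite s2; field.
    rewrite expRD mulrA ler_pM2r ?expR_gt0// expRN lnK ?posrE; last by lra.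
    by rewrite ler_pdivrMr//; lra.
  have r0 : 0 < Num.sqrt (n p)%:R :> R by rewrite sqrtr_gt0.
  apply: le_trans (hc_alt_bound ind lP muP nZ _ _ n0 p0 XE p1 t0 _ _) _; try exact: pw.
  - rewrite /hc_threshold ler_pdivlMr// mulrAC -[2 * 2]/(2 ^+ 2) -{1}(ger0_norm (_ : 0 <= 2 ^+ 2 :> R))//.
    rewrite -sqrtr_sqr -sqrtrM ?sqr_ge0// ler_sqrt//.
    have := ln_sublinear (lt_le_trans ltr01 L1); lra.
  - have -> : p%:R ^- 2 = expR (- (2 * ln (p%:R : R))) :> R.
      by rewrite expRN -[p%:R in LHS](lnK (_ : p%:R \is Num.pos)) ?posrE// -expRM_natl.
    rewrite ler_expR.
    have -> : (n p)%:R * tau ^+ 2 / 2 / (4 * Num.sqrt (n p)%:R) = Num.sqrt (n p)%:R * tau ^+ 2 / 8.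
      rewrite -{1}(sqr_sqrtr (ltW nR)); move: (Num.sqrt _) r0 => r r0.
      by field; rewrite gt_eqF.
    have h : p%:R `^ (theta / 2) / 2 <= Num.sqrt (n p)%:R.
      rewrite -[leLHS]ger0_norm ?divr_ge0 ?(ltW (pw _))// -sqrtr_sqr ler_wsqrtr//.
      rewrite exprMn pXn (_ : theta / 2 * 2%:R = theta); last by field.
      have := pw theta; rewrite (_ : (2^-1 : R) ^+ 2 = 4^-1); last by field.
      lra.
    have h2 : p%:R `^ (theta / 2 - 2 * alpha) / 2 <= Num.sqrt (n p)%:R * tau ^+ 2.
      rewrite pD mulrAC /tau /signal_strength pXn (_ : - alpha * 2%:R = - (2 * alpha)); last by ring.
      by rewrite ler_pM2r.
    lra.
  rewrite lee_fin; apply: lerD; first by rewrite pe powRN.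
  have h : p%:R `^ (theta - 4 * alpha) / 2 <= (n p)%:R * tau ^+ 4.
    rewrite pD mulrAC /tau /signal_strength pXn (_ : - alpha * 4%:R = - (4 * alpha)); last by ring.
    by rewrite ler_pM2r.
  have nt0 : 0 < (n p)%:R * tau ^+ 4 by rewrite mulr_gt0// exprn_gt0.
  rewrite powRN ler_pdivrMr// mulrAC ler_pdivlMr//.
  have t21 : tau ^+ 2 <= 1 by rewrite expr_le1// ltW.
  have := pw (theta - 4 * alpha); have := C40.
  have : 8 * (8 * tau ^+ 2 + 2 * C4) <= 8 * (8 + 2 * C4) by lra.
  move: h; set x := p%:R `^ _; set y := (n p)%:R * _; set u := 8 * (8 * _ + _).
  nra.
- rewrite -[X in _ --> X]addr0; apply: cvgD.
    rewrite -[X in _ --> X]addr0; apply: cvgD.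
      rewrite -[X in _ --> X]addr0; apply: cvgD; first exact: vanish_div.
      apply: vanish_expRN => M; near=> p; rewrite ler_pdivlMr//; near: p; exact: ssy.
    apply: vanish_expRN => M; near=> p; rewrite ler_pdivlMr//.
    have s1 : 1 <= s p by near: p; exact: sy.
    have sM : `|M| * 12 <= s p by near: p; exact: sy.
    by have := ler_norm M; nra.
  rewrite -[X in _ --> X]addr0; apply: cvgD; apply: vanish_powR; lra.
Unshelve. all: by end_near.
Qed.

End Consistency.

Unset Implicit Arguments.

(* The hypothesis on n says that n p is p ^ theta rounded, up or down, to an
   integer. *)
Theorem theorem4p3 (R : realType) (alpha beta theta : R) (n : nat -> nat)
    (d0 : nat -> measure_display) (Omega0 : forall p, measurableType (d0 p))
    (P0 : forall p, probability (Omega0 p) R)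
    (X0 : forall p, Omega0 p -> 'M[R]_(n p, p))
    (d1 : nat -> measure_display) (Omega1 : forall p, measurableType (d1 p))
    (P1 : forall p, probability (Omega1 p) R)
    (X1 : forall p, Omega1 p -> 'M[R]_(n p, p))
    (halpha : 0 < alpha < 1) (hbeta : 0 < beta < 1) (htheta : 0 < theta < 1)
    (hcurve : alpha < eta_hyp theta beta)
    (hn : forall p, `|(n p)%:R - p%:R `^ theta| < 1)
    (hnull : forall p, null_model (P0 p) (X0 p))
    (harw : forall p, arw_model (P1 p) alpha beta (X1 p)) :
  (beta < 2^-1 ->
     Err (P0 p) (X0 p) (P1 p) (X1 p) (@sa_test R (n p) p)
       @[p --> \oo] --> 0%E) /\
  (2^-1 < beta ->
     Err (P0 p) (X0 p) (P1 p) (X1 p) (@hc_test R (n p) p)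
       @[p --> \oo] --> 0%E).
Proof.
have maxE : eta_hyp theta beta = Num.max ((2 + theta - 4 * beta) / 4) (theta / 4) by [].
(* The two terms of the maximum cross at [beta = 1 / 2], so on either side the larger one is the
   condition of the test at hand. *)
move: hcurve; rewrite maxE lt_max => hc; split => hb.
  apply: sa_consistency => //; case/orP: hc => //; lra.
apply: hc_consistency => //; case/orP: hc => //; lra.
Qed.
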